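(* Let $X$ be a metric space and let $\mathscr{U}$ be a uniformly bounded open cover of $X$. Then the natural bijection $\mathrm{id}:|\mathcal{V}(\mathscr{U})|\to \mathcal{V}^m(\mathscr{U})$ induces isomorphisms of singular homology groups and of singular cohomology groups (in every degree, for any choice of coefficients).
   Context: Let $(X,d_X)$ be a metric space and $\mathscr{U}$ a cover of $X$. The cover $\mathscr{U}$ is uniformly bounded if there is $D<\infty$ with $\operatorname{diam}(U)\le D$ for all $U\in\mathscr{U}$. Vietoris complex: $\mathcal{V}(\mathscr{U})$ is the abstract simplicial complex with vertex set $X$ whose simplices are the finite sets $\sigma\subseteq X$ with $\sigma\subseteq U$ for some $U\in\mathscr{U}$. Its geometric realization $|\mathcal{V}(\mathscr{U})|$ is the set of functions $\alpha:X\to[0,1]$ such that $\{x:\alpha(x)\ne0\}$ is a simplex of $\mathcal{V}(\mathscr{U})$ and $\sum_{x\in X}\alpha(x)=1$, with the CW (weak) topology: a set $W$ is open iff $W\cap|\sigma|$ is open in $|\sigma|$ for every simplex $\sigma$, where $|\sigma|$ is the set of $\alpha$ with support in $\sigma$, topologized as a standard simplex. Vietoris metric thickening: $\mathcal{V}^m(\mathscr{U})$ is the set of finitely supported probability measures $\mu$ on $X$ such that $\operatorname{supp}(\mu)\subseteq U$ for some $U\in\mathscr{U}$, with the 1-Wasserstein metric. For $\mu=\sum_i a_i\delta_{x_i}$, $\nu=\sum_j b_j\delta_{y_j}$ (finite sums of weighted Dirac measures), $d_W(\mu,\nu)=\inf\sum_{i,j}\gamma_{i,j}d_X(x_i,y_j)$,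 the infimum being over all $\gamma_{i,j}\ge0$ with $\sum_i\gamma_{i,j}=b_j$ for all $j$ and $\sum_j\gamma_{i,j}=a_i$ for all $i$. The natural bijection sends $\alpha$ to the measure $\sum_{x\in X}\alpha(x)\delta_x$; it is continuous. Coefficients are in an arbitrary abelian group. *)

(* Defs.v *)
From HB Require Import structures.
From mathcomp Require Import all_boot all_order all_algebra finmap.
From mathcomp Require Import all_classical all_reals all_analysis.
(* The notations of monalg clash with those of MathComp-Analysis. *)
From mathcomp Require monalg.
Import -(notations) monalg.

Set Implicit Arguments.
Unset Strict Implicit.
Unset Printing Implicit Defensive.

Import Order.TTheory GRing.Theory Num.Theory.
Import numFieldNormedType.Exports.

Local Open Scope classical_set_scope.
Local Open Scope ring_scope.
Local Open Scope quotient_scope.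

(* Homology at B of a three-term sequence A -f-> B -g-> C: ker g modulo im f.
   No proof that g \o f = 0 is required: boundaries are taken among cycles. *)
Section Homology.
Variables (A B C : zmodType) (f : {additive A -> B}) (g : {additive B -> C}).

Definition is_cycle : {pred B} := [pred z | g z == 0].

Fact is_cycle_zmod_closed : zmod_closed is_cycle.
Proof.
split=> [|x y]; rewrite !inE ?raddf0 // => /eqP gx /eqP gy.
by rewrite raddfB gx gy subr0.
Qed.

HB.instance Definition _ :=
  GRing.isZmodClosed.Build B is_cycle is_cycle_zmod_closed.

Record cycles : Type := Cycle { cycle_val : B; cycleP : cycle_val \in is_cycle }.

HB.instance Definition _ := [isSub for cycle_val].
HB.instance Definition _ := [Choice of cycles by <:].
HB.instance Definition _ := [SubChoice_isSubZmodule of cycles by <:].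

Definition is_boundary : {pred cycles} :=
  [pred z : cycles | `[< exists a, f a = cycle_val z >]].

Lemma is_boundaryP z : reflect (exists a, f a = cycle_val z) (z \in is_boundary).
Proof. exact: asboolP. Qed.

Fact is_boundary_zmod_closed : zmod_closed is_boundary.
Proof.
split=> [|x y]; first by apply/is_boundaryP; exists 0; rewrite raddf0.
move=> /is_boundaryP[a fa] /is_boundaryP[b fb]; apply/is_boundaryP; exists (a - b).
by rewrite raddfB fa fb.
Qed.

HB.instance Definition _ :=
  GRing.isZmodClosed.Build cycles is_boundary is_boundary_zmod_closed.

Definition homology : zmodType := Quotient.quot is_boundary.

Definition homology_class (z : cycles) : homology :=
  \pi_(Quotient.quot is_boundary) z.

Fact homology_class_is_zmod_morphism : zmod_morphism homology_class.
Proof. exact: raddfB. Qed.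

HB.instance Definition _ := GRing.isZmodMorphism.Build _ _ homology_class
  homology_class_is_zmod_morphism.

Lemma homology_classK (h : homology) : homology_class (repr h) = h.
Proof. exact: reprK. Qed.

End Homology.
Arguments is_boundary {A B C} f g _.
Arguments is_boundaryP {A B C f g z}.
Arguments homology_class {A B C} f {g} z.

Record three_term_map (A B C A' B' C' : zmodType)
    (f : {additive A -> B}) (g : {additive B -> C})
    (f' : {additive A' -> B'}) (g' : {additive B' -> C'}) := ThreeTermMap {
  left_map : {additive A -> A'};
  middle_map : {additive B -> B'};
  right_map : {additive C -> C'};
  left_square : forall x, middle_map (f x) = f' (left_map x);
  right_square : forall y, right_map (g y) = g' (middle_map y)
}.

Section HomologyMap.
Variables (A B C A' B' C' : zmodType).
Variables (f : {additive A -> B}) (g : {additive B -> C}).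
Variables (f' : {additive A' -> B'}) (g' : {additive B' -> C'}).
Variable m : three_term_map f g f' g'.

Fact cycles_map_subproof (z : cycles g) : middle_map m (cycle_val z) \in
  is_cycle g'.
Proof. by case: z => z /=; rewrite !inE -right_square => /eqP ->; rewrite raddf0. Qed.

Definition cycles_map (z : cycles g) : cycles g' :=
  Cycle (cycles_map_subproof z).

(* Defined on chosen representatives; homology_map_class shows that the choice
   is irrelevant. *)
Definition homology_map (h : homology f g) : homology f' g' :=
  homology_class f' (cycles_map (repr h)).

Lemma homology_map_class (z : cycles g) :
  homology_map (homology_class f z) = homology_class f' (cycles_map z).
Proof.
apply/eqP; rewrite -Quotient.idealrBE.
have : repr (homology_class f z) - z \in is_boundary f g.
  by rewrite Quotient.idealrBE /homology_class reprK.
move=> /is_boundaryP[x fx]; apply/is_boundaryP; exists (left_map m x).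
by rewrite -left_square fx /= raddfB.
Qed.

Fact homology_map_is_zmod_morphism : zmod_morphism homology_map.
Proof.
move=> h k; rewrite -(homology_classK h) -(homology_classK k) -raddfB.
rewrite !homology_map_class -raddfB; congr homology_class.
by apply: val_inj; rewrite /= raddfB.
Qed.

HB.instance Definition _ := GRing.isZmodMorphism.Build _ _ homology_map
  homology_map_is_zmod_morphism.
End HomologyMap.

Definition is_group_isomorphism (A B : zmodType) (h : {additive A -> B}) :
    Prop :=
  bijective h.

(* malg K G is the group of finitely supported functions K -> G, and
   mkmalgU k g is the function with value g at k and 0 elsewhere. *)
Section Chains.
Variables (K L : choiceType) (G : zmodType) (phi : K -> L).

Definition chain_map (c : malg K G) : malg L G :=
  \sum_(k <- msupp c) mkmalgU (phi k) (mcoeff k c).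

Lemma chain_mapEw (E : {fset K}) (c : malg K G) : (msupp c `<=` E)%fset ->
  chain_map c = \sum_(k <- E) mkmalgU (phi k) (mcoeff k c).
Proof.
move=> cE; apply: big_fset_incl => // k _ kc.
by rewrite mcoeff_outdom// monalgU0.
Qed.

Fact chain_map_is_zmod_morphism : zmod_morphism chain_map.
Proof.
move=> c d; pose E := (msupp c `|` msupp d)%fset.
rewrite (@chain_mapEw E (c - d)) ?msuppB_le//.
rewrite (@chain_mapEw E c) ?fsubsetUl// (@chain_mapEw E d) ?fsubsetUr//.
by rewrite -sumrB; apply: eq_bigr => k _; rewrite !raddfB.
Qed.

HB.instance Definition _ := GRing.isZmodMorphism.Build _ _ chain_map
  chain_map_is_zmod_morphism.

Lemma chain_mapU k (g : G) : chain_map (mkmalgU k g) = mkmalgU (phi k) g.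
Proof. by rewrite (chain_mapEw msuppU_le) big_seq_fset1 mcoeffUU. Qed.

End Chains.

Lemma chain_map_comp (K L M : choiceType) (G : zmodType)
    (phi : K -> L) (psi : L -> M) (c : malg K G) :
  chain_map psi (chain_map phi c) = chain_map (psi \o phi) c.
Proof.
by rewrite raddf_sum/=; apply: eq_bigr => k _; rewrite chain_mapU.
Qed.

Section Singular.
Variable R : realType.

Definition std_simplex n : set 'rV[R]_n.+1 :=
  [set t | (forall i, 0 <= t 0 i) /\ \sum_i t 0 i = 1].
Arguments std_simplex n _ : clear implicits.

Notation simplex n := (set_type (std_simplex n)).

Lemma continuous_mx (T : topologicalType) m n (h : T -> 'M[R]_(m, n)) :
  (forall i j, continuous (fun t => h t i j)) -> continuous h.
Proof.
move=> hc t A [P Pn PA] /=; rewrite nbhs_filterE.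
pose Q (ij : 'I_m * 'I_n) := [set u | P ij.1 ij.2 (h u ij.1 ij.2)].
apply: (filterS (P := [set u | forall ij, Q ij u])).
  by move=> u Qu; apply: PA => i j; exact: (Qu (i, j)).
by apply: filter_forall => -[i j]; apply: hc; exact: Pn.
Qed.

Fact face_subproof n (i : 'I_n.+2) (t : simplex n) :
  \row_j oapp (val t 0) 0 (unlift i j) \in std_simplex n.+1.
Proof.
have [t0 t1] := set_mem (valP t); apply/mem_set; split=> [j|/=].
  by rewrite mxE; case: unlift => /=.
rewrite (bigD1_ord i)//= !mxE unlift_none add0r -[RHS]t1.
by apply: eq_bigr => j _; rewrite mxE liftK.
Qed.

Definition face n (i : 'I_n.+2) (t : simplex n) :
  simplex n.+1 := exist (fun u => u \in std_simplex n.+1) _ (face_subproof i t).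

Fact face_continuous n (i : 'I_n.+2) : continuous (@face n i).
Proof.
apply: continuous_comp_initial; apply: continuous_mx => a j.
rewrite [X in continuous X](_ : _ =
  fun t : simplex n => oapp (val t 0) 0 (unlift i j)); last first.
  by apply/funext => t /=; rewrite mxE.
case: unlift => [k|] /=; last exact: cst_continuous.
move=> t; apply: (@continuous_comp _ _ _ set_val (fun M : 'rV[R]_n.+1 => M 0 k)).
  exact: initial_continuous.
exact: coord_continuous.
Qed.

HB.instance Definition _ n (i : 'I_n.+2) :=
  isContinuous.Build _ _ (@face n i) (@face_continuous n i).

Definition sing_simplex (n : nat) (T : topologicalType) : choiceType :=
  continuousType (simplex n) T.

Definition sing_face n (T : topologicalType) (i : 'I_n.+2)
  (s : sing_simplex n.+1 T) : sing_simplex n T := s \o face i.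

Definition sing_map n (S T : topologicalType) (h : continuousType S T)
  (s : sing_simplex n S) : sing_simplex n T := h \o s.

Section SingularHomology.
Variable G : zmodType.

Definition sing_chain n (T : topologicalType) : zmodType :=
  malg (sing_simplex n T) G.

(* The boundary in degree 0 is the zero map, with a dummy codomain. *)
Definition sing_bd n (T : topologicalType) :
    sing_chain n T -> sing_chain n.-1 T :=
  if n is m.+1 then
    fun c => \sum_(i < m.+2) chain_map (sing_face i) c *~ (-1) ^+ i
  else fun=> 0.

Fact sing_bd_is_zmod_morphism n T : zmod_morphism (@sing_bd n T).
Proof.
case: n => [|n] c d /=; first by rewrite subr0.
by rewrite -sumrB; apply: eq_bigr => i _; rewrite raddfB mulrzBl.
Qed.

HB.instance Definition _ n T := GRing.isZmodMorphism.Build _ _ (@sing_bd n T)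
  (@sing_bd_is_zmod_morphism n T).

Definition sing_homology n (T : topologicalType) : zmodType :=
  @homology (sing_chain n.+1 T) (sing_chain n T) (sing_chain n.-1 T)
    (@sing_bd n.+1 T) (@sing_bd n T).

Definition sing_chain_map n (S T : topologicalType) (h : continuousType S T) :
  sing_chain n S -> sing_chain n T := chain_map (sing_map h).

HB.instance Definition _ n (S T : topologicalType) (h : continuousType S T) :=
  GRing.Additive.copy (@sing_chain_map n S T h) (chain_map (sing_map h)).

Lemma sing_bd_map n (S T : topologicalType) (h : continuousType S T)
    (c : sing_chain n S) :
  sing_chain_map h (sing_bd c) = sing_bd (sing_chain_map h c).
Proof.
case: n c => [|n] c; first by rewrite /= raddf0.
have mapE (i : 'I_n.+2) : sing_chain_map h (chain_map (sing_face i) c) =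
    chain_map (sing_face i) (sing_chain_map h c).
  rewrite /sing_chain_map !chain_map_comp; congr chain_map.
  by apply/funext => s; exact/continuousEP.
by rewrite /= raddf_sum; apply: eq_bigr => i _; rewrite raddfMz /= mapE.
Qed.

Definition sing_homology_map n (S T : topologicalType)
    (h : continuousType S T) :
    {additive sing_homology n S -> sing_homology n T} :=
  homology_map (ThreeTermMap (@sing_bd_map n.+1 S T h) (@sing_bd_map n S T h)).

(* Cochains: Hom(C_n(T; Z), G), that is arbitrary functions from the basis of
   singular simplices to G. *)
Definition sing_cochain n (T : topologicalType) : zmodType :=
  sing_simplex n T -> G.

Definition sing_cobd n (T : topologicalType) (p : sing_cochain n T) :
    sing_cochain n.+1 T :=
  fun s => \sum_(i < n.+2) p (sing_face i s) *~ (-1) ^+ i.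

Fact sing_cobd_is_zmod_morphism n T : zmod_morphism (@sing_cobd n T).
Proof.
move=> p q; apply/funext => s; rewrite !fctE -sumrB.
by apply: eq_bigr => i _; rewrite -mulrzBl.
Qed.

HB.instance Definition _ n T := GRing.isZmodMorphism.Build _ _ (@sing_cobd n T)
  (@sing_cobd_is_zmod_morphism n T).

(* The coboundary arriving in degree n; it is zero for n = 0. *)
Definition sing_cobd_in n (T : topologicalType) :
    sing_cochain n.-1 T -> sing_cochain n T :=
  if n is m.+1 then @sing_cobd m T else fun=> 0.

Fact sing_cobd_in_is_zmod_morphism n T : zmod_morphism (@sing_cobd_in n T).
Proof. by case: n => [|n] p q /=; rewrite ?subr0// raddfB. Qed.

HB.instance Definition _ n T := GRing.isZmodMorphism.Build _ _
  (@sing_cobd_in n T) (@sing_cobd_in_is_zmod_morphism n T).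

Definition sing_cohomology n (T : topologicalType) : zmodType :=
  homology (@sing_cobd_in n T) (@sing_cobd n T).

Definition sing_cochain_map n (S T : topologicalType) (h : continuousType S T)
  (p : sing_cochain n T) : sing_cochain n S := p \o sing_map h.

Fact sing_cochain_map_is_zmod_morphism n (S T : topologicalType)
    (h : continuousType S T) :
  zmod_morphism (@sing_cochain_map n S T h).
Proof. by []. Qed.

HB.instance Definition _ n (S T : topologicalType) (h : continuousType S T) :=
  GRing.isZmodMorphism.Build _ _
  (@sing_cochain_map n S T h) (@sing_cochain_map_is_zmod_morphism n S T h).

Lemma sing_cobd_map n (S T : topologicalType) (h : continuousType S T)
    (p : sing_cochain n T) :
  sing_cochain_map h (sing_cobd p) = sing_cobd (sing_cochain_map h p).
Proof.
apply/funext => s; apply: eq_bigr => i _; rewrite /sing_cochain_map /=.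
by congr (p _ *~ _); exact/continuousEP.
Qed.

Lemma sing_cobd_in_map n (S T : topologicalType) (h : continuousType S T)
    (p : sing_cochain n.-1 T) :
  sing_cochain_map h (sing_cobd_in p) = sing_cobd_in (sing_cochain_map h p).
Proof. by case: n p => [|n] p //; exact: sing_cobd_map. Qed.

Definition sing_cohomology_map n (S T : topologicalType)
    (h : continuousType S T) :
    {additive sing_cohomology n T -> sing_cohomology n S} :=
  homology_map
    (ThreeTermMap (@sing_cobd_in_map n S T h) (@sing_cobd_map n S T h)).

End SingularHomology.
End Singular.

Section Wasserstein.
Variables (R : realType) (X : metricType R).

(* Finitely supported measures are set functions with real values defined on all
   subsets of X. The library's measures need a pointed carrier and may differ on
   non-measurable sets; here two measures are equal iff they have the same
   weights, and X may be empty. *)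
Definition dirac_comb n (a : 'I_n -> R) (x : 'I_n -> X) : set X -> R :=
  fun A => \sum_(i < n) a i * \1_A (x i).

Definition finite_probability (mu : set X -> R) :=
  exists n (a : 'I_n -> R) (x : 'I_n -> X),
    [/\ forall i, 0 <= a i, \sum_i a i = 1 & mu = dirac_comb a x].

Definition msupport (mu : set X -> R) : set X := [set x | mu [set x] != 0].

(* The infimum also ranges over the presentations of mu and nu as finite sums of
   weighted Dirac masses (points may be repeated); its value is that for any
   fixed presentation. *)
Definition transport_costs (mu nu : set X -> R) : set R :=
  [set c | exists m n (a : 'I_m -> R) (x : 'I_m -> X) (b : 'I_n -> R)
      (y : 'I_n -> X) (gamma : 'I_m -> 'I_n -> R),
    [/\ mu = dirac_comb a x, nu = dirac_comb b y & [/\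
        forall i j, 0 <= gamma i j,
        forall j, \sum_i gamma i j = b j,
        forall i, \sum_j gamma i j = a i &
        c = \sum_i \sum_j gamma i j * mdist (x i) (y j)]]].

Definition wasserstein (mu nu : set X -> R) : R := inf (transport_costs mu nu).

Lemma transport_costs_ge0 mu nu : lbound (transport_costs mu nu) 0.
Proof.
move=> _ [m [n [a [x [b [y [g [_ _ [g0 _ _ ->]]]]]]]]].
by do 2 (apply: sumr_ge0 => ? _); rewrite mulr_ge0// mdist_ge0.
Qed.

Lemma wasserstein_le mu nu c : transport_costs mu nu c -> wasserstein mu nu <= c.
Proof. by apply: ge_inf; exists 0; exact: transport_costs_ge0. Qed.

Lemma transport_costs_nonempty mu nu :
  finite_probability mu -> finite_probability nu ->
  transport_costs mu nu !=set0.
Proof.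
move=> [m [a [x [a0 a1 muE]]]] [n [b [y [b0 b1 nuE]]]].
exists (\sum_i \sum_j a i * b j * mdist (x i) (y j)).
exists m, n, a, x, b, y, (fun i j => a i * b j); split=> //; split=> //.
- by move=> i j; rewrite mulr_ge0.
- by move=> j; rewrite -mulr_suml a1 mul1r.
- by move=> i; rewrite -mulr_sumr b1 mulr1.
Qed.

Lemma le_wasserstein mu nu c :
  finite_probability mu -> finite_probability nu ->
  (forall d, transport_costs mu nu d -> c <= d) -> c <= wasserstein mu nu.
Proof. by move=> ? ? cP; apply: lb_le_inf => //; exact: transport_costs_nonempty. Qed.

Lemma wasserstein_ge0 mu nu : finite_probability mu -> finite_probability nu ->
  0 <= wasserstein mu nu.
Proof. by move=> ? ?; apply: le_wasserstein => // c /transport_costs_ge0. Qed.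

Lemma wasserstein_refl mu : finite_probability mu -> wasserstein mu mu = 0.
Proof.
move=> mup; apply/eqP; rewrite eq_le wasserstein_ge0// andbT.
case: (mup) => n [a [x [a0 a1 muE]]]; apply: wasserstein_le.
exists n, n, a, x, a, x, (fun i j => a i *+ (i == j)); split=> //; split.
- by move=> i j; rewrite mulrn_wge0.
- by move=> j; rewrite (bigD1 j)//= eqxx mulr1n big1 ?addr0// => i /negPf ->.
- move=> i; rewrite (bigD1 i)//= eqxx mulr1n big1 ?addr0// => j.
  by rewrite eq_sym => /negPf ->.
- rewrite big1// => i _; rewrite big1// => j _.
  by case: eqVneq => [->|_]; rewrite ?mdistxx ?mulr0// mulr0n mul0r.
Qed.

Lemma transport_costsC mu nu c :
  transport_costs mu nu c -> transport_costs nu mu c.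
Proof.
move=> [m [n [a [x [b [y [g [muE nuE [g0 gr gl ->]]]]]]]]].
exists n, m, b, y, a, x, (fun j i => g i j); split=> //; split=> //.
rewrite exchange_big/=; apply: eq_bigr => j _; apply: eq_bigr => i _.
by rewrite metric_sym.
Qed.

Lemma wassersteinC mu nu : wasserstein mu nu = wasserstein nu mu.
Proof.
by congr inf; apply/seteqP; split=> c; exact: transport_costsC.
Qed.

Lemma dirac_comb_point n (a : 'I_n -> R) (x : 'I_n -> X) p :
  dirac_comb a x [set p] = \sum_i a i * (x i == p)%:R.
Proof.
apply: eq_bigr => i _; rewrite indicE; congr (_ * (nat_of_bool _)%:R).
by apply/idP/eqP; rewrite inE.
Qed.

Lemma dirac_comb_point_ge n (a : 'I_n -> R) (x : 'I_n -> X) i :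
  (forall i, 0 <= a i) -> a i <= dirac_comb a x [set x i].
Proof.
move=> a0; rewrite dirac_comb_point (bigD1 i)//= eqxx mulr1 lerDl.
by apply: sumr_ge0 => j _; rewrite mulr_ge0.
Qed.

Lemma transport_costs_glue mu nu la c d :
  transport_costs mu nu c -> transport_costs nu la d ->
  exists2 e, transport_costs mu la e & e <= c + d.
Proof.
move=> [m [n [a [x [b [y [g [muE nuE [g0 gr gl ->]]]]]]]]].
move=> [n' [l [b' [y' [a' [z [h [nuE' laE [h0 hr hl ->]]]]]]]]].
have b0 j : 0 <= b j by rewrite -gr sumr_ge0.
have b'0 k : 0 <= b' k by rewrite -hl sumr_ge0.
pose w p := nu [set p].
have bw j : w (y j) = 0 -> b j = 0.
  move=> wj; apply/eqP; rewrite eq_le b0 andbT -wj /w nuE.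
  exact: dirac_comb_point_ge.
have b'w k : w (y' k) = 0 -> b' k = 0.
  move=> wj; apply/eqP; rewrite eq_le b'0 andbT -wj /w nuE'.
  exact: dirac_comb_point_ge.
have gw i j : w (y j) = 0 -> g i j = 0.
  move=> /bw bj; apply/eqP; rewrite eq_le g0 andbT -bj -gr.
  by rewrite (bigD1 i)//= lerDl sumr_ge0.
have hw k t : w (y' k) = 0 -> h k t = 0.
  move=> /b'w bj; apply/eqP; rewrite eq_le h0 andbT -bj -hl.
  by rewrite (bigD1 t)//= lerDl sumr_ge0.
pose q j k : R := (y j == y' k)%:R / w (y j).
have w0 p : 0 <= w p.
  by rewrite /w nuE dirac_comb_point sumr_ge0// => j _; rewrite mulr_ge0.
have q0 j k : 0 <= q j k by rewrite /q divr_ge0.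
have qr i j : g i j * (\sum_k b' k * q j k) = g i j.
  have [wj|wj] := eqVneq (w (y j)) 0; first by rewrite gw// mul0r.
  rewrite [X in _ * X](_ : _ = 1) ?mulr1//.
  under eq_bigr do rewrite /q mulrA.
  rewrite -mulr_suml -[X in _ / X]/(nu _) nuE' dirac_comb_point.
  under [X in X / _]eq_bigr do rewrite eq_sym.
  by rewrite divff// -dirac_comb_point -nuE'.
have ql k t : h k t * (\sum_j b j * q j k) = h k t.
  have [wj|wj] := eqVneq (w (y' k)) 0; first by rewrite hw// mul0r.
  rewrite [X in _ * X](_ : _ = 1) ?mulr1//.
  transitivity (\sum_j b j * (y j == y' k)%:R / w (y' k)).
    apply: eq_bigr => j _; rewrite /q mulrA.
    by case: eqVneq => [->//|_]; rewrite mulr0 !mul0r.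
  by rewrite -mulr_suml -dirac_comb_point -nuE divff.
pose f i t := \sum_j \sum_k g i j * h k t * q j k.
have fE (F : 'I_m -> 'I_n -> 'I_n' -> 'I_l -> R) :
   \sum_i \sum_t \sum_j \sum_k g i j * h k t * q j k * F i j k t =
   \sum_i \sum_j \sum_k \sum_t g i j * h k t * q j k * F i j k t.
  apply: eq_bigr => i _; rewrite exchange_big/=; apply: eq_bigr => j _.
  by rewrite exchange_big.
exists (\sum_i \sum_t f i t * mdist (x i) (z t)).
  exists m, l, a, x, a', z, f; split=> //; split=> //.
  - by move=> i t; do 2 (apply: sumr_ge0 => ? _); rewrite mulr_ge0// mulr_ge0.
  - move=> t; rewrite /f exchange_big/=.
    under eq_bigr do rewrite exchange_big/=.
    rewrite exchange_big/= -hr; apply: eq_bigr => k _.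
    rewrite -[RHS]ql mulr_sumr; apply: eq_bigr => j _.
    rewrite -gr mulr_suml mulr_sumr; apply: eq_bigr => i _.
    by rewrite [RHS]mulrCA [RHS]mulrA.
  - move=> i; rewrite /f exchange_big/= -gl; apply: eq_bigr => j _.
    rewrite exchange_big/= -[RHS]qr mulr_sumr; apply: eq_bigr => k _.
    rewrite -hl mulr_suml mulr_sumr; apply: eq_bigr => t _.
    by rewrite [RHS]mulrA.
pose F1 i j (k : 'I_n') (t : 'I_l) := mdist (x i) (y j).
pose F2 (i : 'I_m) (j : 'I_n) k t := mdist (y' k) (z t).
apply: (@le_trans _ _
  (\sum_i \sum_t \sum_j \sum_k g i j * h k t * q j k * (F1 i j k t + F2 i j k t))).
  apply: ler_sum => i _; apply: ler_sum => t _; rewrite /f mulr_suml.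
  apply: ler_sum => j _; rewrite mulr_suml; apply: ler_sum => k _.
  have [yE|yk] := eqVneq (y j) (y' k); last first.
    by rewrite /q (negPf yk) !(mul0r, mulr0).
  apply: ler_wpM2l; first by rewrite mulr_ge0// mulr_ge0.
  by rewrite /F2 -yE; exact: metric_triangle.
rewrite fE; under eq_bigr do under eq_bigr do under eq_bigr do
  (under eq_bigr do rewrite mulrDr; rewrite big_split/=).
under eq_bigr do under eq_bigr do rewrite big_split/=.
under eq_bigr do rewrite big_split/=.
rewrite big_split/= lerD//.
  apply: ler_sum => i _; apply: ler_sum => j _.
  rewrite -[X in _ <= X * _]qr mulr_sumr mulr_suml.
  apply: ler_sum => k _; rewrite -hl mulr_suml mulr_sumr mulr_suml.
  by apply: ler_sum => t _; rewrite !mulrA.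
rewrite exchange_big/=; under eq_bigr do rewrite exchange_big/=.
rewrite exchange_big/=; apply: ler_sum => k _.
under eq_bigr do rewrite exchange_big/=.
rewrite exchange_big/=; apply: ler_sum => t _.
rewrite -[X in _ <= X * _]ql mulr_sumr mulr_suml.
apply: ler_sum => j _; rewrite -gr mulr_suml mulr_sumr mulr_suml.
by apply: ler_sum => i _; rewrite /F2 (mulrCA (h k t)) !mulrA.
Qed.

Lemma wasserstein_triangle nu mu la : finite_probability nu ->
  finite_probability mu -> finite_probability la ->
  wasserstein mu la <= wasserstein mu nu + wasserstein nu la.
Proof.
move=> nup mup lap; rewrite -lerBlDl; apply: le_wasserstein => // d dP.
rewrite lerBlDl -lerBlDr; apply: le_wasserstein => // c cP.
rewrite lerBlDr; have [e eP] := transport_costs_glue cP dP.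
by apply: le_trans; exact: wasserstein_le.
Qed.

Lemma transport_costs_bound mu nu :
  finite_probability mu -> finite_probability nu ->
  exists K, forall c A, transport_costs mu nu c -> `|mu A - nu A| <= K * c.
Proof.
move=> [m0 [a0 [x0 [_ _ muE0]]]] [n0 [b0 [y0 [_ _ nuE0]]]].
pose K := \sum_i \sum_j (mdist (x0 i) (y0 j))^-1.
exists K => c A [m [n [a [x [b [y [g [muE nuE [g0 gr gl ->]]]]]]]]].
have a_ge0 i : 0 <= a i by rewrite -gl sumr_ge0.
have b_ge0 j : 0 <= b j by rewrite -gr sumr_ge0.
have -> : mu A - nu A = \sum_i \sum_j g i j * (\1_A (x i) - \1_A (y j)).
  under eq_bigr do (under eq_bigr do rewrite mulrBr; rewrite sumrB).
  rewrite sumrB muE nuE /dirac_comb [X in _ = _ - X]exchange_big/=.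
  by congr (_ - _); apply: eq_bigr => i _; rewrite -mulr_suml ?gl ?gr.
rewrite (le_trans (ler_norm_sum _ _ _))// mulr_sumr.
apply: ler_sum => i _; rewrite (le_trans (ler_norm_sum _ _ _))// mulr_sumr.
apply: ler_sum => j _; rewrite normrM ger0_norm// mulrCA.
have [->|gij] := eqVneq (g i j) 0; first by rewrite !mul0r.
apply: ler_wpM2l => //.
have [->|xy] := eqVneq (x i) (y j).
  by rewrite subrr normr0 mdistxx mulr0.
have gij0 : 0 < g i j by rewrite lt_neqAle eq_sym gij g0.
have supp k (d : 'I_k -> R) (u : 'I_k -> X) p :
    0 < dirac_comb d u [set p] -> exists r, u r = p.
  move=> dp; apply/not_existsP => up; move: dp.
  rewrite dirac_comb_point big1 ?ltxx// => r _.
  by case: eqP => [/up//|]; rewrite mulr0.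
have [i0 xi0] : exists r, x0 r = x i.
  apply: (supp _ a0); rewrite -muE0 muE (lt_le_trans _ (dirac_comb_point_ge _ _ _))//.
  by rewrite -gl (lt_le_trans gij0)// (bigD1 j)//= lerDl sumr_ge0.
have [j0 yj0] : exists r, y0 r = y j.
  apply: (supp _ b0); rewrite -nuE0 nuE (lt_le_trans _ (dirac_comb_point_ge _ _ _))//.
  by rewrite -gr (lt_le_trans gij0)// (bigD1 i)//= lerDl sumr_ge0.
have dxy : 0 < mdist (x i) (y j) by rewrite mdist_gt0.
apply: (@le_trans _ _ 1).
  by rewrite !indicE; do 2 case: (_ \in _);
    rewrite ?subrr ?subr0 ?sub0r ?normrN ?normr0 ?normr1.
rewrite -ler_pdivrMr// div1r /K (bigD1 i0)//= (bigD1 j0)//= xi0 yj0.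
rewrite -addrA lerDl addr_ge0// ?sumr_ge0// => k _; last rewrite sumr_ge0// => ? _.
all: by rewrite invr_ge0 mdist_ge0.
Qed.

Lemma wasserstein_eq0 mu nu :
  finite_probability mu -> finite_probability nu ->
  wasserstein mu nu = 0 -> mu = nu.
Proof.
move=> mup nup d0; apply/funext => A; apply/eqP; rewrite -subr_eq0 -normr_le0.
have [K KP] := transport_costs_bound mup nup.
have [K0|K0] := leP K 0.
  have [c cP] := transport_costs_nonempty mup nup.
  rewrite (le_trans (KP _ A cP))// mulr_le0_ge0//.
  exact: transport_costs_ge0 cP.
rewrite -(mulr0 K) -d0 mulrC -ler_pdivrMr//; apply: le_wasserstein => // c cP.
by rewrite ler_pdivrMr// mulrC KP.
Qed.

End Wasserstein.

Definition open_cover (X : topologicalType) (U : set (set X)) : Prop :=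
  (forall A, U A -> open A) /\ \bigcup_(A in U) A = [set: X].

Definition uniformly_bounded (R : realType) (X : metricType R)
    (U : set (set X)) : Prop :=
  exists D : R, forall A, U A -> forall x y, A x -> A y -> mdist x y <= D.

Section Vietoris.
Variables (R : realType) (X : metricType R) (U : set (set X)).

Definition vietoris_simplex (s : set X) : Prop :=
  finite_set s /\ exists2 A, U A & s `<=` A.

(* The geometric realization of the Vietoris complex. *)
Record vietoris_complex := VietorisComplex {
  bary :> X -> R;
  bary_itv : forall x, 0 <= bary x <= 1;
  bary_simplex : vietoris_simplex [set x | bary x != 0];
  bary_sum : \sum_(x \in [set: X]) bary x = 1
}.

HB.instance Definition _ := gen_eqMixin vietoris_complex.
HB.instance Definition _ := gen_choiceMixin vietoris_complex.

Definition closed_simplex (s : set X) : set vietoris_complex :=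
  [set p | [set x | p x != 0] `<=` s].

(* On the closed simplex spanned by the finite set s, the topology of the standard
   simplex is that of the maximum metric in barycentric coordinates. *)
Definition weak_open (W : set vietoris_complex) : Prop :=
  forall s, vietoris_simplex s -> forall p, closed_simplex s p -> W p ->
  exists2 e : R, 0 < e & forall q, closed_simplex s q ->
    (forall x, s x -> `|p x - q x| < e) -> W q.

Fact weak_openT : weak_open setT.
Proof. by move=> s _ p _ _; exists 1. Qed.

Fact weak_openI : setI_closed weak_open.
Proof.
move=> V W Vo Wo s sU p ps [Vp Wp].
have [e e0 eV] := Vo s sU p ps Vp; have [d d0 dW] := Wo s sU p ps Wp.
exists (Num.min e d); first by rewrite lt_min e0.
move=> q qs pq; split; [apply: eV|apply: dW] => // x sx;
  by have := pq x sx; rewrite lt_min => /andP[].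
Qed.

Fact weak_open_bigcup (I : Type) (W : I -> set vietoris_complex) :
  (forall i, weak_open (W i)) -> weak_open (\bigcup_i W i).
Proof.
move=> Wo s sU p ps [i _ Wp]; have [e e0 eW] := Wo i s sU p ps Wp.
by exists e => // q qs pq; exists i => //; exact: eW.
Qed.

HB.instance Definition _ := isOpenTopological.Build vietoris_complex
  weak_openT weak_openI weak_open_bigcup.

Lemma vietoris_openE (W : set vietoris_complex) : open W = weak_open W.
Proof. by []. Qed.

Record vietoris_thickening := VietorisThickening {
  vmeasure :> set X -> R;
  vmeasure_prob : finite_probability vmeasure;
  vmeasure_supp : exists2 A, U A & msupport vmeasure `<=` A
}.

HB.instance Definition _ := gen_eqMixin vietoris_thickening.
HB.instance Definition _ := gen_choiceMixin vietoris_thickening.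

Let wdist (mu nu : vietoris_thickening) : R := wasserstein mu nu.

Fact wdistxx mu : wdist mu mu = 0.
Proof. exact/wasserstein_refl/vmeasure_prob. Qed.

Fact wdist_eq0 mu nu : wdist mu nu = 0 -> mu = nu.
Proof.
move=> /(wasserstein_eq0 (vmeasure_prob mu) (vmeasure_prob nu)).
case: mu nu => [m m1 m2] [n n1 n2] /= mn; move: mn m1 m2 => -> m1 m2.
by congr VietorisThickening; exact: Prop_irrelevance.
Qed.

Fact wdistC mu nu : wdist mu nu = wdist nu mu.
Proof. exact: wassersteinC. Qed.

Fact wdist_triangle nu mu la : wdist mu la <= wdist mu nu + wdist nu la.
Proof. by apply: wasserstein_triangle; exact: vmeasure_prob. Qed.

HB.instance Definition _ := @isMetric.Build R vietoris_thickening
  wdist wdistxx wdist_eq0 wdistC wdist_triangle.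

Definition vietoris_measure (p : vietoris_complex) : set X -> R :=
  fun A => \sum_(x \in [set: X]) p x * \1_A x.

Lemma vietoris_measureE (r : seq X) (p : vietoris_complex) :
  uniq r -> closed_simplex [set` r] p ->
  vietoris_measure p =
  dirac_comb (fun i => p (tnth (in_tuple r) i)) (tnth (in_tuple r)).
Proof.
move=> ur pr; apply/funext => A; rewrite /vietoris_measure.
rewrite (fsbigE r)//; last first.
  move=> x _ xr; have [->|px] := eqVneq (p x) 0; first by rewrite mul0r.
  by have := pr x px; rewrite /= (negPf xr).
rewrite big_tnth.
by apply: eq_bigl => i; rewrite in_setT.
Qed.

Lemma bary_sumE (r : seq X) (p : vietoris_complex) :
  uniq r -> closed_simplex [set` r] p ->
  \sum_(i < size r) p (tnth (in_tuple r) i) = 1.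
Proof.
move=> ur pr; rewrite -(bary_sum p) (fsbigE r)//; last first.
  move=> x _ xr; apply/eqP/negP => /negP px.
  by have := pr x px; rewrite /= (negPf xr).
rewrite [RHS]big_tnth; apply: eq_bigl => i; by rewrite in_setT.
Qed.

Lemma vietoris_simplex_seq (s : set X) :
  vietoris_simplex s -> exists2 r : seq X, uniq r & s = [set` r].
Proof.
move=> [sfin _]; exists (fset_set s); first exact: fset_uniq.
by apply/seteqP; split=> x /=; rewrite in_fset_set// inE.
Qed.

Fact vietoris_measure_prob (p : vietoris_complex) :
  finite_probability (vietoris_measure p).
Proof.
have [r ur rE] := vietoris_simplex_seq (bary_simplex p).
have pr : closed_simplex [set` r] p by rewrite /closed_simplex /= -rE.
exists (size r), (fun i => p (tnth (in_tuple r) i)), (tnth (in_tuple r)).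
split; [by move=> i; case/andP: (bary_itv p (tnth (in_tuple r) i))|
  exact: bary_sumE|exact: vietoris_measureE].
Qed.

Lemma vietoris_measure1 (p : vietoris_complex) x :
  vietoris_measure p [set x] = p x.
Proof.
rewrite /vietoris_measure (fsbigE [:: x])//; last first.
  move=> y _; rewrite inE => yx; rewrite indicE memNset ?mulr0// => /= yx'.
  by rewrite yx' eqxx in yx.
by rewrite big_mkcond big_seq1 in_setT indicE mem_set// mulr1.
Qed.

Fact vietoris_measure_supp (p : vietoris_complex) :
  exists2 A, U A & msupport (vietoris_measure p) `<=` A.
Proof.
have [_ [A UA pA]] := bary_simplex p; exists A => // x.
by rewrite /msupport /= vietoris_measure1; exact: pA.
Qed.

Definition vietoris_id (p : vietoris_complex) : vietoris_thickening :=
  VietorisThickening (vietoris_measure_prob p) (vietoris_measure_supp p).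

Lemma wasserstein_common n (x : 'I_n -> X) (a b : 'I_n -> R) (M e : R) :
  (forall i, 0 <= a i) -> (forall i, 0 <= b i) ->
  \sum_i a i = 1 -> \sum_i b i = 1 ->
  (forall i j, mdist (x i) (x j) <= M) -> 0 <= M ->
  (forall i, `|a i - b i| <= e) ->
  wasserstein (dirac_comb a x) (dirac_comb b x) <= M * (n%:R * e).
Proof.
move=> a0 b0 a1 b1 xM M0 abe.
pose m i := Num.min (a i) (b i); pose u i := a i - m i; pose v i := b i - m i.
pose S := \sum_i u i.
have Sv : \sum_i v i = S by rewrite /S /u /v !sumrB a1 b1.
have u0 i : 0 <= u i by rewrite subr_ge0 ge_min lexx.
have v0 i : 0 <= v i by rewrite subr_ge0 ge_min lexx orbT.
have m0 i : 0 <= m i by rewrite le_min a0 b0.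
have S0 : 0 <= S by exact: sumr_ge0.
have uS i : u i * (S / S) = u i.
  have [S00|S00] := eqVneq S 0; last by rewrite divff// mulr1.
  have /eqP := S00; rewrite psumr_eq0// => /allP/(_ i).
  by rewrite mem_index_enum => /(_ isT)/eqP ->; rewrite mul0r.
have vS i : v i * (S / S) = v i.
  have [S00|S00] := eqVneq S 0; last by rewrite divff// mulr1.
  have /eqP := S00; rewrite -Sv psumr_eq0// => /allP/(_ i).
  by rewrite mem_index_enum => /(_ isT)/eqP ->; rewrite mul0r.
pose g i j := m i *+ (i == j) + u i * v j / S.
apply: (@le_trans _ _ (\sum_i \sum_j g i j * mdist (x i) (x j))).
  apply: wasserstein_le.
  exists n, n, a, x, b, x, g; split=> //; split=> //.
  - by move=> i j; rewrite addr_ge0 ?mulrn_wge0// divr_ge0// mulr_ge0.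
  - move=> j; rewrite big_split/= (bigD1 j)//= eqxx big1 ?addr0; last first.
      by move=> i /negPf ->.
    by rewrite -!mulr_suml -/S mulrAC mulrC vS /v addrC subrK.
  - move=> i; rewrite big_split/= (bigD1 i)//= eqxx big1 ?addr0; last first.
      by move=> j; rewrite eq_sym => /negPf ->.
    by rewrite -mulr_suml -mulr_sumr Sv -mulrA uS /u addrC subrK.
apply: (@le_trans _ _ (\sum_i \sum_j (u i * v j / S) * M)).
  apply: ler_sum => i _; apply: ler_sum => j _; rewrite mulrDl.
  have -> : m i *+ (i == j) * mdist (x i) (x j) = 0.
    by case: eqVneq => [->|_]; rewrite ?mdistxx ?mulr0// mulr0n mul0r.
  by rewrite add0r ler_wpM2l// divr_ge0// mulr_ge0.
rewrite [X in X <= _](_ : _ = M * S); last first.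
  under eq_bigr => i _ do rewrite -mulr_suml -mulr_suml -mulr_sumr Sv -(mulrA (u i)) uS.
  by rewrite -mulr_suml mulrC.
apply: ler_wpM2l => //.
rewrite mulr_natl -[X in _ *+ X]card_ord -sumr_const; apply: ler_sum => i _.
rewrite (le_trans _ (abe i))// /u /m; case: (leP (a i) (b i)) => ab.
  by rewrite subrr.
by rewrite ler_norm.
Qed.

Fact vietoris_id_continuous : continuous vietoris_id.
Proof.
apply/continuousP => W Wo; rewrite vietoris_openE => s sU p ps Wp.
have [r ur rE] := vietoris_simplex_seq sU; rewrite {}rE in ps *.
have /nbhs_ballP[d /= d0 dW] : nbhs (vietoris_id p) W by exact: open_nbhs_nbhs.
pose x := tnth (in_tuple r).
pose M := \sum_i \sum_j mdist (x i) (x j).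
have M0 : 0 <= M by do 2 (apply: sumr_ge0 => ? _); exact: mdist_ge0.
have xM i j : mdist (x i) (x j) <= M.
  rewrite /M (bigD1 i)//= (bigD1 j)//= -addrA lerDl addr_ge0// sumr_ge0// => *.
    exact: mdist_ge0.
  by apply: sumr_ge0 => *; exact: mdist_ge0.
have Mr : 0 < M * (size r)%:R + 1 by rewrite ltr_wpDl// mulr_ge0.
exists (d / (M * (size r)%:R + 1)); first by rewrite divr_gt0.
move=> q qs pq; apply: dW; rewrite ballEmdist /=.
rewrite [X in X < _]/(wasserstein (vietoris_measure p) (vietoris_measure q)).
rewrite (vietoris_measureE ur ps) (vietoris_measureE ur qs).
apply: (le_lt_trans (wasserstein_common (M := M)
  (e := d / (M * (size r)%:R + 1)) _ _ _ _ _ _ _)) => //.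
- by move=> i; case/andP: (bary_itv p (x i)).
- by move=> i; case/andP: (bary_itv q (x i)).
- exact: bary_sumE.
- exact: bary_sumE.
- by move=> i; apply/ltW/pq; exact: mem_tnth.
rewrite !mulrA -ltr_pdivlMr ?invr_gt0// invrK -mulrC ltr_pM2l//.
by rewrite ltrDl.
Qed.

HB.instance Definition _ := isContinuous.Build _ _ vietoris_id
  vietoris_id_continuous.

End Vietoris.
Arguments vietoris_id {R X} U p.

(* Main.v *)
(* The natural bijection identifies the singular chains of the complex with those
   spanned by the tame simplices of the thickening, the ones whose supports have a
   finite union: a compact subset of the complex only involves finitely many
   vertices, and on finitely many vertices the two topologies agree.  So it is enough
   that every chain of the thickening with tame boundary is tame up to a boundary.

   Let finitely many singular simplices be given, with compact image [C].  Every
   measure [mu] has a ball around it whose members carry most of their mass near the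
   support of [mu], within a single set of the cover; let [mu_1 .. mu_r] be the
   centres of finitely many such balls covering [C].  A simplex [s] is deformed in
   two stages.  First [s t] is multiplied by cut-off functions, one for each point
   of a fine grid of the simplex close to [t], the one at a grid point [g] vanishing
   away from the support of the [mu_i] attached to [s g]; since at most
   [2 ^ dim.+1] of them act at a time, mass remains.  The trimmed measure then lies
   well inside a set of the cover, so its mass can be moved linearly onto nearby
   points of a finite set [y] chosen once for all by tightness of [C].  Both stages
   are compatible with faces, because a grid point of a face is a grid point of the
   simplex; the prism operator of this homotopy is the required chain homotopy, and
   no subdivision is needed.

   Homology follows directly; for cohomology, which is not determined by homology
   with the same coefficients, a chain retraction over the integers is built from
   the acyclicity by recursion on the degree and then dualized. *)

From HB Require Import structures.
Require Import Defs.
From mathcomp Require Import all_boot all_order all_algebra finmap.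
From mathcomp Require Import all_classical all_reals all_analysis.
From mathcomp Require Import zify ring lra.
From mathcomp Require monalg.
Import -(notations) monalg.

Set Implicit Arguments.
Unset Strict Implicit.
Unset Printing Implicit Defensive.

Import Order.TTheory GRing.Theory Num.Theory.
Import numFieldNormedType.Exports.

Local Open Scope classical_set_scope.
Local Open Scope ring_scope.

(** * Finitely supported measures *)

Section Expectation.
Variables (R : realType) (X : metricType R).
Implicit Types (mu nu : set X -> R) (h : X -> R).

(** An arbitrary finite index type lets couplings and kernels be indexed by pairs, with no
    renumbering. *)
Definition comb (I : finType) (a : I -> R) (x : I -> X) : set X -> R :=
  fun A => \sum_i a i * \1_A (x i).

Lemma combE (I : finType) (a : I -> R) (x : I -> X) :
  comb a x = dirac_comb (fun i : 'I_#|I| => a (enum_val i))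
    (fun i : 'I_#|I| => x (enum_val i)).
Proof.
apply/funext => A; rewrite /comb /dirac_comb.
rewrite -(big_enum_val (A := I) (fun i => a i * \1_A (x i))).
by apply: eq_bigl.
Qed.

Lemma comb_point (I : finType) (a : I -> R) (x : I -> X) p :
  comb a x [set p] = \sum_i a i * (x i == p)%:R.
Proof.
apply: eq_bigr => i _; rewrite indicE; congr (_ * (nat_of_bool _)%:R).
by apply/idP/eqP; rewrite inE.
Qed.

Lemma comb_probability (I : finType) (a : I -> R) (x : I -> X) :
  (forall i, 0 <= a i) -> \sum_i a i = 1 -> finite_probability (comb a x).
Proof.
move=> a0 a1; rewrite combE.
exists #|I|, (fun i => a (enum_val i)), (fun i => x (enum_val i)).
split=> //; rewrite -(big_enum_val (A := I) a) -a1.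
by apply: eq_bigl.
Qed.

Lemma comb_msupport (I : finType) (a : I -> R) (x : I -> X) i :
  (forall i, 0 <= a i) -> 0 < a i -> msupport (comb a x) (x i).
Proof.
move=> a0 ai; rewrite /msupport /= comb_point gt_eqF// (bigD1 i)//= eqxx mulr1.
by rewrite ltr_wpDr// sumr_ge0// => j _; rewrite mulr_ge0.
Qed.

Lemma msupport_comb (I : finType) (a : I -> R) (x : I -> X) p :
  msupport (comb a x) p -> exists2 i, a i != 0 & x i = p.
Proof.
rewrite /msupport /= comb_point => s0.
have [i /eqP ai] : exists i, a i * (x i == p)%:R <> 0.
  apply/not_existsP => n0; move/negP: s0; apply; apply/eqP.
  by rewrite big1// => i _; apply: contrapT; exact: n0.
exists i; first by apply: contra_neq ai => ->; rewrite mul0r.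
by apply/eqP; apply: contra_neqT ai => /negPf ->; rewrite mulr0.
Qed.

(** The integral of [h] against a finitely supported [mu], written with point masses so that it does
    not depend on a presentation of [mu]. *)
Definition expect mu h : R := \sum_(x \in [set: X]) mu [set x] * h x.

Lemma expect_comb (I : finType) (a : I -> R) (x : I -> X) h :
  expect (comb a x) h = \sum_i a i * h (x i).
Proof.
have ur := undup_uniq [seq x i | i : I].
rewrite /expect (fsbigE (undup [seq x i | i : I]))//; last first.
  move=> p _ px; rewrite comb_point big1 ?mul0r// => i _.
  by case: eqP => [E|]; rewrite ?mulr0//; move: px; rewrite -E mem_undup fintype.image_f.
transitivity (\sum_(p <- undup [seq x i | i : I]) \sum_i
    a i * (x i == p)%:R * h p).
  by apply: eq_big => [p|p _]; rewrite ?in_setT// -mulr_suml -comb_point.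
rewrite exchange_big/=; apply: eq_bigr => i _.
rewrite (bigD1_seq (x i)) ?undup_uniq ?mem_undup ?fintype.image_f//= eqxx mulr1 big1 ?addr0//.
by move=> p /negPf pi; rewrite eq_sym pi mulr0 mul0r.
Qed.

Lemma probability_comb mu : finite_probability mu ->
  exists (I : finType) (a : I -> R) (x : I -> X),
    [/\ forall i, 0 <= a i, \sum_i a i = 1 & mu = comb a x].
Proof. by move=> [n [a [x ?]]]; exists 'I_n, a, x. Qed.

(** A transport plan becomes one family of weights with two endpoint maps, so that both marginals
    and the cost are sums over the same index. *)
Lemma coupling mu nu c : transport_costs mu nu c ->
  exists (E : finType) (g : E -> R) (x y : E -> X), [/\ forall e, 0 <= g e,
    mu = comb g x, nu = comb g y & c = \sum_e g e * mdist (x e) (y e)].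
Proof.
move=> [m [n [a [x [b [y [g [-> -> [g0 gb ga ->]]]]]]]]].
exists ('I_m * 'I_n)%type, (fun e => g e.1 e.2), (x \o fst), (y \o snd).
split=> //; last by rewrite pair_bigA.
- apply/funext => A; rewrite /comb /dirac_comb.
  rewrite -(pair_bigA _ (fun i j => g i j * \1_A (x i)))/=.
  by apply: eq_bigr => i _; rewrite -mulr_suml ga.
- apply/funext => A; rewrite /comb /dirac_comb.
  rewrite -(pair_bigA _ (fun i j => g i j * \1_A (y j)))/= exchange_big/=.
  by apply: eq_bigr => j _; rewrite -mulr_suml gb.
Qed.

(** The diagonal plan sends the mass [g e] from [x e] to [y e]. *)
Lemma wasserstein_comb (E : finType) (g : E -> R) (x y : E -> X) :
  (forall e, 0 <= g e) ->
  wasserstein (comb g x) (comb g y) <= \sum_e g e * mdist (x e) (y e).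
Proof.
move=> g0; apply: wasserstein_le; rewrite !combE.
exists #|E|, #|E|, (fun i => g (enum_val i)), (fun i => x (enum_val i)),
  (fun i => g (enum_val i)), (fun i => y (enum_val i)),
  (fun i j => g (enum_val i) *+ (i == j)); split=> //; split=> //.
- by move=> i j; rewrite mulrn_wge0.
- by move=> j; rewrite (bigD1 j)//= eqxx mulr1n big1 ?addr0// => i /negPf ->.
- move=> i; rewrite (bigD1 i)//= eqxx mulr1n big1 ?addr0// => j.
  by rewrite eq_sym => /negPf ->.
transitivity (\sum_(e in E) g e * mdist (x e) (y e)); first exact: eq_bigl.
rewrite big_enum_val; apply: eq_bigr => i _.
rewrite (bigD1 i)//= eqxx mulr1n big1 ?addr0// => j.
by rewrite eq_sym => /negPf ->; rewrite mulr0n mul0r.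
Qed.

Lemma transport_cost_lt mu nu e :
  finite_probability mu -> finite_probability nu -> wasserstein mu nu < e ->
  exists2 c, transport_costs mu nu c & c < e.
Proof.
move=> mup nup We; have [] := @inf_adherent _ (transport_costs mu nu)
  (e - wasserstein mu nu).
- by rewrite subr_gt0.
- split; first exact: transport_costs_nonempty.
  by exists 0; exact: transport_costs_ge0.
by move=> c cP; rewrite -/(wasserstein mu nu) addrC subrK => ce; exists c.
Qed.

Definition lipschitz_with (L : R) h :=
  forall x y, `|h x - h y| <= L * mdist x y.

(** The easy half of Kantorovich-Rubinstein duality, read off from a nearly optimal coupling. *)
Lemma expect_lipschitz mu nu h L : 0 <= L ->
  finite_probability mu -> finite_probability nu -> lipschitz_with L h ->
  `|expect mu h - expect nu h| <= L * wasserstein mu nu.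
Proof.
move=> L0 mup nup hL; apply/ler_addgt0Pr => e e0.
(* Dividing the error by [L + 1] instead of [L] covers the case [L = 0]. *)
have L1 : 0 < L + 1 by rewrite ltr_wpDl.
have [|c /coupling[E [g [x [y [g0 -> -> ->]]]]] ce] :=
  @transport_cost_lt mu nu (wasserstein mu nu + e / (L + 1)) mup nup.
  by rewrite ltrDl divr_gt0.
rewrite !expect_comb -sumrB.
apply: (@le_trans _ _ (L * \sum_i g i * mdist (x i) (y i))).
  rewrite (le_trans (ler_norm_sum _ _ _))// mulr_sumr; apply: ler_sum => i _.
  by rewrite -mulrBr normrM ger0_norm// mulrCA ler_wpM2l.
set W := wasserstein _ _ in ce *.
apply: (@le_trans _ _ (L * (W + e / (L + 1)))).
  by rewrite ler_wpM2l// ltW.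
rewrite mulrDr lerD2l mulrCA -[leRHS]mulr1 ler_wpM2l// ?(ltW e0)//.
by rewrite ler_pdivrMr// mul1r lerDl.
Qed.

Lemma expect1 mu : finite_probability mu -> expect mu (fun=> 1) = 1.
Proof.
move=> /probability_comb[I [a [x [a0 a1 ->]]]]; rewrite expect_comb.
by under eq_bigr do rewrite mulr1.
Qed.

Lemma le_expect mu h h' : finite_probability mu ->
  (forall x, msupport mu x -> h x <= h' x) -> expect mu h <= expect mu h'.
Proof.
move=> /probability_comb[I [a [x [a0 a1 ->]]]] hh; rewrite !expect_comb.
apply: ler_sum => i _; have := a0 i; rewrite le_eqVlt => /predU1P[<-|ai].
  by rewrite !mul0r.
by rewrite ler_wpM2l// hh//; exact: comb_msupport.
Qed.

Lemma expectB mu h h' : finite_probability mu ->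
  expect mu (fun x => h x - h' x) = expect mu h - expect mu h'.
Proof.
move=> /probability_comb[I [a [x [a0 a1 ->]]]]; rewrite !expect_comb -sumrB.
by apply: eq_bigr => i _; rewrite mulrBr.
Qed.

Lemma expect_sum mu (I : finType) (h : I -> X -> R) : finite_probability mu ->
  expect mu (fun x => \sum_i h i x) = \sum_i expect mu (h i).
Proof.
move=> /probability_comb[J [a [x [a0 a1 ->]]]]; rewrite expect_comb.
under eq_bigr do rewrite mulr_sumr.
by rewrite exchange_big; apply: eq_bigr => i _; rewrite expect_comb.
Qed.

Lemma expectZ mu (k : R) h : finite_probability mu ->
  expect mu (fun x => k * h x) = k * expect mu h.
Proof.
move=> /probability_comb[J [a [x [a0 a1 ->]]]]; rewrite !expect_comb mulr_sumr.
by apply: eq_bigr => i _; rewrite mulrCA.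
Qed.

Lemma expect_gt0 mu h x : finite_probability mu -> (forall x, 0 <= h x) ->
  msupport mu x -> 0 < h x -> 0 < expect mu h.
Proof.
move=> /probability_comb[J [a [u [a0 a1 ->]]]] h0 /msupport_comb[i ai <-] hx.
rewrite expect_comb (bigD1 i)//= ltr_wpDr//.
  by apply: sumr_ge0 => j _; rewrite mulr_ge0.
by rewrite mulr_gt0// lt_neqAle eq_sym ai a0.
Qed.

Lemma expect_indic mu A : finite_probability mu -> expect mu \1_A = mu A.
Proof. by move=> /probability_comb[J [a [x [a0 a1 ->]]]]; rewrite expect_comb. Qed.

Lemma finite_msupport mu : finite_probability mu -> finite_set (msupport mu).
Proof.
move=> /probability_comb[J [a [x [a0 a1 ->]]]].
apply: (@sub_finite_set _ _ [set` [seq x i | i : J]]); last exact: finite_seq.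
by move=> p /msupport_comb[i _ <-]; rewrite /= fintype.image_f.
Qed.

(** The common part [m] stays in place and the excess [u] is spread over the deficit [v]
    proportionally. Distances are bounded only between points that carry mass, because [kern_dist]
    controls nothing more. *)
Lemma wasserstein_tv (E : finType) (p : E -> X) (a b : E -> R) (M : R) :
  (forall i, 0 <= a i) -> (forall i, 0 <= b i) ->
  \sum_i a i = 1 -> \sum_i b i = 1 ->
  (forall i j, 0 < a i -> 0 < b j -> mdist (p i) (p j) <= M) -> 0 <= M ->
  wasserstein (comb a p) (comb b p) <= M * \sum_i `|a i - b i|.
Proof.
move=> a0 b0 a1 b1 pM M0.
pose m i := Num.min (a i) (b i); pose u i := a i - m i; pose v i := b i - m i.
pose S := \sum_i u i.
have Sv : \sum_i v i = S by rewrite /S /u /v !sumrB a1 b1.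
have u0 i : 0 <= u i by rewrite subr_ge0 ge_min lexx.
have v0 i : 0 <= v i by rewrite subr_ge0 ge_min lexx orbT.
have m0 i : 0 <= m i by rewrite le_min a0 b0.
have S0 : 0 <= S by exact: sumr_ge0.
(* If [S = 0], then [S / S] is 0, but so is every [u i]. *)
have uS i : u i * (S / S) = u i.
  have [S00|S00] := eqVneq S 0; last by rewrite divff// mulr1.
  have /eqP := S00; rewrite psumr_eq0// => /allP/(_ i).
  by rewrite mem_index_enum => /(_ isT)/eqP ->; rewrite mul0r.
have vS i : v i * (S / S) = v i.
  have [S00|S00] := eqVneq S 0; last by rewrite divff// mulr1.
  have /eqP := S00; rewrite -Sv psumr_eq0// => /allP/(_ i).
  by rewrite mem_index_enum => /(_ isT)/eqP ->; rewrite mul0r.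
pose g (e : E * E) := m e.1 *+ (e.1 == e.2) + u e.1 * v e.2 / S.
have g0 e : 0 <= g e by rewrite addr_ge0 ?mulrn_wge0// divr_ge0// mulr_ge0.
have -> : comb a p = comb g (p \o fst).
  apply/funext => A; rewrite /comb.
  rewrite -(pair_bigA _ (fun i j => g (i, j) * \1_A (p i)))/=.
  apply: eq_bigr => i _; rewrite -mulr_suml; congr (_ * _).
  rewrite big_split/= (bigD1 i)//= eqxx big1 ?addr0; last by move=> j; rewrite eq_sym => /negPf ->.
  by rewrite -mulr_suml -mulr_sumr Sv -mulrA uS /u addrC subrK.
have -> : comb b p = comb g (p \o snd).
  apply/funext => A; rewrite /comb.
  rewrite -(pair_bigA _ (fun i j => g (i, j) * \1_A (p j)))/= exchange_big/=.
  apply: eq_bigr => j _; rewrite -mulr_suml; congr (_ * _).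
  rewrite big_split/= (bigD1 j)//= eqxx big1 ?addr0; last by move=> i /negPf ->.
  by rewrite -!mulr_suml -/S mulrAC mulrC vS /v addrC subrK.
rewrite (le_trans (wasserstein_comb _ _ g0))//.
apply: (@le_trans _ _ (\sum_i \sum_j (u i * v j / S) * M)).
  rewrite pair_bigA/=; apply: ler_sum => -[i j] _ /=; rewrite mulrDl.
  have -> : m i *+ (i == j) * mdist (p i) (p j) = 0.
    by case: eqVneq => [->|_]; rewrite ?mdistxx ?mulr0// mulr0n mul0r.
  rewrite add0r; have [->|ui] := eqVneq (u i) 0; first by rewrite !mul0r.
  have [->|vj] := eqVneq (v j) 0; first by rewrite !(mulr0, mul0r).
  rewrite ler_wpM2l ?divr_ge0 ?mulr_ge0// pM//.
    by rewrite (@lt_le_trans _ _ (u i)) ?lt0r ?ui ?u0// /u gerBl.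
  by rewrite (@lt_le_trans _ _ (v j)) ?lt0r ?vj ?v0// /v gerBl.
rewrite [X in X <= _](_ : _ = M * S); last first.
  under eq_bigr => i _ do rewrite -mulr_suml -mulr_suml -mulr_sumr Sv -(mulrA (u i)) uS.
  by rewrite -mulr_suml mulrC.
rewrite ler_wpM2l//; apply: ler_sum => i _.
rewrite /u /m; case: (leP (a i) (b i)) => ab; last by rewrite ler_norm.
by rewrite subrr.
Qed.

(** * Reweighting and moving the mass of a measure *)

Section Kernel.
Variable J : finType.
Implicit Types (f : J -> X -> R) (z : J -> X -> X).

(* [mu] reweighted by [\sum_j f j], the share [f j x] of the mass at [x] being
   moved to [z j x], and normalized. *)
Definition kern f z mu : set X -> R :=
  fun A => expect mu (fun x => \sum_j f j x * \1_A (z j x)) /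
    expect mu (fun x => \sum_j f j x).

Lemma kern_comb f z (E : finType) (g : E -> R) (x : E -> X) :
  kern f z (comb g x) = comb (fun p : E * J => g p.1 * f p.2 (x p.1) /
    expect (comb g x) (fun x => \sum_j f j x)) (fun p => z p.2 (x p.1)).
Proof.
apply/funext => A; rewrite /kern [in LHS]expect_comb /comb -/(comb g x).
rewrite -(pair_bigA _ (fun i j => g i * f j (x i) /
  expect (comb g x) (fun x => \sum_j f j x) * \1_A (z j (x i))))/=.
rewrite mulr_suml; apply: eq_bigr => i _; rewrite mulr_sumr mulr_suml.
by apply: eq_bigr => j _; rewrite !mulrA mulrAC.
Qed.

Lemma kern_weight_sum f (E : finType) (g : E -> R) (x : E -> X) :
  0 < expect (comb g x) (fun x => \sum_j f j x) ->
  \sum_(p : E * J) g p.1 * f p.2 (x p.1) /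
    expect (comb g x) (fun x => \sum_j f j x) = 1.
Proof.
move=> Z0; rewrite -mulr_suml -[RHS](divff (lt0r_neq0 Z0)); congr (_ / _).
by rewrite expect_comb -(pair_bigA _ (fun i j => g i * f j (x i)))/=;
  apply: eq_bigr => i _; rewrite mulr_sumr.
Qed.

Lemma kern_probability f z mu : finite_probability mu ->
  (forall j x, 0 <= f j x) -> 0 < expect mu (fun x => \sum_j f j x) ->
  finite_probability (kern f z mu).
Proof.
move=> /probability_comb[E [g [x [g0 g1 ->]]]] f0 Z0.
rewrite kern_comb; apply: comb_probability; last exact: kern_weight_sum.
by move=> p; rewrite divr_ge0 ?mulr_ge0// ltW.
Qed.

Lemma msupport_kern f z mu p : finite_probability mu ->
  msupport (kern f z mu) p ->
  exists x j, [/\ msupport mu x, f j x != 0 & p = z j x].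
Proof.
move=> /probability_comb[E [g [x [g0 g1 ->]]]].
rewrite kern_comb => /msupport_comb[[i j]/= w0 <-].
exists (x i), j; split=> //.
  apply: comb_msupport => //; rewrite lt_neqAle g0 eq_sym andbT.
  by apply: contra_neq w0 => ->; rewrite !mul0r.
by apply: contra_neq w0 => ->; rewrite mulr0 mul0r.
Qed.

(** The intermediate measure has the weights of the first kernel and the points of the second.
    Reaching it means moving points along the coupling, which is cheap since each [z j] is
    non-expanding. From there only the weights change, a total variation estimate in which [D] is
    paid twice: for the weights and for their normalization. *)
Lemma kern_dist f f0 z mu nu c (eps L M : R) :
  finite_probability mu -> transport_costs mu nu c ->
  (forall j x, 0 <= f j x <= 1) -> (forall j x, 0 <= f0 j x) ->
  (forall j x, `|f j x - f0 j x| <= eps) ->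
  (forall j, lipschitz_with L (f0 j)) ->
  (forall j x y, mdist (z j x) (z j y) <= mdist x y) ->
  0 <= M -> (forall j k x y, msupport nu x -> msupport nu y ->
    mdist (z j x) (z k y) <= M) ->
  0 < expect nu (fun x => \sum_j f0 j x) ->
  let D := #|J|%:R * (eps + L * c) in
  expect nu (fun x => \sum_j f0 j x) - D <= expect mu (fun x => \sum_j f j x) /\
  (0 < expect mu (fun x => \sum_j f j x) ->
   wasserstein (kern f z mu) (kern f0 z nu) <=
   (#|J|%:R * c + M * (2 * D)) / expect mu (fun x => \sum_j f j x)).
Proof.
move=> /expect1 g1 /coupling[E [g [x [y [g0 muE nuE ->]]]]].
rewrite {}muE {}nuE {mu nu} in g1 *; move=> f01 f00 fe f0L zL M0 zM Z0 D.
have {}g1 : \sum_i g i = 1.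
  by rewrite -[RHS]g1 expect_comb; under [RHS]eq_bigr do rewrite mulr1.
pose u (p : E * J) := g p.1 * f p.2 (x p.1).
pose v (p : E * J) := g p.1 * f0 p.2 (y p.1).
have ZE : expect (comb g x) (fun x => \sum_j f j x) = \sum_p u p.
  rewrite expect_comb -(pair_bigA _ (fun i j => g i * f j (x i)))/=.
  by apply: eq_bigr => i _; rewrite mulr_sumr.
have Z0E : expect (comb g y) (fun x => \sum_j f0 j x) = \sum_p v p.
  rewrite expect_comb -(pair_bigA _ (fun i j => g i * f0 j (y i)))/=.
  by apply: eq_bigr => i _; rewrite mulr_sumr.
have uvD : \sum_p `|u p - v p| <= D.
  rewrite -(pair_bigA _ (fun i j => `|u (i, j) - v (i, j)|))/= /D.
  rewrite -[eps]mul1r -[X in X * eps]g1 mulr_suml mulr_sumr -big_split/= mulr_sumr.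
  apply: ler_sum => i _.
  rewrite mulr_natl -[X in _ *+ X]/(#|xpredT : pred J|) -sumr_const.
  apply: ler_sum => j _; rewrite /u /v/= -mulrBr normrM ger0_norm// mulrCA -mulrDr.
  by rewrite ler_wpM2l// (le_trans (ler_distD (f0 j (x i)) _ _))// lerD//; exact: f0L.
have ZD : `|\sum_p u p - \sum_p v p| <= D.
  by rewrite -sumrB; exact: le_trans (ler_norm_sum _ _ _) uvD.
rewrite ZE Z0E in Z0 *; split.
  by move: ZD; rewrite distrC ler_distl => /andP[_]; rewrite lerBlDl addrC.
move=> Zp; rewrite !kern_comb ZE Z0E.
pose al p := u p / \sum_p u p; pose be p := v p / \sum_p v p.
have u0 p : 0 <= u p by rewrite mulr_ge0//; case/andP: (f01 p.2 (x p.1)).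
have v0 p : 0 <= v p by rewrite mulr_ge0.
have al0 p : 0 <= al p by rewrite divr_ge0// ltW.
have be0 p : 0 <= be p by rewrite divr_ge0// ltW.
have al1 : \sum_p al p = 1 by rewrite -mulr_suml divff// gt_eqF.
have be1 : \sum_p be p = 1 by rewrite -mulr_suml divff// gt_eqF.
rewrite (le_trans (@wasserstein_triangle _ _
  (comb al (fun p => z p.2 (y p.1))) _ _ _ _ _))//; try exact: comb_probability.
rewrite mulrDl lerD//.
  rewrite (le_trans (wasserstein_comb _ _ al0))//.
  rewrite -(pair_bigA _ (fun i j => al (i, j) * mdist (z j (x i)) (z j (y i))))/=.
  rewrite mulr_sumr mulr_suml; apply: ler_sum => i _.
  rewrite mulr_natl -[X in _ *+ X]/(#|xpredT : pred J|) -sumr_const mulr_suml.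
  apply: ler_sum => j _; rewrite /al /u/= mulrAC ler_wpM2r ?invr_ge0 ?(ltW Zp)//.
  rewrite -mulrA ler_wpM2l//; case/andP: (f01 j (x i)) => ? ?.
  by rewrite -[leRHS]mul1r ler_pM// mdist_ge0.
have gpos i (q S : R) : 0 < g i * q / S -> 0 < g i.
  have := g0 i; rewrite le_eqVlt => /predU1P[<-|//].
  by rewrite !mul0r ltxx.
rewrite (le_trans (wasserstein_tv (M := M) al0 be0 al1 be1 _ _))//.
  move=> [i j] [k l] /gpos gi /gpos gk.
  by apply: zM; exact: comb_msupport.
rewrite -mulrA ler_wpM2l// ler_pdivlMr// mulr_suml.
apply: (@le_trans _ _ (\sum_p (`|u p - v p| +
   be p * `|\sum_p v p - \sum_p u p|))).
  apply: ler_sum => p _; rewrite -[X in _ * X](gtr0_norm Zp) -normrM mulrBl.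
  rewrite /al divfK ?gt_eqF//.
  have -> : u p - be p * \sum_p u p = (u p - v p) + be p * (\sum_p v p - \sum_p u p).
    by rewrite mulrBr {2}/be divfK ?gt_eqF// addrA subrK.
  by rewrite (le_trans (ler_normD _ _))// lerD2l normrM (ger0_norm (be0 p)).
by rewrite big_split/= -mulr_suml be1 mul1r mulrDl mul1r lerD// distrC.
Qed.

(** A local Lipschitz estimate at [nu], whose constants depend on neither [mu] nor [f]. The support
    of [nu] is finite, which bounds the diameter of the points reached. *)
Lemma kern_continuity f0 z nu (L : R) : finite_probability nu -> 0 <= L ->
  (forall j x, 0 <= f0 j x) -> (forall j, lipschitz_with L (f0 j)) ->
  (forall j x y, mdist (z j x) (z j y) <= mdist x y) ->
  0 < expect nu (fun x => \sum_j f0 j x) ->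
  exists K eta : R, [/\ 0 < K, 0 < eta & forall mu f d, finite_probability mu ->
    (forall j x, 0 <= f j x <= 1) -> 0 < d <= eta ->
    (forall j x, `|f j x - f0 j x| <= d) -> wasserstein mu nu < d ->
    wasserstein (kern f z mu) (kern f0 z nu) <= K * d].
Proof.
move=> nup L0 f00 f0L zL Z0; set Z := expect _ _ in Z0.
have [r rE] : exists r : seq X, msupport nu = [set` r].
  by exists (fset_set (msupport nu)); apply/seteqP; split=> p;
    rewrite /= in_fset_set ?inE//; exact: finite_msupport.
pose M := \sum_(p <- r) \sum_(q <- r) \sum_j \sum_k mdist (z j p) (z k q).
have M0 : 0 <= M by do 4 (apply: sumr_ge0 => ? _); exact: mdist_ge0.
have zM j k x y : msupport nu x -> msupport nu y -> mdist (z j x) (z k y) <= M.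
  rewrite rE /= => xr yr.
  rewrite /M (big_rem x)//= (big_rem y)//= (bigD1 j)//= (bigD1 k)//=.
  by rewrite -!addrA lerDl !addr_ge0//; do 4 ?(apply: sumr_ge0 => ? _); exact: mdist_ge0.
pose N : R := #|J|%:R.
have N0 : 0 <= N by [].
pose A := N * (1 + L); have A0 : 0 <= A by rewrite mulr_ge0// addr_ge0.
(* The second constant keeps the normalizing factor of [mu] above [Z / 2]; the first is the
   resulting quotient. The added 1s make the first constant and the denominator of the second
   positive. *)
exists (2 * (N + M * (2 * A)) / Z + 1), (Z / (2 * (A + 1))); split.
- by rewrite ltr_wpDl// divr_ge0 ?(ltW Z0)// mulr_ge0// addr_ge0// mulr_ge0// mulr_ge0.
- by rewrite divr_gt0// mulr_gt0// ltr_wpDl.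
move=> mu f d mup f01 /andP[d0 de] fd Wd.
have [c cP cd] := transport_cost_lt mup nup Wd.
have c0 : 0 <= c by exact: transport_costs_ge0 cP.
have [] := kern_dist mup cP f01 f00 fd f0L zL M0 zM Z0.
rewrite -/N -/Z; set D := N * _; set Zm := expect mu _ => ZD W.
have DA : D <= A * d.
  rewrite /D /A -mulrA ler_wpM2l// mulrDl mul1r lerD2l ler_wpM2l// ltW//.
have dZ : A * d <= Z / 2.
  apply: (@le_trans _ _ (A * (Z / (2 * (A + 1))))); first by rewrite ler_wpM2l.
  have A1 : A + 1 != 0 by rewrite gt_eqF// ltr_wpDl.
  have -> : A * (Z / (2 * (A + 1))) = Z / 2 * (A / (A + 1)) by field.
  rewrite ler_piMr ?divr_ge0 ?(ltW Z0)// ler_pdivrMr ?ltr_wpDl//.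
  by rewrite mul1r lerDl.
have Zm2 : Z / 2 <= Zm.
  by rewrite (le_trans _ ZD)// lerBrDr; have := splitr Z; lra.
have Z2 : 0 < Z / 2 by rewrite divr_gt0.
have Zm0 : 0 < Zm by rewrite (lt_le_trans Z2).
rewrite (le_trans (W Zm0))// ler_pdivrMr//.
apply: (@le_trans _ _ ((N + M * (2 * A)) * d)).
  rewrite [leRHS]mulrDl lerD ?ler_wpM2l ?(ltW cd)// -mulrA ler_wpM2l//.
  by rewrite -mulrA ler_wpM2l.
apply: (@le_trans _ _ ((2 * (N + M * (2 * A)) / Z) * d * (Z / 2))).
  by rewrite le_eqVlt; apply/orP; left; apply/eqP; field; rewrite gt_eqF.
rewrite ler_pM ?(ltW Z2)//; last by rewrite ler_wpM2r ?(ltW d0)// lerDl.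
by rewrite mulr_ge0 ?(ltW d0)// divr_ge0 ?(ltW Z0)// mulr_ge0// addr_ge0// mulr_ge0// mulr_ge0.
Qed.

End Kernel.
End Expectation.

(** * Standard simplices *)

Notation simplex R n := (set_type (@std_simplex R n)).

Section Simplices.
Variable R : realType.

Definition coord n (t : simplex R n) (j : 'I_n.+1) : R := val t 0 j.

Lemma coord_ge0 n (t : simplex R n) j : 0 <= coord t j.
Proof. by have [t0 _] := set_mem (valP t); exact: t0. Qed.

Lemma coord_sum n (t : simplex R n) : \sum_j coord t j = 1.
Proof. by have [_ t1] := set_mem (valP t); exact: t1. Qed.

Lemma coord_le1 n (t : simplex R n) j : coord t j <= 1.
Proof.
rewrite -(coord_sum t) (bigD1 j)//= lerDl; apply: sumr_ge0 => ? _.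
exact: coord_ge0.
Qed.

Lemma coord_inj n (t u : simplex R n) : coord t =1 coord u -> t = u.
Proof. by move=> tu; apply/val_inj/rowP => j; exact: tu. Qed.

Lemma coord_continuousP n j : continuous (fun t : simplex R n => coord t j).
Proof.
move=> t; apply: (@continuous_comp _ _ _ set_val (fun M : 'rV[R]_n.+1 => M 0 j)).
  exact: initial_continuous.
exact: coord_continuous.
Qed.

Lemma nbhs_simplex n (t : simplex R n) (A : set (simplex R n)) : nbhs t A ->
  exists2 e : R, 0 < e & forall u, (forall j, `|coord t j - coord u j| < e) -> A u.
Proof.
case=> _ [[W Wo <-] Wt WA]; have : nbhs (val t) W by apply: open_nbhs_nbhs; split.
move=> /nbhs_ballP[e e0 eW]; exists e => // u ue; apply/WA/eW; split=> // i j.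
by rewrite !ord1; exact: ue.
Qed.

Lemma near_simplex n (t : simplex R n) (e : R) : 0 < e ->
  \forall u \near t, forall j, `|coord t j - coord u j| < e.
Proof.
move=> e0; apply: (@filter_forall _ _
  (fun j => [set u | `|coord t j - coord u j| < e]) _ (nbhs_filter t)) => j.
have /pseudometric_normed_Zmodule.cvgr_dist_lt := @coord_continuousP n j t; exact.
Qed.

Fact smap_subproof p q (th : 'I_p.+1 -> 'I_q.+1) (t : simplex R p) :
  \row_l (\sum_(j | th j == l) coord t j) \in @std_simplex R q.
Proof.
apply/mem_set; split=> [l|]; rewrite ?mxE.
  by apply: sumr_ge0 => j _; exact: coord_ge0.
under eq_bigr do rewrite mxE.
by rewrite -(coord_sum t) (partition_big th xpredT).
Qed.

(** The affine map induced by a map of vertices: push-forward of barycentric coordinates. Faces and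
    degeneracies are instances. *)
Definition smap p q (th : 'I_p.+1 -> 'I_q.+1) (t : simplex R p) : simplex R q :=
  exist (fun u => u \in @std_simplex R q) _ (smap_subproof th t).

Lemma smapE p q (th : 'I_p.+1 -> 'I_q.+1) t l :
  coord (smap th t) l = \sum_(j | th j == l) coord t j.
Proof. by rewrite /coord mxE. Qed.

(** Hence the time parameter of a prism, a partial sum of coordinates, pulls back along [th] to
    another such sum. *)
Lemma smap_sum p q (th : 'I_p.+1 -> 'I_q.+1) t (P : pred 'I_q.+1) :
  \sum_(l | P l) coord (smap th t) l = \sum_(j | P (th j)) coord t j.
Proof.
rewrite [RHS](partition_big th P)//=; apply: eq_bigr => l Pl.
by rewrite smapE; apply: eq_bigl => j; case: eqVneq => [->|]; rewrite ?Pl ?andbF.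
Qed.

Lemma smap_comp p q r (th : 'I_q.+1 -> 'I_r.+1) (et : 'I_p.+1 -> 'I_q.+1) t :
  smap th (smap et t) = smap (th \o et) t.
Proof.
by apply: coord_inj => l; rewrite !smapE (smap_sum et t (fun j => th j == l)).
Qed.

Lemma smap_id p (t : simplex R p) : smap id t = t.
Proof. by apply: coord_inj => l; rewrite smapE big_pred1_eq. Qed.

Lemma face_smap n (i : 'I_n.+2) (t : simplex R n) : face i t = smap (lift i) t.
Proof.
apply: coord_inj => l; rewrite smapE /coord mxE.
case: unliftP => [k ->|->] /=.
  by rewrite (eq_bigl (pred1 k)) ?big_pred1_eq// => j; rewrite (inj_eq lift_inj).
by rewrite big1// => j; rewrite eq_sym (negPf (neq_lift _ _)).
Qed.

Lemma continuous_sum (T : topologicalType) (I : finType) (P : pred I)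
    (F : I -> T -> R) : (forall i, continuous (F i)) ->
  continuous (fun t => \sum_(i | P i) F i t).
Proof.
move=> Fc t; rewrite -[X in continuous_at _ X]fct_sumE.
by elim/big_ind : _ => [|f g fc gc|i _]; [exact: cst_continuous|exact: continuousD|exact: Fc].
Qed.

Lemma smap_continuous p q (th : 'I_p.+1 -> 'I_q.+1) : continuous (smap th).
Proof.
apply: continuous_comp_initial; apply: continuous_mx => a j.
rewrite [X in continuous X](_ : _ =
  fun t : simplex R p => \sum_(k | th k == j) coord t k).
  by apply: continuous_sum => k; exact: coord_continuousP.
by apply/funext => t /=; rewrite mxE.
Qed.

HB.instance Definition _ p q (th : 'I_p.+1 -> 'I_q.+1) :=
  isContinuous.Build _ _ (smap th) (@smap_continuous p q th).

Lemma coord_psum_01 n (t : simplex R n) (P : pred 'I_n.+1) :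
  0 <= \sum_(j | P j) coord t j <= 1.
Proof.
apply/andP; split; first by apply: sumr_ge0 => j _; exact: coord_ge0.
rewrite -(coord_sum t) [leRHS](bigID P)/= lerDl.
by apply: sumr_ge0 => j _; exact: coord_ge0.
Qed.

Lemma compact_subtype (T : topologicalType) (A : set T) :
  compact A -> compact [set: set_type A].
Proof.
move=> Ac F FF _.
pose v : set_type A -> T := set_val.
have FA : (v @ F) A.
  have -> : (v @ F) A = F (v @^-1` A) by [].
  rewrite (_ : v @^-1` A = setT); first exact: filterT.
  by apply/seteqP; split=> // x _; exact: set_valP.
have [p [Ap Fp]] := Ac (v @ F) _ FA.
exists (exist (fun x => x \in A) p (mem_set Ap)); split=> // S B FS.
case=> _ [[W Wo <-] Wp WB].
have [||_ [[s Ss <-] Ws]] := Fp (v @` S) W; first 1 last.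
- by apply: open_nbhs_nbhs; split.
- by exists s; split=> //; exact: WB.
suff : F (v @^-1` (v @` S)) by [].
by apply: filterS FS => s Ss; exists s.
Qed.

(** Near-covering compactness, applied along the filter of finite index sets ordered by
    inclusion. *)
Lemma compact_finite_cover (T : topologicalType) (I : choiceType) (A : set T)
    (f : I -> set T) : compact A -> (forall i, open (f i)) ->
  (forall p, A p -> exists i, f i p) ->
  exists F : {fset I}, forall p, A p -> exists2 i, i \in F & f i p.
Proof.
move=> /compact_near_coveringP Ac fo Af.
pose up := filter_from setT (fun F : {fset I} => [set E : {fset I} | (F `<=` E)%fset]).
have upF : Filter up.
  apply: filter_fromT_filter; first by exists fset0.
  move=> E F; exists (E `|` F)%fset => D /=.
  by rewrite fsubUset => /andP.
have [|F _ FP] := Ac _ up (fun F p => exists2 i, i \in F & f i p) upF.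
  move=> p /Af[i fip]; exists (f i, [set E : {fset I} | ([fset i] `<=` E)%fset]).
    split=> /=; last by exists [fset i]%fset.
    by apply: open_nbhs_nbhs; split.
  by move=> [q E] /= [fiq]; rewrite fsub1set => iE; exists i.
by exists F => p Ap; apply: (FP F (fsubset_refl F) p Ap).
Qed.

Lemma compact_simplex n : compact [set: simplex R n].
Proof.
apply: compact_subtype.
have Cco : compact [set v : 'rV[R]_n.+1 | forall i, v ord0 i \in `[(0:R), 1]].
  by apply: (@rV_compact _  _ (fun=> `[(0:R), 1]%classic)) => _; exact: segment_compact.
apply: subclosed_compact Cco _; last first.
  move=> v [v0 v1] i; rewrite in_itv/= v0/= -v1 (bigD1 i)//= lerDl.
  by apply: sumr_ge0.
apply: closedI.
  rewrite [X in closed X](_ : _ = \bigcap_i [set v : 'rV[R]_n.+1 | 0 <= v 0 i]).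
    apply: closed_bigI => i _.
    apply: (@preimage_closed _ _ (fun v : 'rV[R]_n.+1 => v 0 i) [set x : R | 0 <= x]).
      by move=> v _; exact: coord_continuous.
    exact: closed_ge.
  by apply/seteqP; split=> v /= v0 i => [_|]; exact: v0.
apply: (@preimage_closed _ _ (fun v : 'rV[R]_n.+1 => \sum_i v 0 i) [set (1 : R)]).
  by move=> v _; apply: continuous_sum => i; exact: coord_continuous.
exact: closed_eq.
Qed.

(** Heine's theorem, from near-covering compactness as [k] tends to 0 from the right. *)
Lemma simplex_uniform_continuity n (Y : metricType R) (s : simplex R n -> Y) (d : R) :
  continuous s -> 0 < d -> exists2 k : R, 0 < k &
    forall t u, (forall j, `|coord t j - coord u j| <= k) -> mdist (s t) (s u) < d.
Proof.
move=> sc d0.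
have /compact_near_coveringP nc := @compact_simplex n.
have k0 := nc R (0^'+) (fun k t => forall u,
  (forall j, `|coord t j - coord u j| <= k) -> mdist (s t) (s u) < d) _ _.
have {k0} : \forall k \near 0^'+, [set: simplex R n] `<=` fun t => forall u,
    (forall j, `|coord t j - coord u j| <= k) -> mdist (s t) (s u) < d.
  apply: k0 => t _.
  have [|e e0 se] := @nbhs_simplex _ t [set u | mdist (s t) (s u) < d / 2].
    by apply: (metricType_numDomainType.cvgr_dist_lt (sc t)); rewrite divr_gt0.
  have e2 : 0 < e / 2 by rewrite divr_gt0.
  exists ([set u | forall j, `|coord t j - coord u j| < e / 2], [set k | k < e / 2]).
    by split; [exact: near_simplex|exact: nbhs_right_lt].
  move=> [u k] [/= ue ke] v vk.
    rewrite (le_lt_trans (metric_triangle _ (s t) _))// (splitr d) metric_sym ltrD//.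
      by apply: se => j; rewrite (lt_trans (ue j))// ltr_pdivrMr// ltr_pMr// ltr1n.
    apply: se => j; rewrite (le_lt_trans (ler_distD (coord u j) _ _))//.
    by rewrite (splitr e) ltrD// (le_lt_trans (vk j)).
move=> k0; near (0:R)^'+ => k; exists k; first by near: k; exact: nbhs_right_gt.
by move=> t; apply: (near k0 k _).
Unshelve. all: by end_near.
Qed.

End Simplices.

(** * Tame simplices *)

Lemma mdist_reverse_triangle (R : realType) (X : metricType R) (x y z : X) :
  `|mdist x y - mdist x z| <= mdist y z.
Proof.
have abc (a b c : R) : a <= b + c -> b <= a + c -> `|a - b| <= c.
  by move=> ? ?; rewrite ler_norml; apply/andP; split; lra.
by apply: abc; [rewrite (metric_sym y)|]; exact: metric_triangle.
Qed.

Section TameSimplices.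
Variables (R : realType) (X : metricType R) (U : set (set X)).
Local Notation K := (vietoris_complex U).
Local Notation M := (vietoris_thickening U).

Lemma thickening_inj (mu nu : M) : (mu : set X -> R) = nu -> mu = nu.
Proof.
case: mu nu => [m m1 m2] [n n1 n2] /= mn; move: mn m1 m2 => -> m1 m2.
by congr VietorisThickening; exact: Prop_irrelevance.
Qed.

Lemma complex_inj (p q : K) : bary p =1 bary q -> p = q.
Proof.
case: p q => [p p1 p2 p3] [q q1 q2 q3] /= /funext pq; move: pq p1 p2 p3 => ->.
by move=> *; congr VietorisComplex; exact: Prop_irrelevance.
Qed.

Lemma vietoris_id_inj : injective (vietoris_id U).
Proof.
move=> p q pq; apply: complex_inj => x; rewrite -!vietoris_measure1.
by have := congr1 (fun mu : M => mu [set x]) pq.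
Qed.

Lemma measure_sum1 (mu : M) : \sum_(x \in [set: X]) mu [set x] = 1.
Proof.
rewrite -(expect1 (vmeasure_prob mu)); apply: eq_fsbigr => x _.
by rewrite mulr1.
Qed.

Lemma measure_set1_ge0 (mu : M) x : 0 <= mu [set x].
Proof.
have [I [a [y [a0 _ ->]]]] := probability_comb (vmeasure_prob mu).
by rewrite comb_point sumr_ge0// => i _; rewrite mulr_ge0.
Qed.

Lemma measure_set1_le1 (mu : M) x : mu [set x] <= 1.
Proof.
have [I [a [y [a0 a1 ->]]]] := probability_comb (vmeasure_prob mu).
rewrite comb_point -[leRHS]a1; apply: ler_sum => i _.
by rewrite ler_piMr// lern1 leq_b1.
Qed.

Fact unmeasure_itv (mu : M) x : 0 <= mu [set x] <= 1.
Proof. by rewrite measure_set1_ge0 measure_set1_le1. Qed.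

Fact unmeasure_simplex (mu : M) : vietoris_simplex U [set x | mu [set x] != 0].
Proof.
by split; [exact: finite_msupport (vmeasure_prob mu)|exact: vmeasure_supp].
Qed.

(** The set-theoretic inverse of the natural bijection. Its continuity along tame simplices is the
    content of [tame_lift]. *)
Definition unmeasure (mu : M) : K :=
  VietorisComplex (unmeasure_itv mu) (unmeasure_simplex mu) (measure_sum1 mu).

Lemma unmeasureK : cancel unmeasure (vietoris_id U).
Proof.
move=> mu; apply/thickening_inj/funext => A.
exact: expect_indic (vmeasure_prob mu).
Qed.

Lemma finite_setP (s : set X) : finite_set s -> exists r : seq X, s = [set` r].
Proof.
move=> sfin; exists (fset_set s).
by apply/seteqP; split=> x /=; rewrite in_fset_set// inE.
Qed.

Lemma mdistM (mu nu : M) : mdist mu nu = wasserstein mu nu. Proof. by []. Qed.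

Definition tame n (s : sing_simplex R n M) : Prop :=
  finite_set (\bigcup_t msupport (s t)).

(* Choose for each vertex [x] used by [C] a point [w x] of [C] using it.  For finite
   [F] the set of all [w x] with [x] outside [F] meets every simplex in a finite set,
   so its complement [O F] is open, and the [O F] are a directed cover. *)
Lemma compact_finite_support (C : set K) : compact C ->
  finite_set (\bigcup_(p in C) [set x | p x != 0]).
Proof.
move=> Cco; pose S := \bigcup_(p in C) [set x | p x != 0].
have [x|w wP] := @choice _ (option K)
    (fun x o => S x -> exists p, [/\ o = Some p, C p & p x != 0]).
  have [[p Cp px]|nS] := pselect (S x); last by exists None.
  by exists (Some p) => _; exists p.
pose O (F : {fset X}) := [set q : K | forall x, S x -> x \notin F -> w x <> Some q].
have Oopen F : open (O F).
  rewrite vietoris_openE => s /vietoris_simplex_seq[r ur ->{s}] p pr Op.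
  pose bad x := [&& `[<S x>], x \notin F & w x != Some p].
  (* The l1 distance on the vertices [r] from [p] to the forbidden point [w x]. A point whose
     coordinates are all within [d / (size r).+1] of those of [p] is closer than [d] in this
     distance. *)
  pose e x : R := if w x is Some q then \sum_(y <- r) `|p y - q y| else 1.
  have e0 x : x \in r -> S x -> x \notin F ->
      (forall q, w x = Some q -> closed_simplex [set` r] q -> 0 < e x).
    move=> xr Sx xF q wx qr; rewrite /e wx lt0r sumr_ge0// andbT.
    apply/negP; rewrite psumr_eq0// => /allP pq.
    apply: (Op x Sx xF); rewrite wx; congr Some; apply: complex_inj => y.
    have [yr|yr] := boolP (y \in r).
      by have := pq y yr; rewrite /= normr_eq0 subr_eq0 => /eqP.
    have -> : q y = 0 by apply/eqP/negPn/negP => /qr /=; rewrite (negPf yr).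
    by apply/esym/eqP/negPn/negP => /pr /=; rewrite (negPf yr).
  pose d := \big[Num.min/1]_(x <- r | 0 < e x) e x.
  exists (d / (size r).+1%:R).
    by rewrite divr_gt0//; exact: lt_bigmin.
  move=> q qr pq x Sx xF wx.
  have [p' [wx' _ p'x]] := wP x Sx; have p'q : p' = q by move: wx'; rewrite wx => -[].
  have xr : x \in r by apply: qr; rewrite /= -p'q.
  have ex := e0 x xr Sx xF q wx qr.
  have : d <= e x by apply: ge_bigmin_seq.
  apply/negP; rewrite -ltNge /e wx.
  apply: (@le_lt_trans _ _ (\sum_(y <- r) d / (size r).+1%:R)).
    by rewrite big_seq [leRHS]big_seq; apply: ler_sum => y yr; apply/ltW/pq.
  rewrite big_const_seq count_predT iter_addr_0 -[X in X < _]mulr_natr mulrAC ltr_pdivrMr//.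
  rewrite ltr_pM2l ?ltr_nat//.
  exact: lt_bigmin.
have [|D' CO] := compact_finite_cover Cco Oopen.
  move=> q Cq; have [r rE] := finite_setP (bary_simplex q).1.
  exists [fset x in r]%fset => // x Sx; rewrite !inE => xr wx.
  have [p [wp _ px]] := wP x Sx; move: wp px; rewrite wx => -[<-] qx.
  have : [set x | q x != 0] x by [].
  by rewrite rE /= (negPf xr).
apply: (@sub_finite_set _ _ [set` (\bigcup_(F <- D') F)%fset]); last first.
  exact: finite_fset.
move=> x Sx; apply/negPn/negP => xF.
have [p [wx Cp _]] := wP x Sx; have [F FD Op] := CO p Cp.
apply: (Op x Sx) => //; apply: contraNN xF => xF.
by apply/bigfcupP; exists F; rewrite ?andbT.
Qed.

(** The image of a simplex in the complex is compact, so [compact_finite_support] applies. *)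
Lemma sing_map_tame n (s : sing_simplex R n K) : tame (sing_map (vietoris_id U) s).
Proof.
have := @compact_finite_support [set s t | t in setT] _.
have sC : compact [set s t | t in setT].
  apply: continuous_compact; last exact: compact_simplex.
  by apply: continuous_subspaceT; exact: cts_fun.
move=> /(_ sC); apply: sub_finite_set => x [t _ tx].
exists (s t); first by exists t.
by move: tx; rewrite /msupport /= vietoris_measure1.
Qed.

(** The weight at [x] is the expectation of a Lipschitz bump [h] that is 1 at [x] and 0 at the other
    vertices in [r]; [expect_lipschitz] makes this continuous. *)
Lemma weight_continuous n (s : sing_simplex R n M) (r : seq X) x :
  (forall t, msupport (s t) `<=` [set` r]) -> x \in r ->
  continuous (fun t => s t [set x] : R).
Proof.
move=> sr xr.
pose rho : R := \big[Num.min/1]_(y <- r | y != x) mdist x y.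
have rho0 : 0 < rho.
  by apply: lt_bigmin => // y yx; rewrite mdist_gt0 eq_sym.
pose h y : R := Num.max 0 (1 - mdist x y / rho).
have hL : lipschitz_with rho^-1 h.
  move=> y z; rewrite /h.
  have := mdist_reverse_triangle x y z.
  rewrite -(ler_pM2l (_ : 0 < rho^-1)) ?invr_gt0//; apply: le_trans.
  rewrite -[X in X * `|_|]gtr0_norm ?invr_gt0// -normrM mulrBr !(mulrC rho^-1).
  move: (_ / rho) (_ / rho) => a b.
  have := ler_norm (a - b); have := ler_norm (b - a); rewrite (distrC b).
  by case: (leP 0 (1 - a)); case: (leP 0 (1 - b)) => *;
    rewrite ler_norml; apply/andP; split; lra.
have hx : h x = 1 by rewrite /h mdistxx mul0r subr0; apply/max_idPr.
have hy y : y \in r -> y != x -> h y = 0.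
  move=> yr yx; rewrite /h; apply/max_idPl; rewrite subr_le0 ler_pdivlMr// mul1r.
  exact: ge_bigmin_seq.
have E t : s t [set x] = expect (s t) h.
  rewrite /expect (fsbigE (undup r)) ?undup_uniq//; last first.
    move=> y _; rewrite mem_undup => yr.
    have -> : s t [set y] = 0; last by rewrite mul0r.
    by apply/eqP/negPn/negP => /(sr t) /=; rewrite (negPf yr).
  rewrite (eq_bigl xpredT) => [|y]; last by rewrite in_setT.
  rewrite (bigD1_seq x) ?mem_undup ?undup_uniq//= hx mulr1.
  rewrite big_seq_cond big1 ?addr0// => y /andP[]; rewrite mem_undup => yr yx.
  by rewrite hy// mulr0.
rewrite (funext E) => t; have FF := nbhs_filter t.
apply/(@cvgrPdist_le _ _ _ _ FF) => e e0.
have /metricType_numDomainType.cvgr_dist_lt := cts_fun (s := s) t.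
move=> /(_ (e * rho) (mulr_gt0 e0 rho0)); apply: filterS => u /= ue.
have r0 : 0 <= rho^-1 by rewrite invr_ge0 ltW.
rewrite (le_trans (expect_lipschitz r0 (vmeasure_prob _) (vmeasure_prob _) hL))//.
by rewrite mulrC ler_pdivrMr// ltW.
Qed.

(** Only the finitely many faces spanned by subsets of [r] matter. The weak topology gives a radius
    on each of them, and the least radius works because the weights are continuous. *)
Lemma tame_lift n (s : sing_simplex R n M) : tame s ->
  exists k : sing_simplex R n K, sing_map (vietoris_id U) k = s.
Proof.
move=> /finite_setP[r rE].
have sr t : msupport (s t) `<=` [set` r] by rewrite -rE => x sx; exists t.
pose f t := unmeasure (s t).
have fc : continuous f.
  move=> t W; rewrite nbhsE => -[V [Vo Vt] VW] /=; rewrite nbhs_filterE.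
  (* [d] is an admissible radius in [V] for the face spanned by [F], if that face is a simplex
     containing [f t]; otherwise any positive [d] will do. *)
  pose e (F : {ffun seq_sub r -> bool}) (d : R) := 0 < d /\
    let s := [set x | exists2 i, F i & val i = x] in
    vietoris_simplex U s -> closed_simplex s (f t) -> forall q, closed_simplex s q ->
      (forall x, s x -> `|f t x - q x| < d) -> V q.
  have [F|d dP] := @choice _ _ e; first rewrite /e.
    set S := [set x | _]; have [SU|] := pselect (vietoris_simplex U S); last by exists 1.
    have [St|] := pselect (closed_simplex S (f t)); last by exists 1.
    by have [d d0 dV] := Vo S SU _ St Vt; exists d.
  pose dm := \big[Num.min/1]_F d F.
  have dm0 : 0 < dm.
    by apply: lt_bigmin => // F _; have [] := dP F.
  (* Weights that are nonzero at [t] stay nonzero nearby, so [f t] lies in the face spanned by the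
     support of [f u]. *)
  have near1 : \forall u \near t, forall i : seq_sub r,
      `|f t (val i) - f u (val i)| < dm /\ (f t (val i) != 0 -> f u (val i) != 0).
    apply: (@filter_forall _ _ (fun i : seq_sub r => [set u | `|f t (val i) - f u (val i)| < dm /\
      (f t (val i) != 0 -> f u (val i) != 0)]) _ (nbhs_filter t)) => i.
    have wc := weight_continuous sr (ssvalP i).
    have wd d' : 0 < d' -> \forall u \near t, `|f t (val i) - f u (val i)| < d'.
      have /pseudometric_normed_Zmodule.cvgr_dist_lt := wc t; exact.
    have [ft0|ft0] := eqVneq (f t (val i)) 0.
      by apply: filterS (wd _ dm0) => u ud; split=> //; rewrite ft0 eqxx.
    have ft1 : 0 < `|f t (val i)| by rewrite normr_gt0.
    apply: filterS2 (wd _ dm0) (wd _ ft1) => u ud ut; split=> // _.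
    by move: ut; apply: contraTneq => ->; rewrite subr0 ltxx.
  apply: filterS near1 => u near1; apply: VW.
  pose F := [ffun i : seq_sub r => f u (val i) != 0].
  have FE : [set x | exists2 i, F i & val i = x] = [set x | f u x != 0].
    apply/seteqP; split=> x /=; first by move=> [i]; rewrite ffunE => ? <-.
    by move=> ux; exists (SeqSub (sr u x ux)); rewrite ?ffunE.
  have [_] := dP F; rewrite FE /=; apply.
  - exact: unmeasure_simplex.
  - move=> x /= tx; have := (near1 (SeqSub (sr t x tx))).2; exact.
  - by [].
  - move=> x /= ux; have [+ _] := near1 (SeqSub (sr u x ux)).
    by move=> /lt_le_trans; apply; exact: bigmin_le.
pose k : sing_simplex R n K := mkcts fc.
by exists k; apply/continuousEP => t; exact: unmeasureK.
Qed.

End TameSimplices.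

(** * The deformation *)

Section Products.
Variable R : realType.

Lemma prod_01 (I : Type) (r : seq I) (P : pred I) (u : I -> R) :
  (forall i, 0 <= u i <= 1) -> 0 <= \prod_(i <- r | P i) u i <= 1.
Proof.
move=> u01; elim/big_ind : _ => [|a b /andP[a0 a1] /andP[b0 b1]|//].
  by rewrite ler01 lexx.
by rewrite mulr_ge0// mulr_ile1.
Qed.

Lemma prod_dist (I : Type) (r : seq I) (P : pred I) (u v : I -> R) :
  (forall i, 0 <= u i <= 1) -> (forall i, 0 <= v i <= 1) ->
  `|\prod_(i <- r | P i) u i - \prod_(i <- r | P i) v i| <=
  \sum_(i <- r | P i) `|u i - v i|.
Proof.
move=> u01 v01; elim: r => [|i r IHr]; first by rewrite !big_nil subrr normr0.
rewrite !big_cons; case: ifP => // _.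
set a := \prod_(j <- r | P j) u j in IHr *.
set b := \prod_(j <- r | P j) v j in IHr *.
have -> : u i * a - v i * b = (u i - v i) * a + v i * (a - b) by ring.
have /andP[a0 a1] : 0 <= a <= 1 by exact: prod_01.
have /andP[v0 v1] := v01 i.
rewrite (le_trans (ler_normD _ _))// !normrM (ger0_norm a0) (ger0_norm v0) lerD//.
  by rewrite ler_piMr.
by rewrite (le_trans _ IHr)// ler_piMl.
Qed.

(** Weierstrass' product inequality: the loss under simultaneous trimming is at most the sum of the
    separate losses. *)
Lemma prod_1B_ge (I : Type) (r : seq I) (P : pred I) (u : I -> R) :
  (forall i, 0 <= u i <= 1) ->
  1 - \sum_(i <- r | P i) u i <= \prod_(i <- r | P i) (1 - u i).
Proof.
move=> u01; elim: r => [|i r IHr]; first by rewrite !big_nil subr0.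
rewrite !big_cons; case: ifP => // _.
set a := \prod_(j <- r | P j) _ in IHr *.
have /andP[a0 a1] : 0 <= a <= 1.
  by apply: prod_01 => j; have /andP[? ?] := u01 j; rewrite subr_ge0 gerBl; apply/andP.
have /andP[u0 u1] := u01 i; rewrite mulrBl mul1r opprD addrCA addrC lerD//.
by rewrite lerN2 ler_piMr.
Qed.

Lemma maxr_dist (c a b : R) : `|Num.max c a - Num.max c b| <= `|a - b|.
Proof.
have := ler_norm (a - b); have := ler_norm (b - a); rewrite (distrC b).
by case: (leP c a); case: (leP c b) => *; rewrite ler_norml; apply/andP; split; lra.
Qed.

Lemma minr_dist (c a b : R) : `|Num.min c a - Num.min c b| <= `|a - b|.
Proof.
have := ler_norm (a - b); have := ler_norm (b - a); rewrite (distrC b).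
by case: (leP c a); case: (leP c b) => *; rewrite ler_norml; apply/andP; split; lra.
Qed.

(** Equal to 1 up to distance 1/2 from 0, and to 0 from distance 1 on. The plateau makes some grid
    hat equal to 1 at every point ([grid_hat_eq1]). *)
Definition hat (v : R) : R := Num.max 0 (Num.min 1 (2 - 2 * `|v|)).

Lemma hat_01 v : 0 <= hat v <= 1.
Proof. by rewrite /hat le_max lexx/= ge_max ler01 ge_min lexx. Qed.

Lemma hat_eq0 v : 1 <= `|v| -> hat v = 0.
Proof.
move=> v1; apply/max_idPl; rewrite ge_min; apply/orP; right.
by lra.
Qed.

Lemma hat_eq1 v : `|v| <= 2^-1 -> hat v = 1.
Proof.
move=> v1; rewrite /hat; have /min_idPl -> : 1 <= 2 - 2 * `|v| by lra.
exact/max_idPr.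
Qed.

Lemma hat_dist u v : `|hat u - hat v| <= 2 * `|u - v|.
Proof.
rewrite (le_trans (maxr_dist _ _ _))// (le_trans (minr_dist _ _ _))//.
have -> : 2 - 2 * `|u| - (2 - 2 * `|v|) = 2 * (`|v| - `|u|) by ring.
by rewrite normrM ger0_norm// ler_pM2l// distrC ler_dist_dist.
Qed.

Lemma dist2_continuous (f : R -> R) :
  (forall u v, `|f u - f v| <= 2 * `|u - v|) -> continuous f.
Proof.
move=> fd v; apply/cvgrPdist_le => e e0; near=> u.
rewrite (le_trans (fd _ _))// -ler_pdivlMl//; near: u.
by apply: cvgr_dist_le => //; rewrite mulr_gt0// invr_gt0.
Unshelve. all: by end_near.
Qed.

Lemma hat_continuous : continuous hat.
Proof. exact: dist2_continuous hat_dist. Qed.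

(** Only the integers [f] and [f.+1] around [v] can contribute. *)
Lemma hat_sum n (v : R) : 0 <= v -> \sum_(j < n) hat (v - j%:R) <= 2.
Proof.
move=> v0; pose f := Num.truncn v.
have fv : f%:R <= v < f.+1%:R by exact: truncn_itv.
have le1 p : \sum_(j < n) (nat_of_ord j == p)%:R <= 1 :> R.
  have [pn|pn] := ltnP p n.
    rewrite (bigD1 (Ordinal pn))//= eqxx big1 ?addr0// => j.
    by rewrite -val_eqE/= => /negPf ->.
  by rewrite big1// => j _; rewrite ltn_eqF// (leq_trans (ltn_ord j)).
apply: (@le_trans _ _ (\sum_(j < n) ((nat_of_ord j == f)%:R +
    (nat_of_ord j == f.+1)%:R))); last by rewrite big_split/= -[leRHS]/(1 + 1) lerD.
apply: ler_sum => j _; have /andP[h0 h1] := hat_01 (v - j%:R).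
have [jf|jf] := eqVneq (nat_of_ord j) f; first by rewrite ler_wpDr.
have [jf1|jf1] := eqVneq (nat_of_ord j) f.+1; first by rewrite add0r.
rewrite add0r hat_eq0//; have /andP[fv1 fv2] := fv.
have [jf'|jf'] := ltnP j f.
  have : (j.+1%:R : R) <= f%:R by rewrite ler_nat.
  by rewrite -natr1 => ?; rewrite ger0_norm; lra.
have : (f.+2%:R : R) <= j%:R by rewrite ler_nat; lia.
by rewrite -natr1 => ?; rewrite ler0_norm; lra.
Qed.

End Products.

(** * Trimming on a grid and pushing onto finitely many points *)

Section Deformation.
Variables (R : realType) (X : metricType R) (U : set (set X)).
Local Notation M := (vietoris_thickening U).
Variables (N L : nat) (G : M -> X -> R) (V : M -> set X).
Variables (q : nat) (y : 'I_q -> X) (rho delta : R) (C : set M).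

Let index k := {ffun 'I_k.+1 -> 'I_L.+1}.

(* [m] stands for the point of the simplex proportional to it; the null vector is
   excluded wherever [grid_point m], then a junk vertex, would matter. *)
Definition grid_mass k (m : index k) : nat := (\sum_i m i)%N.

Fact vertex_subproof k : \row_i (i == 0 :> 'I_k.+1)%:R \in @std_simplex R k.
Proof.
apply/mem_set; split=> [i|]; rewrite ?mxE ?ler0n//.
rewrite (bigD1 ord0)//= mxE eqxx big1 ?addr0// => i.
by rewrite mxE => /negPf ->.
Qed.

Definition grid_point k (m : index k) : simplex R k :=
  insubd (exist (fun u => u \in @std_simplex R k) _ (vertex_subproof k))
    (\row_i ((m i)%:R / (grid_mass m)%:R)).

Lemma grid_pointE k (m : index k) i : grid_mass m != 0%N ->
  coord (grid_point m) i = (m i)%:R / (grid_mass m)%:R.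
Proof.
move=> m0; rewrite /coord /grid_point val_insubd.
rewrite ifT ?mxE//; apply/mem_set; split=> [j|]; first by rewrite mxE divr_ge0.
under eq_bigr do rewrite mxE; rewrite -mulr_suml -natr_sum divff//.
by rewrite pnatr_eq0.
Qed.

Definition grid_hat k (t : simplex R k) (m : index k) : R :=
  \prod_i hat (L%:R * coord t i - (m i)%:R).

(* [grid_hat t m] vanishes unless all coordinates of [L t] are at distance less than
   1 from those of [m]; it is 1 at a rounding of [L t]. *)
Definition trim k (s : simplex R k -> M) (t : simplex R k) (a : R) (x : X) : R :=
  \prod_(m : index k | grid_mass m != 0%N)
    (1 - a * grid_hat t m * G (s (grid_point m)) x).

(* Trimming takes place for [s <= 1/2], pushing onto [y] for [s >= 1/2]. *)
Definition trim_level (s : R) : R := Num.min 1 (2 * s).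
Definition push_level (s : R) : R := Num.max 0 (2 * s - 1).

Definition off i (x : X) : R := Num.min 1 (mdist x (y i) / rho).

(* Mass at [x] stays there with weight [None] and goes to [y i] with weight [Some i];
   the total is normalized only in [deform], which avoids dividing by
   [\sum_i (1 - off i x)]. *)
Definition weight k (s : simplex R k -> M) t (u : R) (j : option 'I_q) (x : X) : R :=
  if j is Some i then push_level u * trim s t (trim_level u) x * (1 - off i x)
  else (1 - push_level u) * trim s t (trim_level u) x.

Definition move (j : option 'I_q) (x : X) : X := if j is Some i then y i else x.

Definition deform k (s : simplex R k -> M) t u : set X -> R :=
  kern (weight s t u) move (s t).

Lemma grid_hat_01 k (t : simplex R k) m : 0 <= grid_hat t m <= 1.
Proof. by apply: prod_01 => i; exact: hat_01. Qed.

Lemma grid_hat_neq0 k (t : simplex R k) (m : index k) : grid_hat t m != 0 ->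
  forall i, `|L%:R * coord t i - (m i)%:R| < 1.
Proof.
move=> t0 i; rewrite ltNge; apply: contra_neqN t0 => /hat_eq0 h0.
by rewrite /grid_hat (bigD1 i)//= h0 mul0r.
Qed.

(** The sum over all grid indices factors into one sum per coordinate, each at most 2. *)
Lemma grid_hat_sum k (t : simplex R k) : \sum_m grid_hat t m <= 2 ^+ k.+1.
Proof.
rewrite /grid_hat.
rewrite -(bigA_distr_bigA (fun i (j : 'I_L.+1) => hat (L%:R * coord t i - j%:R))).
have -> : 2 ^+ k.+1 = \prod_(i < k.+1) 2 :> R by rewrite prodr_const card_ord.
apply: ler_prod => i _.
rewrite hat_sum ?mulr_ge0 ?coord_ge0// andbT; apply: sumr_ge0 => j _.
by have /andP[] := hat_01 (L%:R * coord t i - j%:R).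
Qed.

Lemma grid_scale_sum k (t : simplex R k) : \sum_i L%:R * coord t i = L%:R.
Proof. by rewrite -mulr_sumr coord_sum mulr1. Qed.

(** For [m = 0] all coordinates of [L t] would be below 1, and their sum [L] below [k.+1]. *)
Lemma grid_hat_mass k (t : simplex R k) (m : index k) : (k.+1 <= L)%N ->
  grid_hat t m != 0 -> grid_mass m != 0%N.
Proof.
move=> kL /grid_hat_neq0 tm; apply/eqP => m0.
have : (L%:R : R) < k.+1%:R; last by rewrite ltr_nat ltnNge kL.
have -> : k.+1%:R = \sum_(i < k.+1) 1 :> R by rewrite sumr_const card_ord.
rewrite -[X in X < _](grid_scale_sum t); apply: ltr_sum => [|i _].
  by apply/hasP; exists ord0; rewrite ?mem_index_enum.
have mi : (m i = 0 :> nat)%N by apply/eqP; move/eqP: m0; rewrite sum_nat_eq0 => /forallP/(_ i).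
by have := tm i; rewrite mi subr0 => /ltr_normlW.
Qed.

(** Truncating after adding 1/2 rounds each coordinate of [L t] to a nearest integer, which lands on
    the plateau of [hat]. *)
Lemma grid_hat_eq1 k (t : simplex R k) : exists m, grid_hat t m = 1.
Proof.
pose v i : R := L%:R * coord t i + 2^-1.
have v0 i : 0 <= v i by rewrite addr_ge0 ?mulr_ge0 ?coord_ge0.
have vi i := truncn_itv (v0 i).
have vL i : (Num.truncn (v i) < L.+1)%N.
  rewrite -(ltr_nat R); have /andP[+ _] := vi i; move=> /le_lt_trans; apply.
  rewrite /v -[X in _ < X]natr1 ler_ltD//; last by rewrite invf_lt1 ?ltr1n.
  by rewrite ler_piMr ?coord_le1.
exists [ffun i => Ordinal (vL i)]; rewrite /grid_hat big1// => i _.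
rewrite ffunE hat_eq1//=; have := vi i; move: (Num.truncn _) => p.
have -> : p.+1%:R = p%:R + 1 :> R by rewrite natr1.
rewrite /v => /andP[? ?].
by rewrite ler_norml; apply/andP; split; lra.
Qed.

(** The mass of [m] differs from [L] by at most [k.+1], one unit per coordinate; the coordinate [j]
    itself accounts for the last unit. *)
Lemma grid_point_near k (t : simplex R k) (m : index k) j : (k.+1 <= L)%N ->
  grid_hat t m != 0 -> `|coord (grid_point m) j - coord t j| <= k.+2%:R / L%:R.
Proof.
move=> kL tm; have m0 := grid_hat_mass kL tm; have mi := grid_hat_neq0 tm.
have S0 : (0 : R) < (grid_mass m)%:R by rewrite ltr0n lt0n.
have L0 : (0 : R) < L%:R by rewrite ltr0n (leq_trans _ kL).
rewrite grid_pointE// ler_pdivlMr// -[X in `|_| * X](gtr0_norm L0) -normrM.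
set S : R := (grid_mass m)%:R in S0 *.
have -> : ((m j)%:R / S - coord t j) * L%:R =
    (m j)%:R / S * (L%:R - S) + ((m j)%:R - L%:R * coord t j).
  by field; rewrite gt_eqF.
rewrite (le_trans (ler_normD _ _))// -[X in _ <= X]natr1 lerD//; last first.
  by rewrite distrC ltW.
have mS : (m j)%:R / S <= 1.
  by rewrite ler_pdivrMr// mul1r ler_nat /grid_mass (bigD1 j)//= leq_addr.
rewrite normrM ger0_norm ?divr_ge0 ?(ltW S0)//.
rewrite (@le_trans _ _ `|L%:R - S|) ?ler_piMl//.
rewrite /S /grid_mass natr_sum -[X in X - _](grid_scale_sum t) -sumrB.
have -> : k.+1%:R = \sum_(i < k.+1) 1 :> R by rewrite sumr_const card_ord.
rewrite (le_trans (ler_norm_sum _ _ _))//.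
by apply: ler_sum => i _; exact: ltW.
Qed.

Lemma grid_hat_continuous k (m : index k) :
  continuous (fun t : simplex R k => grid_hat t m).
Proof.
rewrite /grid_hat => t; rewrite -[X in continuous_at _ X]fct_prodE.
elim/big_ind : _ => [|f g fc gc|i _]; [exact: cst_continuous|exact: continuousM|].
apply: (@continuous_comp _ _ _ (fun t => L%:R * coord t i - (m i)%:R) (@hat R)).
  apply: continuousB; last exact: cst_continuous.
  by apply: continuousM; [exact: cst_continuous|exact: coord_continuousP].
exact: hat_continuous.
Qed.

Lemma trim_level_01 u : 0 <= u <= 1 -> 0 <= trim_level u <= 1.
Proof.
by move=> /andP[u0 u1]; rewrite /trim_level le_min ler01 mulr_ge0//= ge_min lexx.
Qed.

Lemma push_level_01 u : 0 <= u <= 1 -> 0 <= push_level u <= 1.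
Proof.
move=> /andP[u0 u1]; rewrite /push_level le_max lexx/= ge_max ler01/=.
by lra.
Qed.

Lemma push_trim_level u : push_level u != 0 -> trim_level u = 1.
Proof.
rewrite /push_level /trim_level => u0; apply/min_idPl; rewrite leNgt.
by apply: contra_neqN u0 => ?; apply/max_idPl; lra.
Qed.

Lemma trim_level_continuous : continuous trim_level.
Proof.
apply: dist2_continuous => u v; rewrite (le_trans (minr_dist _ _ _))//.
by rewrite -mulrBr normrM ger0_norm.
Qed.

Lemma push_level_continuous : continuous push_level.
Proof.
apply: dist2_continuous => u v; rewrite (le_trans (maxr_dist _ _ _))//.
have -> : 2 * u - 1 - (2 * v - 1) = 2 * (u - v) by ring.
by rewrite normrM ger0_norm.
Qed.


Lemma off_01 i x : 0 < rho -> 0 <= off i x <= 1.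
Proof.
move=> rho0; rewrite /off le_min ler01 ge_min lexx/= andbT.
by rewrite divr_ge0 ?mdist_ge0// ltW.
Qed.

Hypothesis rho_gt0 : 0 < rho.
Hypothesis G_01 : forall p x, 0 <= G p x <= 1.
Hypothesis G_lipschitz : forall p, exists2 K : R, 0 <= K & lipschitz_with K (G p).
Hypothesis G_small : forall p nu, C p -> mdist p nu < delta ->
  expect nu (G p) <= (2 * 2 ^+ N)^-1.
Hypothesis V_U : forall p, C p -> U (V p).
Hypothesis V_near : forall p x, C p -> G p x < 1 ->
  V p x /\ forall i, mdist x (y i) < rho -> V p (y i).
Hypothesis y_tight : forall p, C p -> expect p (fun x => \prod_i off i x) < 2^-1.
Hypothesis N_lt_L : (N < L)%N.

(** Bounding the dimension by [N] lets one grid and one set of constants serve a simplex and all its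
    faces; [N.+1 / L] dominates the distance in [grid_point_near]. *)
Definition small k (s : simplex R k -> M) : Prop := [/\ (k.+1 <= N)%N,
  forall t, C (s t) & forall t u,
  (forall j, `|coord t j - coord u j| <= N.+1%:R / L%:R) -> mdist (s t) (s u) < delta].

Lemma small_grid k (s : simplex R k -> M) t m : small s -> grid_hat t m != 0 ->
  mdist (s (grid_point m)) (s t) < delta.
Proof.
move=> [kN _ sd] tm; apply: sd => j.
rewrite (le_trans (grid_point_near _ _ tm))//.
  by rewrite (leq_trans kN)// ltnW.
by rewrite ler_wpM2r ?invr_ge0// ler_nat.
Qed.

Let trim_factor k (s : simplex R k -> M) t a x m : 0 <= a <= 1 ->
  0 <= a * grid_hat t m * G (s (grid_point m)) x <= 1.
Proof.
move=> /andP[a0 a1]; have /andP[h0 h1] := grid_hat_01 t m.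
have /andP[g0 g1] := G_01 (s (grid_point m)) x.
by rewrite mulr_ge0 ?mulr_ge0//= mulr_ile1 ?mulr_ge0// mulr_ile1.
Qed.

Lemma trim_01 k (s : simplex R k -> M) t a x : 0 <= a <= 1 ->
  0 <= trim s t a x <= 1.
Proof.
move=> a01; apply: prod_01 => m; have /andP[f0 f1] := trim_factor s t x m a01.
by rewrite subr_ge0 f1 gerBl.
Qed.

(** By [G_small] each acting cut-off removes at most [(2 * 2 ^+ N)^-1], times its hat. The hats add
    up to at most [2 ^+ N], so at most half of the mass is lost. *)
Lemma trim_mass k (s : simplex R k -> M) t a : small s -> 0 <= a <= 1 ->
  2^-1 <= expect (s t) (trim s t a).
Proof.
move=> ss a01; have tp := vmeasure_prob (s t); have /andP[a0 a1] := a01.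
have [kN sC _] := ss.
apply: (@le_trans _ _ (expect (s t)
  (fun x => 1 - \sum_m grid_hat t m * G (s (grid_point m)) x))); last first.
  apply: le_expect => // x _; rewrite (le_trans _ (prod_1B_ge _ _ _))//; last first.
    by move=> m; exact: trim_factor.
  rewrite lerB// big_mkcond; apply: ler_sum => m _.
  have /andP[h0 h1] := grid_hat_01 t m; have /andP[g0 g1] := G_01 (s (grid_point m)) x.
  by case: ifP => _; rewrite ?mulr_ge0// ler_wpM2r// ler_piMl.
rewrite expectB// expect1// expect_sum// (_ : 2^-1 = 1 - 2^-1); last by field.
rewrite lerB//.
apply: (@le_trans _ _ (\sum_m grid_hat t m * (2 * 2 ^+ N)^-1)).
  apply: ler_sum => m _; rewrite expectZ//; have /andP[h0 _] := grid_hat_01 t m.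
  have [->|hm] := eqVneq (grid_hat t m) 0; first by rewrite !mul0r.
  by rewrite ler_wpM2l// G_small// small_grid.
rewrite -mulr_suml invfM mulrCA ler_piMr// ler_pdivrMr ?exprn_gt0// mul1r.
by rewrite (le_trans (grid_hat_sum t))// ler_eXn2l// ltr1n.
Qed.

Lemma weight_01 k (s : simplex R k -> M) t u j x : 0 <= u <= 1 ->
  0 <= weight s t u j x <= 1.
Proof.
move=> u01; have /andP[t0 t1] := trim_01 s t x (trim_level_01 u01).
have /andP[b0 b1] := push_level_01 u01.
case: j => [i|] /=; last first.
  by rewrite mulr_ge0 ?subr_ge0//= mulr_ile1 ?subr_ge0 ?gerBl.
have /andP[f0 f1] := off_01 i x rho_gt0.
rewrite mulr_ge0 ?subr_ge0 ?mulr_ge0//= mulr_ile1 ?subr_ge0 ?gerBl ?mulr_ge0//.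
by rewrite mulr_ile1.
Qed.

(** Suppose all weights vanish on the support. Before pushing is complete, the weight [None] then
    forces the trimmed mass to be 0, against [trim_mass]. Once it is complete, every [off i] is 1
    wherever [trim] is nonzero, so [trim] is at most the product of the [off i], against
    [y_tight]. *)
Lemma weight_mass_gt0 k (s : simplex R k -> M) t u : small s -> 0 <= u <= 1 ->
  0 < expect (s t) (fun x => \sum_j weight s t u j x).
Proof.
move=> ss u01; have tp := vmeasure_prob (s t).
have mass := trim_mass t ss (trim_level_01 u01).
have /andP[b0 b1] := push_level_01 u01; have [_ sC _] := ss.
have w0 j x : 0 <= weight s t u j x by have /andP[] := weight_01 s t j x u01.
suff : exists2 x, msupport (s t) x & exists j, 0 < weight s t u j x.
  move=> [x sx [j jx]].
  apply: (expect_gt0 tp _ sx) => [x'|]; first exact: sumr_ge0.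
  by rewrite (bigD1 j)//= ltr_wpDr// sumr_ge0.
have ge0 x : 0 <= trim s t (trim_level u) x.
  by have /andP[] := trim_01 s t x (trim_level_01 u01).
apply: contrapT => nw.
have w_eq0 x j : msupport (s t) x -> weight s t u j x = 0.
  move=> sx; apply/eqP; rewrite eq_le w0 andbT leNgt; apply/negP => wj.
  by apply: nw; exists x => //; exists j.
have [b_eq1|b_neq1] := eqVneq (push_level u) 1; last first.
  suff : expect (s t) (trim s t (trim_level u)) <= expect (s t) (fun=> 0 * 1).
    rewrite expectZ// mul0r => /(le_trans mass).
    by rewrite leNgt invr_gt0 ltr0n.
  apply: le_expect => // x /(w_eq0 _ None) /eqP.
  by rewrite /= mulf_eq0 subr_eq0 eq_sym (negPf b_neq1)/= mul0r => /eqP ->.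
suff : expect (s t) (trim s t (trim_level u)) <=
    expect (s t) (fun x => \prod_i off i x).
  by move=> /(le_trans mass)/le_lt_trans/(_ (y_tight (sC t))); rewrite ltxx.
apply: le_expect => // x sx.
have [->|tx] := eqVneq (trim s t (trim_level u) x) 0.
  by apply: prodr_ge0 => i _; have /andP[] := off_01 i x rho_gt0.
rewrite big1; first by have /andP[] := trim_01 s t x (trim_level_01 u01).
move=> i _; have /eqP := w_eq0 x (Some i) sx.
by rewrite /= b_eq1 mul1r mulf_eq0 (negPf tx) subr_eq0 => /eqP ->.
Qed.

Lemma deform_probability k (s : simplex R k -> M) t u : small s -> 0 <= u <= 1 ->
  finite_probability (deform s t u).
Proof.
move=> ss u01; apply: kern_probability; first exact: vmeasure_prob.
  by move=> j x; have /andP[] := weight_01 s t j x u01.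
exact: weight_mass_gt0.
Qed.

Lemma msupport_deform k (s : simplex R k -> M) t u p :
  msupport (deform s t u) p -> msupport (s t) p /\ push_level u != 1 \/
    exists i, p = y i.
Proof.
move=> /(msupport_kern (vmeasure_prob (s t)))[x [[i|] [sx wx ->]]] /=.
  by right; exists i.
left; split=> //; apply: contra_neq wx => /= ->.
by rewrite subrr mul0r.
Qed.

(** Until pushing starts the support only shrinks. Afterwards trimming is complete, and a grid index
    with hat 1 removes every point where its [G] equals 1. By [V_near] what remains lies in the
    corresponding [V], together with the [y i] onto which it is pushed. *)
Lemma deform_support k (s : simplex R k -> M) t u : small s -> 0 <= u <= 1 ->
  exists2 A, U A & msupport (deform s t u) `<=` A.
Proof.
move=> ss u01; have [b0|b0] := eqVneq (push_level u) 0.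
  have [A UA sA] := vmeasure_supp (s t); exists A => // p.
  move=> /(msupport_kern (vmeasure_prob (s t)))[x [[i|] [sx wx ->]]]; last exact: sA.
  by move: wx; rewrite /= b0 !mul0r eqxx.
have [kN sC _] := ss; have [m tm] := grid_hat_eq1 t.
have tm0 : grid_hat t m != 0 by rewrite tm oner_eq0.
have m0 : grid_mass m != 0%N.
  by apply: grid_hat_mass tm0; rewrite (leq_trans kN)// ltnW.
exists (V (s (grid_point m))); first exact: V_U.
move=> p /(msupport_kern (vmeasure_prob (s t)))[x [j [sx wx ->]]].
have tx : trim s t (trim_level u) x != 0.
  apply: contra_neq wx; case: j => [i|] /= ->; first by rewrite mulr0 mul0r.
  by rewrite mulr0.
have Gx : G (s (grid_point m)) x < 1.
  have /andP[_ g1] := G_01 (s (grid_point m)) x; rewrite lt_neqAle g1 andbT.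
  apply: contra_neq tx => G1; rewrite /trim (bigD1 m)//= G1 tm.
  by rewrite push_trim_level// !mulr1 subrr mul0r.
have [Vx Vy] := V_near (sC _) Gx; case: j wx => [i|] //= wx.
apply: Vy; rewrite -[rho]mul1r -ltr_pdivrMr// ltNge; apply: contra_neqN wx => d1.
by rewrite /off (min_idPl d1) subrr mulr0.
Qed.

Lemma deform_bottom k (s : simplex R k -> M) t : deform s t 0 = s t.
Proof.
have t0 : trim_level 0 = 0 by rewrite /trim_level mulr0; apply/min_idPr.
have b0 : push_level 0 = 0.
  by rewrite /push_level mulr0 sub0r; apply/max_idPl; rewrite oppr_le0.
have trim1 x : trim s t 0 x = 1 by rewrite /trim big1// => m _; rewrite !mul0r subr0.
have wE x (c : option 'I_q -> R) : \sum_j weight s t 0 j x * c j = c None.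
  rewrite (bigD1 None)//= big1 ?addr0; first by rewrite b0 t0 trim1 subr0 !mul1r.
  by case=> [i|]//= _; rewrite b0 !mul0r.
apply/funext => A; rewrite /deform /kern.
have -> : (fun x => \sum_j weight s t 0 j x) = fun=> 1.
  apply/funext => x; rewrite -[RHS](wE x (fun=> 1)).
  by apply: eq_bigr => j _; rewrite mulr1.
have -> : (fun x => \sum_j weight s t 0 j x * \1_A (move j x)) = \1_A.
  by apply/funext => x; rewrite wE.
by rewrite expect1 ?expect_indic ?divr1//; exact: vmeasure_prob.
Qed.


Lemma off_lipschitz i : lipschitz_with rho^-1 (off i).
Proof.
move=> x x'; rewrite (le_trans (minr_dist _ _ _))// -mulrBl mulrC normrM.
rewrite gtr0_norm ?invr_gt0// ler_pM2l ?invr_gt0//.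
by rewrite (metric_sym x) (metric_sym x') mdist_reverse_triangle.
Qed.

Let sub1B (a b : R) : 1 - a - (1 - b) = b - a. Proof. by ring. Qed.

Lemma trim_lipschitz k (s : simplex R k -> M) t a : 0 <= a <= 1 ->
  exists2 K : R, 0 <= K & lipschitz_with K (trim s t a).
Proof.
move=> a01; have [m|K KP] := @choice (index k) R
  (fun m K => 0 <= K /\ lipschitz_with K (G (s (grid_point m)))).
  by have [K ? ?] := G_lipschitz (s (grid_point m)); exists K.
exists (\sum_m K m); first by apply: sumr_ge0 => m _; case: (KP m).
move=> x x'; rewrite (le_trans (prod_dist _ _ _ _))//.
- by move=> m; have /andP[? ?] := trim_factor s t x m a01; rewrite subr_ge0 gerBl; apply/andP.
- by move=> m; have /andP[? ?] := trim_factor s t x' m a01; rewrite subr_ge0 gerBl; apply/andP.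
rewrite big_mkcond mulr_suml; apply: ler_sum => m _; have [K0 KG] := KP m.
case: ifP => _; last by rewrite mulr_ge0 ?mdist_ge0.
rewrite sub1B -mulrBr normrM (le_trans _ (KG x x'))//.
have /andP[a0 a1] := a01; have /andP[h0 h1] := grid_hat_01 t m.
by rewrite distrC ler_piMl// ger0_norm ?mulr_ge0// mulr_ile1.
Qed.

Lemma weight_lipschitz k (s : simplex R k -> M) t u : 0 <= u <= 1 ->
  exists2 K : R, 0 <= K & forall j, lipschitz_with K (weight s t u j).
Proof.
move=> u01; have [K K0 KT] := trim_lipschitz s t (trim_level_01 u01).
have r0 : 0 <= rho^-1 by rewrite invr_ge0 ltW.
exists (K + rho^-1); first by rewrite addr_ge0.
have /andP[b0 b1] := push_level_01 u01.
move=> j x x'; rewrite mulrDl; have T01 z := trim_01 s t z (trim_level_01 u01).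
have Kx := KT x x'; set T := trim s t (trim_level u) in Kx T01.
have d0 : 0 <= rho^-1 * mdist x x' by rewrite mulr_ge0 ?mdist_ge0.
case: j => [i|] /=; rewrite -/T; last first.
  rewrite -mulrBr normrM ler_wpDr// (le_trans _ Kx)// ler_piMl//.
  by rewrite ger0_norm ?subr_ge0// gerBl.
have -> : push_level u * T x * (1 - off i x) - push_level u * T x' * (1 - off i x') =
  push_level u * ((1 - off i x) * (T x - T x') + T x' * (off i x' - off i x)) by ring.
have /andP[f0 f1] := off_01 i x rho_gt0; have /andP[T0 T1] := T01 x'.
rewrite normrM ger0_norm// (le_trans (ler_piMl _ b1))//.
rewrite (le_trans (ler_normD _ _))// !normrM lerD//.
  by rewrite (le_trans _ Kx)// ler_piMl// ger0_norm ?subr_ge0// gerBl.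
rewrite ger0_norm// (le_trans (ler_piMl _ T1))// distrC.
exact: off_lipschitz.
Qed.

(** A bound for the change of the weights that is uniform in the point of [X], as [kern_continuity]
    requires. *)
Definition level_dist k (t t' : simplex R k) (u u' : R) : R :=
  `|push_level u - push_level u'| +
  \sum_(m : index k)
    `|trim_level u * grid_hat t m - trim_level u' * grid_hat t' m|.

Lemma weight_dist k (s : simplex R k -> M) t t' u u' j x :
  0 <= u <= 1 -> 0 <= u' <= 1 ->
  `|weight s t u j x - weight s t' u' j x| <= level_dist t t' u u'.
Proof.
move=> u01 u'01; have /andP[b0 b1] := push_level_01 u01.
have /andP[b'0 b'1] := push_level_01 u'01.
have T01 := trim_01 s t x (trim_level_01 u01).
have T'01 := trim_01 s t' x (trim_level_01 u'01).
have : `|trim s t (trim_level u) x - trim s t' (trim_level u') x| <=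
  \sum_(m : index k) `|trim_level u * grid_hat t m - trim_level u' * grid_hat t' m|.
  rewrite (le_trans (prod_dist _ _ _ _))//.
  - move=> m; have /andP[? ?] := trim_factor s t x m (trim_level_01 u01).
    by rewrite subr_ge0 gerBl; apply/andP.
  - move=> m; have /andP[? ?] := trim_factor s t' x m (trim_level_01 u'01).
    by rewrite subr_ge0 gerBl; apply/andP.
  rewrite big_mkcond; apply: ler_sum => m _; case: ifP => // _.
  rewrite sub1B -mulrBl normrM distrC ler_piMr//.
  by have /andP[? ?] := G_01 (s (grid_point m)) x; rewrite ger0_norm.
rewrite /weight /level_dist.
move: (trim s t _ x) (trim s t' _ x) T01 T'01 => T T' /andP[T0 T1] /andP[T'0 T'1].
move: (push_level u) (push_level u') b0 b1 b'0 b'1 => b b' b0 b1 b'0 b'1 TT.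
case: j => [i|].
  have /andP[f0 f1] := off_01 i x rho_gt0.
  rewrite -mulrBl normrM (le_trans (ler_piMr _ _))//.
    by rewrite ger0_norm ?subr_ge0// gerBl.
  have -> : b * T - b' * T' = (b - b') * T + b' * (T - T') by ring.
  rewrite (le_trans (ler_normD _ _))// !normrM lerD//.
    by rewrite ler_piMr// ger0_norm.
  by rewrite (le_trans _ TT)// ler_piMl// ger0_norm.
have -> : (1 - b) * T - (1 - b') * T' = (b' - b) * T + (1 - b') * (T - T') by ring.
rewrite (le_trans (ler_normD _ _))// !normrM distrC lerD//.
  by rewrite ler_piMr// ger0_norm.
by rewrite (le_trans _ TT)// ler_piMl// ger0_norm ?subr_ge0 ?gerBl.
Qed.

Lemma level_dist_continuous p k (tau : simplex R p -> simplex R k)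
    (u : simplex R p -> R) q0 : continuous tau -> continuous u ->
  continuous (fun q => level_dist (tau q) (tau q0) (u q) (u q0)).
Proof.
move=> tauc uc; have nc (f : simplex R p -> R) (c : R) : continuous f ->
    continuous (fun q => `|f q - c|).
  move=> fc q'; apply: (@continuous_comp _ _ _ (fun q => f q - c) Num.norm).
    by apply: continuousB; [exact: fc|exact: cst_continuous].
  exact: norm_continuous.
rewrite /level_dist => q'. apply: (@continuousD _ _ (simplex R p)).
  apply: (nc (push_level \o u)) => q1.
  by apply: continuous_comp; [exact: uc|exact: push_level_continuous].
apply: continuous_sum => m; apply: (nc (fun q => trim_level (u q) * grid_hat (tau q) m)).
move=> q1; apply: (@continuousM _ (simplex R p)).
  by apply: (@continuous_comp _ _ _ u trim_level); [exact: uc|exact: trim_level_continuous].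
apply: (@continuous_comp _ _ _ tau (fun t => grid_hat t m)); first exact: tauc.
exact: grid_hat_continuous.
Qed.

(** The cut-offs depend on [s] only through its values at grid points, so the weights vary with
    position and time only through [level_dist]. [kern_continuity] combines this with the motion of
    the measure itself. *)
Lemma deform_near p k (s : sing_simplex R k M) (tau : simplex R p -> simplex R k)
    (u : simplex R p -> R) q0 (e : R) : small s -> continuous tau -> continuous u ->
  (forall q, 0 <= u q <= 1) -> 0 < e ->
  \forall q \near q0,
    wasserstein (deform s (tau q) (u q)) (deform s (tau q0) (u q0)) < e.
Proof.
move=> ss tauc uc u01 e0.
have [K K0 KL] := weight_lipschitz s (tau q0) (u01 q0).
have mv1 j x x' : mdist (move j x) (move j x') <= mdist x x'.
  by case: j => [i|] //=; rewrite mdistxx mdist_ge0.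
have w0 j x : 0 <= weight s (tau q0) (u q0) j x.
  by have /andP[] := weight_01 s (tau q0) j x (u01 q0).
have [K' [eta [K'0 eta0 near_kern]]] := kern_continuity
  (vmeasure_prob (s (tau q0))) K0 w0 KL mv1 (weight_mass_gt0 _ ss (u01 q0)).
pose d := Num.min eta (e / (2 * K')).
have d0 : 0 < d by rewrite lt_min eta0 divr_gt0// mulr_gt0.
have sc : continuous (s \o tau).
  by move=> v; apply: continuous_comp; [exact: tauc|exact: cts_fun].
have near1 : \forall q \near q0, mdist (s (tau q0)) (s (tau q)) < d.
  have /metricType_numDomainType.cvgr_dist_lt := sc q0; exact.
have near2 : \forall q \near q0,
    `|level_dist (tau q0) (tau q0) (u q0) (u q0) -
      level_dist (tau q) (tau q0) (u q) (u q0)| < d.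
  have /pseudometric_normed_Zmodule.cvgr_dist_lt :=
    @level_dist_continuous p k tau u q0 tauc uc q0; exact.
apply: filterS2 near1 near2 => v sv lv.
apply: (@le_lt_trans _ _ (K' * d)); last first.
  apply: (@le_lt_trans _ _ (K' * (e / (2 * K')))).
    by rewrite ler_pM2l// ge_min lexx orbT.
  have -> : K' * (e / (2 * K')) = e / 2 by field; rewrite gt_eqF.
  by rewrite ltr_pdivrMr// ltr_pMr// ltr1n.
apply: near_kern => //.
- exact: vmeasure_prob.
- by move=> j x; exact: weight_01.
- by rewrite d0 ge_min lexx.
- move=> j x; rewrite (le_trans (weight_dist _ _ _ _ _ _ _))// ltW//.
  move: lv; rewrite {1}/level_dist subrr normr0 add0r big1; last first.
    by move=> m _; rewrite subrr normr0.
  by rewrite sub0r normrN => /ltr_normlW.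
- by rewrite wassersteinC.
Qed.

(* Grid indices with [m l = 0] are those of the face; all others have a vanishing
   [grid_hat] on it. *)
Lemma trim_face k (s : simplex R k.+1 -> M) l t a x :
  trim s (face l t) a x = trim (s \o face l) t a x.
Proof.
pose ins (m : index k) : index k.+1 := [ffun i => oapp m ord0 (unlift l i)].
pose del (m : index k.+1) : index k := [ffun i => m (lift l i)].
have insl m : ins m l = ord0 by rewrite ffunE unlift_none.
have inslift m i : ins m (lift l i) = m i by rewrite ffunE liftK.
have massE m : grid_mass (ins m) = grid_mass m.
  rewrite /grid_mass (bigD1_ord l)//= insl add0n.
  by apply: eq_bigr => i _; rewrite inslift.
have facel u : coord (face l u) l = 0 by rewrite /coord mxE unlift_none.
have facelift u i : coord (face l u) (lift l i) = coord u i.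
  by rewrite /coord mxE liftK.
rewrite /trim (bigID (fun m : index k.+1 => m l == ord0))/= [X in _ * X]big1 ?mulr1.
  rewrite (reindex_onto ins del) => [|m /andP[_ /eqP ml]]; last first.
    by apply/ffunP => i; rewrite ffunE; case: unliftP => [j ->|->] /=; rewrite ?ffunE.
  apply: eq_big => [m|m].
    rewrite massE insl eqxx andbT; case: eqP => //= _; apply/eqP/ffunP => i.
    by rewrite ffunE inslift.
  rewrite massE => /andP[/andP[m0 _] _]; congr (1 - _ * _ * G (s _) x).
    rewrite /grid_hat (bigD1_ord l)//= insl facel mulr0 subr0 hat_eq1.
      by rewrite mul1r; apply: eq_bigr => i _; rewrite inslift facelift.
    by rewrite normr0.
  apply: coord_inj => i; rewrite grid_pointE massE//; case: (unliftP l i) => [j ->|->].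
    by rewrite inslift facelift grid_pointE.
  by rewrite insl facel mul0r.
move=> m /andP[_ ml]; rewrite /grid_hat (bigD1 l)//= facel hat_eq0.
  by rewrite mul0r mulr0 mul0r subr0.
rewrite mulr0 sub0r normrN ger0_norm// ler1n lt0n.
by apply: contra_neq ml => ml; exact: val_inj.
Qed.

Lemma deform_face k (s : simplex R k.+1 -> M) l t u :
  deform s (face l t) u = deform (s \o face l) t u.
Proof.
rewrite /deform (_ : weight s (face l t) u = weight (s \o face l) t u)//.
by apply/funext => j; apply/funext => x; case: j => [i|] /=; rewrite trim_face.
Qed.

(** [mu0] is a default value. It allows prisms to be defined for every simplex, although they are
    deformations only for the small ones. *)
Definition thicken (mu0 : M) (mu : set X -> R) : M :=
  match pselect (finite_probability mu),
        pselect (exists2 A, U A & msupport mu `<=` A) with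
  | left p, left s => VietorisThickening p s
  | _, _ => mu0
  end.

Lemma thickenE mu0 mu : finite_probability mu ->
  (exists2 A, U A & msupport mu `<=` A) -> thicken mu0 mu = mu :> (set X -> R).
Proof. by rewrite /thicken; case: pselect => // ?; case: pselect. Qed.

(* With [th] a degeneracy and [P] a final segment of the vertices, these are the
   pieces of the prism over [s]; this form makes all simplicial identities
   equalities between maps of ordinals. *)
Definition prism_fun p k (s : simplex R k -> M) (th : 'I_p.+1 -> 'I_k.+1)
    (P : pred 'I_p.+1) (t : simplex R p) : M :=
  thicken (s (smap th t)) (deform s (smap th t) (\sum_(j | P j) coord t j)).

Lemma prism_funE p k (s : simplex R k -> M) (th : 'I_p.+1 -> 'I_k.+1) P t :
  small s -> prism_fun s th P t =
    deform s (smap th t) (\sum_(j | P j) coord t j) :> (set X -> R).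
Proof.
move=> ss; have u01 := coord_psum_01 t P.
by apply: thickenE; [exact: deform_probability|exact: deform_support].
Qed.

Lemma prism_fun_continuous p k (s : sing_simplex R k M) (th : 'I_p.+1 -> 'I_k.+1) P :
  small s -> continuous (prism_fun s th P).
Proof.
move=> ss t; have FF := nbhs_filter t.
apply/metricType_numDomainType.cvgrPdist_lt => e e0.
have uc : continuous (fun t : simplex R p => \sum_(j | P j) coord t j).
  by apply: continuous_sum => j; exact: coord_continuousP.
have := deform_near t ss (@smap_continuous _ _ _ th) uc (fun t => coord_psum_01 t P) e0.
by apply: filterS => t' tt'; rewrite mdistM wassersteinC !prism_funE.
Qed.

Definition prism p k (s : sing_simplex R k M) (th : 'I_p.+1 -> 'I_k.+1)
    (P : pred 'I_p.+1) : sing_simplex R p M :=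
  if pselect (continuous (prism_fun s th P)) is left c then mkcts c else s \o smap th.

Lemma prismE p k (s : sing_simplex R k M) (th : 'I_p.+1 -> 'I_k.+1) P t :
  small s -> prism s th P t =
    deform s (smap th t) (\sum_(j | P j) coord t j) :> (set X -> R).
Proof.
move=> ss; rewrite -prism_funE// /prism; case: pselect => // nc.
by case: nc; exact: prism_fun_continuous.
Qed.

Lemma small_face k (s : sing_simplex R k.+1 M) l : small s -> small (sing_face l s).
Proof.
move=> [kN sC sd]; split=> [|t|t u tu]; [by rewrite ltnW|exact: sC|].
apply: sd => j; rewrite /coord !mxE.
by case: unliftP => [i _|_] /=; [exact: tu|rewrite subrr normr0 divr_ge0].
Qed.

Lemma prism_face p k (s : sing_simplex R k M) (th : 'I_p.+2 -> 'I_k.+1) P l :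
  small s -> sing_face l (prism s th P) = prism s (th \o lift l) (P \o lift l).
Proof.
move=> ss; apply/continuousEP => t; apply: thickening_inj.
rewrite (prismE (th \o lift l))// -smap_comp.
rewrite -[LHS]/(vmeasure (prism s th P (face l t))) prismE// face_smap.
by rewrite smap_sum.
Qed.

Lemma prism_lift p k (s : sing_simplex R k.+1 M) (th : 'I_p.+1 -> 'I_k.+1) P
    (l : 'I_k.+2) : small s -> prism s (lift l \o th) P = prism (sing_face l s) th P.
Proof.
move=> ss; apply/continuousEP => t; apply: thickening_inj.
rewrite !prismE//; last exact: small_face.
by rewrite -smap_comp -face_smap deform_face.
Qed.

Lemma prism_bottom k (s : sing_simplex R k M) : small s -> prism s id pred0 = s.
Proof.
move=> ss; apply/continuousEP => t; apply: thickening_inj.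
by rewrite prismE// smap_id big_pred0// deform_bottom.
Qed.

Lemma prism_tame p k (s : sing_simplex R k M) (th : 'I_p.+1 -> 'I_k.+1) P :
  small s -> tame s -> tame (prism s th P).
Proof.
move=> ss st; apply: (@sub_finite_set _ _
    (\bigcup_t msupport (s t) `|` [set y i | i in setT])).
  move=> x [t _]; rewrite prismE// => /msupport_deform[[sx _]|[i ->]].
    by left; exists (smap th t).
  by right; exists i.
by rewrite finite_setU; split=> //; exact/finite_image/finite_finset.
Qed.

(** With all vertices in the final segment the time is constantly 1; pushing is then complete and
    only the points [y i] carry mass. *)
Lemma prism_top p k (s : sing_simplex R k M) (th : 'I_p.+1 -> 'I_k.+1) :
  small s -> tame (prism s th predT).
Proof.
move=> ss; apply: (@sub_finite_set _ _ [set y i | i in setT]).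
  move=> x [t _]; rewrite prismE// coord_sum => /msupport_deform[[_]|[i ->]].
    have -> : push_level 1 = 1.
      rewrite /push_level (_ : 2 * 1 - 1 = 1); last by ring.
      by apply/max_idPr; exact: ler01.
    by rewrite eqxx.
  by exists i.
exact/finite_image/finite_finset.
Qed.

End Deformation.

(** * Cut-off functions and uniform radii *)

Section Cut.
Variables (R : realType) (X : metricType R).

(** For [r > 0] it vanishes on [s] and is 1 at distance at least [r] from [s]. As a product it is
    multiplicative under concatenation, and it agrees with the product of the functions [off]. *)
Definition cut (s : seq X) (r : R) (x : X) : R :=
  \prod_(z <- s) Num.min 1 (mdist x z / r).

Let factor_01 (r : R) (x z : X) : 0 < r -> 0 <= Num.min 1 (mdist x z / r) <= 1.
Proof.
move=> r0; rewrite le_min ler01 ge_min lexx/= andbT.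
by rewrite divr_ge0 ?mdist_ge0// ltW.
Qed.

Lemma cut_01 s r x : 0 < r -> 0 <= cut s r x <= 1.
Proof. by move=> r0; apply: prod_01 => z; exact: factor_01. Qed.

Lemma cut_lipschitz s r : 0 < r -> lipschitz_with ((size s)%:R / r) (cut s r).
Proof.
move=> r0 x x'; rewrite (le_trans (prod_dist _ _ _ _))//.
- by move=> z; exact: factor_01.
- by move=> z; exact: factor_01.
apply: (@le_trans _ _ (\sum_(z <- s) mdist x x' / r)).
  apply: ler_sum => z _; rewrite (le_trans (minr_dist _ _ _))// -mulrBl normrM.
  rewrite (@gtr0_norm _ r^-1) ?invr_gt0// ler_pM2r ?invr_gt0//.
  by rewrite (metric_sym x) (metric_sym x') mdist_reverse_triangle.
by rewrite big_const_seq count_predT iter_addr_0 -[X in X <= _]mulr_natl mulrA mulrAC.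
Qed.

Lemma cut_eq0 s r z : z \in s -> cut s r z = 0.
Proof.
move=> zs; rewrite /cut (big_rem z)//= mdistxx mul0r.
by rewrite (min_idPr ler01) mul0r.
Qed.

Lemma cut_lt1 s r x : 0 < r -> cut s r x < 1 -> exists2 z, z \in s & mdist x z < r.
Proof.
move=> r0 c1; apply: contrapT => far; move: c1; rewrite ltNge => /negP; apply.
rewrite /cut big_seq big1// => z zs; apply/min_idPl; rewrite ler_pdivlMr// mul1r.
by rewrite leNgt; apply/negP => xz; apply: far; exists z.
Qed.

Lemma expect_cut s r mu : 0 < r -> finite_probability mu ->
  msupport mu `<=` [set` s] -> expect mu (cut s r) = 0.
Proof.
move=> r0 mup ms; apply/eqP; rewrite eq_le; apply/andP; split.
  rewrite -[leRHS](mul0r (expect mu (fun=> 1))) -expectZ//.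
  by apply: le_expect => // x /ms xs; rewrite cut_eq0// mul0r.
rewrite -[leLHS](mul0r (expect mu (fun=> 1))) -expectZ//.
by apply: le_expect => // x _; rewrite mul0r; have /andP[] := cut_01 s x r0.
Qed.

Lemma cut_flatten (I : eqType) (l : seq I) (f : I -> seq X) r x i : 0 < r ->
  i \in l -> cut (flatten [seq f j | j <- l]) r x <= cut (f i) r x.
Proof.
move=> r0; have c01 s : 0 <= cut s r x <= 1 by exact: cut_01.
have cat s s' : cut (s ++ s') r x = cut s r x * cut s' r x by exact: big_cat.
elim: l => // j l IHl; rewrite inE /= cat.
have /andP[c0 c1] := c01 (f j).
have /andP[d0 d1] := c01 (flatten [seq f j | j <- l]).
case/predU1P => [->|/IHl]; first by rewrite ler_piMr.
by apply: le_trans; rewrite ler_piMl.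
Qed.

End Cut.

(** A Lebesgue number for balls whose radius depends on the centre: half radii are used for the
    cover, and the other half absorbs [d]. *)
Lemma lebesgue_number (R : realType) (Y : metricType R) (C : set Y) (e : Y -> R) :
  compact C -> (forall p, 0 < e p) ->
  exists (r : {fset Y}) (d : R), 0 < d /\ forall p, C p ->
    exists2 c, c \in r & forall p', mdist p p' < d -> mdist c p' < e c.
Proof.
move=> Cco e0; pose f c : set Y := interior (ball c (e c / 2)).
have [||r rP] := @compact_finite_cover Y Y C f Cco.
- by move=> c; exact: open_interior.
- by move=> p _; exists p; apply: nbhsx_ballx; rewrite divr_gt0.
exists r, (\big[Num.min/1]_(c <- r) (e c / 2)); split.
  by apply: lt_bigmin => // c _; rewrite divr_gt0.
move=> p /rP[c cr /interior_subset]; rewrite ballEmdist /= => cp.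
exists c => // p' pp'; rewrite (le_lt_trans (metric_triangle _ p _))//.
rewrite (splitr (e c)) ltrD// (lt_le_trans pp')//.
exact: ge_bigmin_seq.
Qed.

(** The factor 2 leaves room to move a point within [r] of [s] by a further distance less than
    [r]. *)
Lemma open_list_radius (R : realType) (X : metricType R) (A : set X) (s : seq X) :
  open A -> (forall z, z \in s -> A z) ->
  exists2 r : R, 0 < r & forall z x, z \in s -> mdist z x < 2 * r -> A x.
Proof.
move=> Ao sA; have [z|e eP] := @choice X R (fun z e => 0 < e /\
    (z \in s -> forall x, mdist z x < e -> A x)).
  have [zs|_] := boolP (z \in s); last by exists 1.
  have /nbhs_ballP[e /= e0 eA] : nbhs z A by apply: open_nbhs_nbhs; split=> //; exact: sA.
  by exists e; split=> // _ x zx; apply: eA; rewrite ballEmdist.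
exists ((\big[Num.min/1]_(z <- s) e z) / 2).
  by rewrite divr_gt0//; apply: lt_bigmin => // z _; case: (eP z).
move=> z x zs; rewrite mulrCA divff// mulr1 => zx.
apply: (eP z).2 => //; rewrite (lt_le_trans zx)//.
exact: ge_bigmin_seq.
Qed.

(** * Prisms over a prescribed finite set of simplices *)

Section PrismFamilies.
Variables (R : realType) (X : metricType R) (U : set (set X)).
Local Notation M := (vietoris_thickening U).
Local Notation simp k := (sing_simplex R k M).

(** What the chain homotopy needs to know about prisms, with the grid and all constants hidden. *)
Record prism_family := PrismFamily {
  good : forall k, simp k -> Prop;
  pr : forall p k, simp k -> ('I_p.+1 -> 'I_k.+1) -> pred 'I_p.+1 -> simp p;
  good_face : forall k (s : simp k.+1) l, good s -> good (sing_face l s);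
  pr_face : forall p k (s : simp k) (th : 'I_p.+2 -> 'I_k.+1) P l, good s ->
    sing_face l (pr s th P) = pr s (th \o lift l) (P \o lift l);
  pr_lift : forall p k (s : simp k.+1) (th : 'I_p.+1 -> 'I_k.+1) P (l : 'I_k.+2),
    good s -> pr s (lift l \o th) P = pr (sing_face l s) th P;
  pr_bottom : forall k (s : simp k), good s -> pr s id pred0 = s;
  pr_tame : forall p k (s : simp k) (th : 'I_p.+1 -> 'I_k.+1) P, good s -> tame s ->
    tame (pr s th P);
  pr_top : forall p k (s : simp k) (th : 'I_p.+1 -> 'I_k.+1), good s ->
    tame (pr s th predT)
}.

(** Order of choices: [dat] gives each measure its support, a radius and a cover set; [P] and [d]
    are the centres and scale for trimming; [rho] is bounded by the radii over [P]; a second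
    covering [P'] at scale [rho] supplies the points [y]; the mesh [L] comes last, from uniform
    continuity at scale [d]. *)
Lemma prism_family_exists n (S : seq (simp n)) : open_cover U ->
  exists D : prism_family, forall s, s \in S -> good D s.
Proof.
move=> [Uo Ucov].
have [mu|dat datP] := @choice M (seq X * R * set X) (fun mu d =>
    [/\ msupport mu = [set` d.1.1], 0 < d.1.2, U d.2 &
     forall z x, z \in d.1.1 -> mdist z x < 2 * d.1.2 -> d.2 x]).
  have [s sE] := finite_setP (finite_msupport (vmeasure_prob mu)).
  have [A UA sA] := vmeasure_supp mu.
  have [z zs|r r0 rA] := open_list_radius (s := s) (Uo _ UA).
    by apply: sA; rewrite sE.
  by exists (s, r, A).
pose sp mu := (dat mu).1.1; pose rd mu := (dat mu).1.2; pose cv mu := (dat mu).2.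
have rd0 mu : 0 < rd mu by case: (datP mu).
pose N := n.+1; pose eta : R := (2 * 2 ^+ N)^-1.
have eta0 : 0 < eta by rewrite invr_gt0 mulr_gt0// exprn_gt0.
pose C := \bigcup_(s in [set` S]) range s.
have Cco : compact C.
  rewrite /C bigcup_seq; apply: bigsetU_compact => s _.
  apply: continuous_compact; last exact: compact_simplex.
  by apply: continuous_subspaceT; exact: cts_fun.
(* The cut-off around the support of [mu] has mean 0 for [mu]; being Lipschitz, it has small mean
   nearby. *)
have near_small r eps : 0 < r -> 0 < eps -> forall mu nu : M,
    mdist mu nu < eps / ((size (sp mu))%:R / r + 1) ->
    expect nu (cut (sp mu) r) <= eps.
  move=> r0 eps0 mu nu d; have [muE _ _ _] := datP mu.
  have K0 : 0 <= (size (sp mu))%:R / r by rewrite divr_ge0// ltW.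
  have := expect_lipschitz K0 (vmeasure_prob nu) (vmeasure_prob mu)
    (cut_lipschitz (sp mu) r0).
  rewrite (expect_cut r0 (vmeasure_prob mu)) ?muE// subr0 => /ler_normlW.
  move=> /le_trans; apply; move: d; rewrite mdistM wassersteinC.
  rewrite ltr_pdivlMr ?ltr_wpDl// mulrC mulrDl mul1r => /ltW; apply: le_trans.
  by rewrite lerDl wasserstein_ge0//; exact: vmeasure_prob.
have K1 mu r : 0 < r -> (0 : R) < (size (sp mu))%:R / r + 1.
  by move=> r0; rewrite ltr_wpDl// divr_ge0// ltW.
have [P [d [d0 dP]]] := lebesgue_number Cco
  (fun mu => divr_gt0 eta0 (K1 mu _ (rd0 mu))).
pose rho : R := \big[Num.min/1]_(mu <- P) rd mu.
have rho0 : 0 < rho by apply: lt_bigmin => // mu _.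
(* A quarter, since [y_tight] asks for a mean strictly below 1/2. *)
have q0 : (0 : R) < 4^-1 by rewrite invr_gt0.
have [P' [d' [d'0 d'P]]] := lebesgue_number Cco
  (fun mu => divr_gt0 q0 (K1 mu _ rho0)).
(* [sel p] is the centre in [P] attached to [p]; outside [C] its value is arbitrary. *)
have [p|sel selP] := @choice M M (fun p c => C p -> c \in P /\ forall nu,
    mdist p nu < d -> mdist c nu < eta / ((size (sp c))%:R / rd c + 1)).
  have [Cp|] := pselect (C p); last by exists p.
  by have [c cP cd] := dP p Cp; exists c.
pose Y := flatten [seq sp mu | mu <- P']; pose y := tnth (in_tuple Y).
have [s|kap kapP] := @choice (simp n) R (fun s k => 0 < k /\
    forall t u, (forall j, `|coord t j - coord u j| <= k) -> mdist (s t) (s u) < d).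
  have [k k0 kP] := simplex_uniform_continuity (cts_fun (s := s)) d0.
  by exists k.
pose k := \big[Num.min/1]_(s <- S) kap s.
have k0 : 0 < k by apply: lt_bigmin => // s _; case: (kapP s).
pose L := ((Num.truncn (N.+1%:R / k)).+1 + N)%N.
have NL : (N < L)%N by rewrite /L addSn ltnS leq_addl.
have Lk : N.+1%:R / L%:R <= k.
  rewrite ler_pdivrMr ?ltr0n// mulrC -ler_pdivrMr//.
  have /andP[_ /ltW] : (Num.truncn (N.+1%:R / k))%:R <= N.+1%:R / k <
    (Num.truncn (N.+1%:R / k)).+1%:R by apply: truncn_itv; rewrite divr_ge0// ltW.
  by move=> /le_trans; apply; rewrite ler_nat leq_addr.
pose G p := cut (sp (sel p)) (rd (sel p)); pose V p := cv (sel p).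
have G_01 p x : 0 <= G p x <= 1 by exact: cut_01.
have G_lip p : exists2 K : R, 0 <= K & lipschitz_with K (G p).
  exists ((size (sp (sel p)))%:R / rd (sel p)); first by rewrite divr_ge0// ltW.
  exact: cut_lipschitz.
have G_small p nu : C p -> mdist p nu < d -> expect nu (G p) <= eta.
  by move=> /selP[_ +] pn => /(_ _ pn); apply: near_small.
have V_U p : C p -> U (V p) by move=> _; rewrite /V /cv; case: (datP (sel p)).
have V_near p x : C p -> G p x < 1 ->
    V p x /\ forall i, mdist x (y i) < rho -> V p (y i).
  move=> /selP[cP _] /(cut_lt1 (rd0 _))[z zs xz]; have [_ _ _ near_cv] := datP (sel p).
  have rd2 : rd (sel p) < 2 * rd (sel p) by rewrite ltr_pMl// ltr1n.
  split=> [|i xy]; apply: (near_cv z) => //.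
    by rewrite metric_sym (lt_trans xz).
  rewrite (le_lt_trans (metric_triangle _ x _))// mulr_natl mulr2n metric_sym ltrD//.
  by rewrite (lt_le_trans xy)//; exact: ge_bigmin_seq.
have y_tight p : C p -> expect p (fun x => \prod_i off y rho i x) < 2^-1.
  move=> Cp; have [c cP' cd] := d'P p Cp.
  apply: (@le_lt_trans _ _ (4^-1 : R)); last by rewrite ltf_pV2 ?posrE// ltr_nat.
  have pp : mdist p p < d' by rewrite mdistxx.
  apply: (le_trans _ (near_small rho _ rho0 q0 c p (cd p pp))).
  apply: le_expect; first exact: vmeasure_prob.
  move=> x _; rewrite (le_trans _ (cut_flatten sp x rho0 cP'))//.
  rewrite (_ : \prod_i off y rho i x = cut Y rho x)//.
  by rewrite /cut [RHS]big_tnth.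
pose D := @PrismFamily (fun k s => small N L d C s)
  (@prism _ _ _ L G _ y rho)
  (fun k s l => @small_face _ _ _ _ _ _ _ _ s l)
  (fun p k s => prism_face rho0 G_01 G_lip G_small V_U V_near y_tight NL (s := s))
  (fun p k s => prism_lift rho0 G_01 G_lip G_small V_U V_near y_tight NL (s := s))
  (fun k s => prism_bottom rho0 G_01 G_lip G_small V_U V_near y_tight NL (s := s))
  (fun p k s => prism_tame rho0 G_01 G_lip G_small V_U V_near y_tight NL (s := s))
  (fun p k s => prism_top rho0 G_01 G_lip G_small V_U V_near y_tight NL (s := s)).
exists D => s sS; split=> //= [t|t u tu].
  by exists s => //; exists t.
apply: (kapP s).2 => j; rewrite (le_trans (tu j))// (le_trans Lk)//.
exact: ge_bigmin_seq.
Qed.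

End PrismFamilies.

(** * Singular chains *)

Section AlternatingSums.
Variable V : zmodType.
Implicit Types (a b : nat -> nat -> V) (e : nat -> V) (x : V).

Let sgn n x : V := x *~ (-1) ^+ n.

Let sgnS n x : sgn n.+1 x = - sgn n x.
Proof. by rewrite /sgn exprS mulN1r mulrNz. Qed.

(** Terms with [j < i] are rewritten and shifted by one in [i]; they then match the remaining terms
    with the opposite sign. *)
Lemma face_face_sum k a :
  (forall i j, (j < i < k.+2)%N -> a j i = a i.-1 j) ->
  \sum_(0 <= i < k.+2) \sum_(0 <= j < k.+1) a j i *~ (-1) ^+ (i + j) = 0.
Proof.
move=> aE; transitivity (\sum_(0 <= i < k.+2) \sum_(0 <= j < k.+1)
   ((if (j < i)%N then sgn (i + j) (a i.-1 j) else 0) +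
    (if (i <= j)%N then sgn (i + j) (a j i) else 0))).
  apply: eq_big_nat => i /andP[_ ik]; apply: eq_big_nat => j _.
  by have [ji|ij] := ltnP j i; rewrite ?addr0 ?add0r// aE ?ji.
under eq_bigr do rewrite big_split/=.
rewrite big_split/= big_nat_recl//= big1 ?add0r//.
rewrite [X in _ + X]big_nat_recr//= [X in _ + (_ + X)]big_nat_cond.
rewrite [X in _ + (_ + X)]big1 ?addr0; last first.
  by move=> j /andP[/andP[_ jk] _]; rewrite leqNgt jk.
rewrite [X in _ + X]exchange_big_nat/= -big_split/= big1// => i _.
rewrite -big_split/= big1// => j _; rewrite ltnS addSn sgnS (addnC j).
by case: ifP => _; rewrite ?addNr ?addr0.
Qed.

(** Here [a j i] stands for face [j] of piece [i] of a prism, [b j i] for piece [i] over face [j],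
    and [e i] for the walls between pieces. Outer faces cancel against [b]; the walls telescope. *)
Lemma prism_boundary_sum k a b e :
  (forall i j, (j < i <= k)%N -> a j i = b j i.-1) ->
  (forall i, (i <= k)%N -> a i i = e i) ->
  (forall i, (i <= k)%N -> a i.+1 i = e i.+1) ->
  (forall i j, (i.+1 < j <= k.+1)%N -> a j i = b j.-1 i) ->
  \sum_(0 <= j < k.+2) \sum_(0 <= i < k.+1) a j i *~ (-1) ^+ (i + j) +
  \sum_(0 <= j < k.+1) \sum_(0 <= i < k) b j i *~ (-1) ^+ (i + j) = e 0 - e k.+1.
Proof.
move=> a1 a2 a3 a4.
have sq i : (-1) ^+ (i + i) = 1 :> int by rewrite addnn -mul2n exprM sqrrN !expr1n.
have -> : \sum_(0 <= j < k.+2) \sum_(0 <= i < k.+1) a j i *~ (-1) ^+ (i + j) =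
  \sum_(0 <= j < k.+2) \sum_(0 <= i < k.+1)
   ((if (j < i)%N then sgn (i + j) (b j i.-1) else 0) +
    (if (i.+1 < j)%N then sgn (i + j) (b j.-1 i) else 0) +
    ((if j == i then e i else 0) - (if j == i.+1 then e i.+1 else 0))).
  apply: eq_big_nat => j /andP[_ jk]; apply: eq_big_nat => i /andP[_ ik].
  have ik' : (i <= k)%N by rewrite -ltnS.
  have [ji|ij|E] := ltngtP j i; last move: (E) ik' => <- jk'.
  - have /negPf -> : j != i.+1 by lia.
    by rewrite a1 ?ji// ltnNge leqW ?(ltnW ji)// subr0 !addr0.
  - have [ij'|ji|<-] := ltngtP i.+1 j; rewrite ?add0r ?addr0 ?subr0.
    + by rewrite a4 ?ij'.
    + by move: ij; rewrite ltnNge -ltnS ji.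
    + by rewrite a3// addnS exprS mulN1r mulrNz sq.
  - have /negPf -> : j != j.+1 by lia.
    by rewrite a2// ltnNge leqnSn/= !add0r subr0 sq.
under eq_bigr do rewrite 2!big_split/=.
rewrite 2!big_split/= [LHS]addrAC -[RHS]add0r; congr (_ + _); last first.
  rewrite exchange_big_nat/= -[RHS]opprB -(telescope_sumr e (leq0n k.+1)) -sumrN.
  apply: eq_big_nat => i /andP[_ ik].
  rewrite sumrB -!big_mkcond !big_nat1_eq/= opprB.
  by rewrite !ifT//; lia.
have -> : \sum_(0 <= j < k.+2) \sum_(0 <= i < k.+1)
      (if (j < i)%N then sgn (i + j) (b j i.-1) else 0) =
    \sum_(0 <= j < k.+1) \sum_(0 <= i < k)
      (if (j <= i)%N then - sgn (i + j) (b j i) else 0).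
  rewrite big_nat_recr//= [X in _ + X]big_nat_cond [X in _ + X]big1 ?addr0; last first.
    by move=> i /andP[/andP[_ ik] _]; rewrite ltnNge (ltnW ik).
  apply: eq_bigr => j _; rewrite big_nat_recl//= add0r.
  by apply: eq_bigr => i _; rewrite ltnS addSn sgnS.
have -> : \sum_(0 <= j < k.+2) \sum_(0 <= i < k.+1)
      (if (i.+1 < j)%N then sgn (i + j) (b j.-1 i) else 0) =
    \sum_(0 <= j < k.+1) \sum_(0 <= i < k)
      (if (i < j)%N then - sgn (i + j) (b j i) else 0).
  rewrite big_nat_recl//= [X in X + _]big1 ?add0r//; apply: eq_big_nat => j /andP[_ jk].
  rewrite big_nat_recr//= ltnS ltnNge -ltnS jk addr0.
  by apply: eq_bigr => i _; rewrite ltnS addnS sgnS.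
rewrite -!big_split/= big1// => j _; rewrite -!big_split/= big1// => i _.
by case: leqP => _; rewrite ?addr0 ?add0r addNr.
Qed.
End AlternatingSums.

(** * Chains supported on a given class of simplices *)

Section SupportedChains.
Variables (K : choiceType) (G : zmodType).
Implicit Types (P : K -> Prop) (c : malg K G).

Definition supported P c : Prop := forall k, k \in msupp c -> P k.

Lemma supported0 P : supported P 0.
Proof. by move=> k; rewrite msupp0. Qed.

Lemma supportedD P c d : supported P c -> supported P d -> supported P (c + d).
Proof.
by move=> cP dP k /(fsubsetP (msuppD_le c d)); rewrite inE => /orP[/cP|/dP].
Qed.

Lemma supportedN P c : supported P c -> supported P (- c).
Proof. by move=> cP k; rewrite msuppN; exact: cP. Qed.

Lemma supportedB P c d : supported P c -> supported P d -> supported P (c - d).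
Proof. by move=> cP dP; apply: supportedD => //; exact: supportedN. Qed.

Lemma supportedMz P c z : supported P c -> supported P (c *~ z).
Proof.
move=> cP; have cn n : supported P (c *+ n).
  elim: n => [|n IHn]; first by rewrite mulr0n; exact: supported0.
  by rewrite mulrS; exact: supportedD.
case: z => n; first by rewrite -pmulrn.
by rewrite NegzE mulrNz -pmulrn; exact: supportedN.
Qed.

Lemma supported_sum P (I : Type) (r : seq I) (Q : pred I) (F : I -> malg K G) :
  (forall i, Q i -> supported P (F i)) -> supported P (\sum_(i <- r | Q i) F i).
Proof. by move=> FP; elim/big_ind : _ => //; [exact: supported0|exact: supportedD]. Qed.

Lemma supportedU P k g : P k -> supported P (mkmalgU k g).
Proof. by move=> Pk l /(fsubsetP msuppU_le); rewrite inE => /eqP ->. Qed.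

Lemma chain_ind P (Q : malg K G -> Prop) : Q 0 -> (forall c d, Q c -> Q d -> Q (c + d)) ->
  (forall k g, P k -> Q (mkmalgU k g)) -> forall c, supported P c -> Q c.
Proof.
move=> Q0 QD QU c cP; rewrite (monalgE c) big_seq.
by elim/big_ind : _ => // k /cP; exact: QU.
Qed.

End SupportedChains.

Lemma supported_chain_map (K L : choiceType) (G : zmodType) (phi : K -> L)
    (P : L -> Prop) (c : malg K G) :
  supported (P \o phi) c -> supported P (chain_map phi c).
Proof.
move=> cP; rewrite /chain_map big_seq; apply: supported_sum => k kc.
by apply: (@supportedU _ G P (phi k)); have := cP k kc.
Qed.

Lemma eq_chain_map (K L : choiceType) (G : zmodType) (phi psi : K -> L)
    (c : malg K G) : (forall k, k \in msupp c -> phi k = psi k) ->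
  chain_map phi c = chain_map psi c.
Proof. by move=> e; apply: eq_big_seq => k kc; rewrite e. Qed.

Lemma chain_map_id (K : choiceType) (G : zmodType) (c : malg K G) :
  chain_map id c = c.
Proof. by rewrite [RHS]monalgE. Qed.

Lemma mcoeff_chain_map (K L : choiceType) (G : zmodType) (phi : K -> L)
    (c : malg K G) k : injective phi -> mcoeff (phi k) (chain_map phi c) = mcoeff k c.
Proof.
move=> phi_inj; rewrite [in RHS](monalgE c) !raddf_sum/=.
by apply: eq_bigr => l _; rewrite !mcoeffU (inj_eq phi_inj).
Qed.

Lemma chain_map_inj (K L : choiceType) (G : zmodType) (phi : K -> L) :
  injective phi -> injective (@chain_map K L G phi).
Proof.
by move=> phi_inj c d cd; apply/malgP => k; rewrite -!(mcoeff_chain_map _ _ phi_inj) cd.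
Qed.

Section SingularBoundary.
Variables (R : realType) (G : zmodType) (T : topologicalType).
Local Notation chain n := (sing_chain R G n T).

Lemma sing_bdE n (c : chain n.+1) : sing_bd c =
  \sum_(0 <= i < n.+2) chain_map (sing_face (inord i : 'I_n.+2)) c *~ (-1) ^+ i.
Proof. by rewrite big_mkord; apply: eq_bigr => i _; rewrite inord_val. Qed.

Lemma sing_bdMz n (c : chain n) z : sing_bd (c *~ z) = sing_bd c *~ z.
Proof. exact: raddfMz. Qed.

Lemma sing_bdD n : {morph @sing_bd R G n T : c d / c + d}.
Proof. exact: raddfD. Qed.

Lemma sing_bdB n : {morph @sing_bd R G n T : c d / c - d}.
Proof. exact: raddfB. Qed.

Lemma sing_bd_sum n (I : Type) (r : seq I) (P : pred I) (F : I -> chain n) :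
  sing_bd (\sum_(i <- r | P i) F i) = \sum_(i <- r | P i) sing_bd (F i).
Proof. exact: raddf_sum. Qed.

Lemma sing_bd_bd n (c : chain n.+1) : sing_bd (sing_bd c) = 0.
Proof.
case: n c => [//|n] c.
rewrite -[RHS](@face_face_sum _ n.+1 (fun j i => chain_map
  (sing_face (inord j : 'I_n.+2) \o sing_face (inord i : 'I_n.+3)) c)); last first.
  move=> i j /andP[ji ik]; apply: eq_chain_map => s _; apply/continuousEP => t /=.
  rewrite !face_smap !smap_comp; congr (s (smap _ t)); apply/funext => l.
  by apply: val_inj; rewrite /= /bump !inordK; lia.
rewrite [sing_bd c]sing_bdE sing_bd_sum; apply: eq_big_nat => i _.
rewrite sing_bdMz sing_bdE mulrz_suml; apply: eq_bigr => j _.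
by rewrite chain_map_comp exprD mulrzA mulrzAC.
Qed.

Lemma supported_bd n (P : sing_simplex R n.+1 T -> Prop)
    (Q : sing_simplex R n T -> Prop) (c : chain n.+1) :
  (forall s i, P s -> Q (sing_face i s)) -> supported P c -> supported Q (sing_bd c).
Proof.
move=> PQ cP; apply: supported_sum => i _; apply: supportedMz.
by apply: supported_chain_map => s sc; apply: PQ; exact: cP.
Qed.

End SingularBoundary.

(** * The prism operator and relative acyclicity *)

Section RelativeAcyclicity.
Variables (R : realType) (X : metricType R) (U : set (set X)) (G : zmodType).
Local Notation K := (vietoris_complex U).
Local Notation M := (vietoris_thickening U).
Local Notation simp k := (sing_simplex R k M).
Local Notation chain k := (sing_chain R G k M).

Section Prisms.
Variable D : prism_family U.

Definition degeneracy k (i : nat) (j : 'I_k.+2) : 'I_k.+1 := inord (j - (i < j)).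

(** Vertices up to [i] lie on the bottom of the prism and later ones on the top: the classical
    simplex [[v_0, .., v_i, w_i, .., w_k]]. *)
Definition prism_piece k (i : nat) (s : simp k) : simp k.+1 :=
  pr D s (degeneracy i) (fun j => i < j)%N.

Lemma prism_piece_face_lt k (s : simp k.+1) i j : (j < i <= k.+1)%N -> good D s ->
  sing_face (inord j : 'I_k.+3) (prism_piece i s) =
  prism_piece i.-1 (sing_face (inord j : 'I_k.+2) s).
Proof.
move=> /andP[ji ik] gs; rewrite /prism_piece pr_face// -pr_lift//.
congr (pr D s _ _); apply/funext => l; last first.
  by rewrite /= /bump inordK; lia.
by apply: val_inj; case: l => m lk; rewrite /= /degeneracy/= /bump !inordK; lia.
Qed.

Lemma prism_piece_face_gt k (s : simp k.+1) i j : (i.+1 < j <= k.+2)%N -> good D s ->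
  sing_face (inord j : 'I_k.+3) (prism_piece i s) =
  prism_piece i (sing_face (inord j.-1 : 'I_k.+2) s).
Proof.
move=> /andP[ji ik] gs; rewrite /prism_piece pr_face// -pr_lift//.
congr (pr D s _ _); apply/funext => l; last first.
  by rewrite /= /bump inordK; lia.
by apply: val_inj; case: l => m lk; rewrite /= /degeneracy/= /bump !inordK; lia.
Qed.

Lemma prism_piece_face_eq k (s : simp k) i : (i <= k)%N -> good D s ->
  sing_face (inord i : 'I_k.+2) (prism_piece i s) = pr D s id (fun j => i <= j)%N.
Proof.
move=> ik gs; rewrite /prism_piece pr_face//.
congr (pr D s _ _); apply/funext => l; last first.
  by rewrite /= /bump inordK; lia.
by apply: val_inj; case: l => m lk; rewrite /= /degeneracy/= /bump !inordK; lia.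
Qed.

Lemma prism_piece_face_succ k (s : simp k) i : (i <= k)%N -> good D s ->
  sing_face (inord i.+1 : 'I_k.+2) (prism_piece i s) = pr D s id (fun j => i < j)%N.
Proof.
move=> ik gs; rewrite /prism_piece pr_face//.
congr (pr D s _ _); apply/funext => l; last first.
  by rewrite /= /bump inordK; lia.
by apply: val_inj; case: l => m lk; rewrite /= /degeneracy/= /bump !inordK; lia.
Qed.

Definition prism_op k (c : chain k) : chain k.+1 :=
  \sum_(0 <= i < k.+1) chain_map (prism_piece i) c *~ (-1) ^+ i.

(** Degree 0 is a separate case because [k.-1.+1] is then not [k]. *)
Definition prism_op_bd k : chain k -> chain k :=
  if k is k'.+1 then fun c => prism_op (sing_bd c) else fun=> 0.

(** The wall [e 0] is the top of the prism and [e k.+1] its bottom, which is [c] itself. *)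
Lemma prism_op_boundary k (c : chain k) : supported (@good _ _ _ D k) c ->
  sing_bd (prism_op c) + prism_op_bd c = chain_map (fun s => pr D s id predT) c - c.
Proof.
move=> cD.
pose a j i : chain k := chain_map (sing_face (inord j : 'I_k.+2) \o prism_piece i) c.
pose e i : chain k := chain_map (fun s => pr D s id (fun j => i <= j)%N) c.
have -> : sing_bd (prism_op c) = \sum_(0 <= j < k.+2) \sum_(0 <= i < k.+1)
    a j i *~ (-1) ^+ (i + j).
  rewrite /prism_op sing_bd_sum exchange_big_nat; apply: eq_bigr => i _.
  rewrite sing_bdMz sing_bdE mulrz_suml; apply: eq_bigr => j _.
  by rewrite chain_map_comp exprD mulrzA mulrzAC.
have -> : chain_map (fun s => pr D s id predT) c = e 0%N by [].
have e_bottom : e k.+1 = c.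
  rewrite -[RHS]chain_map_id; apply: eq_chain_map => s /cD gs.
  rewrite -[RHS](pr_bottom gs); congr (pr D s _ _); apply/funext => j.
  by rewrite leqNgt ltn_ord.
rewrite -[X in _ - X]e_bottom.
have a_eq i : (i <= k)%N -> a i i = e i.
  by move=> ik; apply: eq_chain_map => s /cD gs; exact: prism_piece_face_eq.
have a_succ i : (i <= k)%N -> a i.+1 i = e i.+1.
  by move=> ik; apply: eq_chain_map => s /cD gs; exact: prism_piece_face_succ.
(* In degree 0 there are no outer faces, and the sum over [b] is empty. *)
case: k => [|k] in c cD a e e_bottom a_eq a_succ *.
  rewrite -(@prism_boundary_sum _ 0 a (fun _ _ => 0) e)//.
  - by rewrite [X in _ = _ + X]big1// => j _; rewrite big_geq.
  - by move=> i j; lia.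
  - by move=> i j; lia.
pose b j i : chain k.+1 := chain_map (prism_piece i \o sing_face (inord j : 'I_k.+2)) c.
rewrite -(@prism_boundary_sum _ k.+1 a b e)//; first last.
- move=> i j ij; apply: eq_chain_map => s /cD gs; exact: prism_piece_face_gt.
- move=> i j ij; apply: eq_chain_map => s /cD gs; exact: prism_piece_face_lt.
congr (_ + _).
rewrite /prism_op_bd sing_bdE /prism_op exchange_big_nat; apply: eq_bigr => i _.
rewrite raddf_sum mulrz_suml; apply: eq_bigr => j _.
by rewrite raddfMz /= chain_map_comp exprD mulrzA mulrzAC.
Qed.

Lemma prism_op_bd_tame k (c : chain k) : supported (@good _ _ _ D k) c ->
  supported (@tame _ _ U k.-1) (sing_bd c) -> supported (@tame _ _ U k) (prism_op_bd c).
Proof.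
case: k c => [|k] c cD ct; first exact: supported0.
apply: supported_sum => i _; apply: supportedMz; apply: supported_chain_map => s sc.
apply: pr_tame; last exact: ct.
by apply: (supported_bd _ cD sc) => {sc}s j; exact: good_face.
Qed.

End Prisms.

Lemma sing_map_inj n : injective (@sing_map R n _ _ (vietoris_id U)).
Proof.
move=> s t st; apply/continuousEP => x; apply: (@vietoris_id_inj _ _ U).
by have /continuousEP/(_ x) := st.
Qed.

Lemma tame_chain_lift n (c : chain n) : supported (@tame _ _ U n) c ->
  exists k : sing_chain R G n K, sing_chain_map (vietoris_id U) k = c.
Proof.
move: c; apply: chain_ind => [|c d [k <-] [l <-]|s g /tame_lift[k <-]].
- by exists 0; rewrite raddf0.
- by exists (k + l); rewrite raddfD.
- by exists (mkmalgU k g); rewrite /sing_chain_map chain_mapU.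
Qed.

Lemma tame_sing_chain_map n (k : sing_chain R G n K) :
  supported (@tame _ _ U n) (sing_chain_map (vietoris_id U) k).
Proof. by apply: supported_chain_map => s _; exact: sing_map_tame. Qed.

(** The prism formula for a family adapted to the simplices of [c]: the top is tame, and so is the
    prism over the tame boundary. Both therefore come from the complex. *)
Theorem relative_acyclicity n (c : chain n) : open_cover U ->
  supported (@tame _ _ U n.-1) (sing_bd c) ->
  exists (e : chain n.+1) (k : sing_chain R G n K),
    c = sing_bd e + sing_chain_map (vietoris_id U) k.
Proof.
move=> Uo ct; have [D Dc] := prism_family_exists (msupp c) Uo.
have cD : supported (@good _ _ _ D n) c by move=> s; exact: Dc.
have [k kE] : exists k : sing_chain R G n K, sing_chain_map (vietoris_id U) k =
    chain_map (fun s => pr D s id predT) c - prism_op_bd D c.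
  apply: tame_chain_lift; apply: supportedB; last exact: prism_op_bd_tame.
  by apply: supported_chain_map => s /cD; exact: pr_top.
exists (- prism_op D c), k; rewrite kE raddfN/=.
have -> : chain_map (fun s => pr D s id predT) c =
    sing_bd (prism_op D c) + prism_op_bd D c + c by rewrite prism_op_boundary// subrK.
by rewrite [X in - _ + X]addrAC addrK addKr.
Qed.

End RelativeAcyclicity.

(** * Homology and cohomology *)

Section HomologyClasses.
Variables (A B C : zmodType) (f : {additive A -> B}) (g : {additive B -> C}).

Lemma homology_class_eq0 (z : cycles g) :
  homology_class f z = 0 <-> exists a, f a = cycle_val z.
Proof.
rewrite -[X in _ = X](raddf0 (homology_class f)); split.
  by move=> /eqP; rewrite -Quotient.idealrBE subr0 => /is_boundaryP.
by move=> fz; apply/eqP; rewrite -Quotient.idealrBE subr0; apply/is_boundaryP.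
Qed.

Lemma additive_bijective (h : {additive A -> B}) :
  (forall x, h x = 0 -> x = 0) -> (forall y, exists x, h x = y) -> bijective h.
Proof.
move=> h0 hs; have [k kP] := @choice B A (fun y x => h x = y) hs.
by exists k => // x; apply: (raddf_inj h0); rewrite kP.
Qed.

Lemma homology_class_surj (h : homology f g) : exists z, homology_class f z = h.
Proof. by exists (repr h); exact: homology_classK. Qed.

End HomologyClasses.

(** A criterion on representatives, which serves homology and cohomology alike. *)
Lemma homology_map_isomorphism (A B C A' B' C' : zmodType)
    (f : {additive A -> B}) (g : {additive B -> C})
    (f' : {additive A' -> B'}) (g' : {additive B' -> C'})
    (m : three_term_map f g f' g') :
  (forall z, g z = 0 -> (exists a, f' a = middle_map m z) -> exists a, f a = z) ->
  (forall w, g' w = 0 -> exists a z, g z = 0 /\ w = f' a + middle_map m z) ->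
  is_group_isomorphism (homology_map m).
Proof.
move=> inj surj; apply: additive_bijective => [h|h].
  have [z <-] := homology_class_surj h.
  have gz : g (cycle_val z) = 0 by apply/eqP; exact: cycleP z.
  rewrite /= homology_map_class => /homology_class_eq0 /= /(inj _ gz) fz.
  exact/homology_class_eq0.
have [w <-] := homology_class_surj h.
have g'w : g' (cycle_val w) = 0 by apply/eqP; exact: cycleP w.
have [a [z [gz wE]]] := surj _ g'w.
have zc : z \in is_cycle g by rewrite inE gz.
exists (homology_class f (Cycle zc)); rewrite /= homology_map_class.
apply/eqP; rewrite -subr_eq0 -raddfB; apply/eqP/homology_class_eq0.
by exists (- a); rewrite raddfN /= wE opprD addrCA subrr addr0.
Qed.

(** * Additive extension to integral chains, and evaluation of cochains *)

Section LinearExtension.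
Variables (K : choiceType) (V : zmodType).
Implicit Types (p : K -> V) (c : malg K int).

(** With [V] the coefficient group this evaluates a cochain; with [V] a chain group it extends a map
    given on simplices. *)
Definition lin p c : V := \sum_(k <- msupp c) p k *~ mcoeff k c.

Lemma lin_Ew p (E : {fset K}) c : (msupp c `<=` E)%fset ->
  lin p c = \sum_(k <- E) p k *~ mcoeff k c.
Proof.
move=> cE; apply: big_fset_incl => // k _ kc.
by rewrite mcoeff_outdom// mulr0z.
Qed.

Fact lin_is_zmod_morphism p : zmod_morphism (lin p).
Proof.
move=> c d; pose E := (msupp c `|` msupp d)%fset.
rewrite (@lin_Ew p E (c - d)) ?msuppB_le//.
rewrite (@lin_Ew p E c) ?fsubsetUl// (@lin_Ew p E d) ?fsubsetUr//.
by rewrite -sumrB; apply: eq_bigr => k _; rewrite raddfB mulrzBr.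
Qed.

HB.instance Definition _ p := GRing.isZmodMorphism.Build _ _ (lin p)
  (lin_is_zmod_morphism p).

Lemma linU p k z : lin p (mkmalgU k z) = p k *~ z.
Proof. by rewrite (lin_Ew _ msuppU_le) big_seq_fset1 mcoeffUU. Qed.

Lemma eq_lin p q c : p =1 q -> lin p c = lin q c.
Proof. by move=> pq; apply: eq_bigr => k _; rewrite pq. Qed.

Lemma lin0 c : lin (fun=> 0) c = 0.
Proof. by rewrite /lin big1// => k _; rewrite mul0rz. Qed.

Lemma linD p q c : lin (fun k => p k + q k) c = lin p c + lin q c.
Proof. by rewrite -big_split; apply: eq_bigr => k _; rewrite mulrzDl. Qed.

Lemma linB p q c : lin (fun k => p k - q k) c = lin p c - lin q c.
Proof. by rewrite -sumrB; apply: eq_bigr => k _; rewrite mulrzBl. Qed.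

End LinearExtension.

Lemma raddf_lin (K : choiceType) (V W : zmodType) (F : {additive V -> W})
  (p : K -> V) (c : malg K int) : F (lin p c) = lin (F \o p) c.
Proof. by rewrite raddf_sum; apply: eq_bigr => k _; rewrite raddfMz. Qed.

Lemma lin_unit (K : choiceType) (c : malg K int) : lin (mkmalgU^~ 1) c = c.
Proof.
rewrite [RHS]monalgE; apply: eq_bigr => k _.
by rewrite -raddfMz/= intz.
Qed.

Lemma lin_chain_map (K L : choiceType) (V : zmodType) (p : L -> V) (phi : K -> L)
  (c : malg K int) : lin p (chain_map phi c) = lin (p \o phi) c.
Proof. by rewrite raddf_sum; apply: eq_bigr => k _; rewrite /= linU. Qed.

Section Cochains.
Variables (R : realType) (T : topologicalType).

Lemma lin_bd n (c : sing_chain R int n T) :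
  lin (fun s : sing_simplex R n T => @sing_bd R int n T (mkmalgU s 1)) c = sing_bd c.
Proof. by rewrite -[in RHS](lin_unit c) raddf_lin. Qed.

Lemma sing_cobdE (G : zmodType) n (p : sing_cochain R G n T) (s : sing_simplex R n.+1 T) :
  sing_cobd p s = lin p (@sing_bd R int n.+1 T (mkmalgU s 1)).
Proof.
rewrite raddf_sum; apply: eq_bigr => i _.
by rewrite raddfMz /= chain_mapU linU.
Qed.

Lemma lin_cobd (G : zmodType) n (p : sing_cochain R G n T) (c : sing_chain R int n.+1 T) :
  lin (sing_cobd p) c = lin p (sing_bd c).
Proof. by rewrite -lin_bd raddf_lin; apply: eq_lin => s; exact: sing_cobdE. Qed.

End Cochains.

(** * The integral chain retraction and its dual *)

Section Retraction.
Variables (R : realType) (X : metricType R) (U : set (set X)).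
Local Notation K := (vietoris_complex U).
Local Notation M := (vietoris_thickening U).
Local Notation iota := (sing_map (vietoris_id U)).
Local Notation iotaC := (sing_chain_map (vietoris_id U)).
Local Notation unit s := (mkmalgU s (1 : int)).

Hypothesis Uopen : open_cover U.

(** The second clause prescribes the trivial splitting on simplices from the complex, so that the
    retraction is the identity there. *)
Definition splits n (s : sing_simplex R n M) (c : sing_chain R int n M)
    (ke : sing_chain R int n K * sing_chain R int n.+1 M) : Prop :=
  c = sing_bd ke.2 + iotaC ke.1 /\ forall a, iota a = s -> ke = (unit a, 0).

Definition split_choice n (s : sing_simplex R n M) (c : sing_chain R int n M) :=
  xget (0, 0) [set ke | splits s c ke].

(* [(retraction n).1] is a chain retraction of the singular chains of the thickening
   onto those of the complex, and [(retraction n).2] a homotopy from it to the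
   identity; [correction] is that homotopy applied to the boundary. *)
Fixpoint retraction n : (sing_simplex R n M -> sing_chain R int n K) *
    (sing_simplex R n M -> sing_chain R int n.+1 M) :=
  match n with
  | 0 => (fun s => (split_choice s (unit s)).1, fun s => (split_choice s (unit s)).2)
  | m.+1 =>
    let c s := unit s - lin (retraction m).2 (@sing_bd R int m.+1 M (unit s)) in
    (fun s => (split_choice s (c s)).1, fun s => (split_choice s (c s)).2)
  end.

Definition correction n : sing_simplex R n M -> sing_chain R int n M :=
  if n is m.+1 then fun s => lin (retraction m).2 (@sing_bd R int m.+1 M (unit s))
  else fun=> 0.

Definition retraction_spec n := forall s,
  splits s (unit s - correction s) ((retraction n).1 s, (retraction n).2 s).

Lemma retractionE n s : ((retraction n).1 s, (retraction n).2 s) =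
  split_choice s (unit s - correction s).
Proof. by case: n s => [|n] s; rewrite /= ?subr0 -surjective_pairing. Qed.

Lemma lin_correction n (c : sing_chain R int n M) : sing_bd c = 0 ->
  lin (@correction n) c = 0.
Proof.
case: n c => [|n] c c0; first by rewrite lin0.
rewrite -(raddf0 (lin (retraction n).2)) -c0 -lin_bd raddf_lin.
exact: eq_lin.
Qed.

(** Apply the homotopy identity of degree [n] to the boundary of [s]; the correction of that
    boundary vanishes because it is a cycle. The result comes from the complex, hence is tame, and
    [relative_acyclicity] can be applied in the next degree. *)
Lemma boundary_correction n (s : sing_simplex R n.+1 M) : retraction_spec n ->
  sing_bd (unit s - correction s) =
  iotaC (lin (retraction n).1 (@sing_bd R int n.+1 M (unit s))).
Proof.
move=> spec; rewrite sing_bdB; set b := sing_bd (unit s).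
have -> : @sing_bd R int n.+1 M (correction s) = lin (fun s' =>
    unit s' - correction s' - iotaC ((retraction n).1 s')) b.
  rewrite /correction raddf_lin; apply: eq_lin => s' /=.
  by have [-> _] := spec s'; rewrite addrK.
rewrite !linB lin_unit lin_correction ?sing_bd_bd// subr0 opprB addrCA subrr addr0.
by rewrite raddf_lin.
Qed.

(** The faces of a simplex of the complex also come from the complex, where the homotopy is 0. *)
Lemma correction_iota n (a : sing_simplex R n K) :
  (forall m, (m < n)%N -> retraction_spec m) -> correction (iota a) = 0.
Proof.
case: n a => [//|n] a spec; rewrite /correction.
have -> : @sing_bd R int n.+1 M (unit (iota a)) = iotaC (@sing_bd R int n.+1 K (unit a)).
  by rewrite sing_bd_map /sing_chain_map chain_mapU.
rewrite lin_chain_map -[RHS](lin0 _ (@sing_bd R int n.+1 K (unit a))).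
apply: eq_lin => a'; have [_] := spec n (ltnSn n) (iota a').
by move=> /(_ a' erefl)[].
Qed.

Lemma retractionP n : retraction_spec n.
Proof.
have [m] := ubnP n; elim: m n => // m IHm n; rewrite ltnS => nm.
have spec k : (k < n)%N -> retraction_spec k.
  by move=> kn; apply: IHm; rewrite (leq_trans kn).
move=> s; rewrite retractionE; apply: xgetPex; rewrite /splits.
(* On a simplex from the complex the prescribed splitting is valid, as its correction vanishes, and
   unambiguous, as [iota] is injective. Elsewhere any splitting will do. *)
have [[a <-]|nK] := pselect (exists a, iota a = s).
  exists (unit a, 0); split; last by move=> a' /(@sing_map_inj R X U n) ->.
  by rewrite correction_iota// subr0 raddf0 add0r /sing_chain_map chain_mapU.
have [|e [k ek]] := @relative_acyclicity R X U int n (unit s - correction s) Uopen.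
  case: n => [|n] in s spec nK nm *; first exact: supported0.
  rewrite boundary_correction; last exact: spec.
  exact: tame_sing_chain_map.
by exists (k, e); split=> // a as_; case: nK; exists a.
Qed.

Lemma retraction_iota n (a : sing_simplex R n K) : (retraction n).1 (iota a) = unit a.
Proof. by have [_ /(_ a erefl)[]] := retractionP (iota a). Qed.

Lemma retraction_homotopy n (s : sing_simplex R n M) : unit s =
  correction s + sing_bd ((retraction n).2 s) + iotaC ((retraction n).1 s).
Proof. by have [+ _] := retractionP s; rewrite -addrA => <-; rewrite addrC subrK. Qed.

Lemma retraction_bd n (s : sing_simplex R n.+1 M) : sing_bd ((retraction n.+1).1 s) =
  lin (retraction n).1 (@sing_bd R int n.+1 M (unit s)).
Proof.
apply: (chain_map_inj (@sing_map_inj R X U n)).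
have := boundary_correction s (@retractionP n); rewrite /sing_chain_map => <-.
have [-> _] := retractionP s; rewrite sing_bdD sing_bd_bd add0r.
exact: (sing_bd_map _ ((retraction n.+1).1 s)).
Qed.

Variable G : zmodType.

(** Up to a boundary [w] comes from a chain [k] of the complex, and discarding that boundary does
    not change the boundary of [w]. *)
Lemma chain_injectivity n (z : sing_chain R G n K) (w : sing_chain R G n.+1 M) :
  sing_bd w = iotaC z -> exists k, @sing_bd R G n.+1 K k = z.
Proof.
move=> wz; have [|e [k wE]] := @relative_acyclicity R X U G n.+1 w Uopen.
  by rewrite wz; exact: tame_sing_chain_map.
exists k; apply: (chain_map_inj (@sing_map_inj R X U n)).
rewrite -[RHS]wz wE sing_bdD sing_bd_bd add0r.
exact: (sing_bd_map _ k).
Qed.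

Lemma chain_surjectivity n (w : sing_chain R G n M) : sing_bd w = 0 ->
  exists (e : sing_chain R G n.+1 M) (k : sing_chain R G n K),
    sing_bd k = 0 /\ w = sing_bd e + iotaC k.
Proof.
move=> w0; have [|e [k wE]] := @relative_acyclicity R X U G n w Uopen.
  by rewrite w0; exact: supported0.
exists e, k; split=> //; apply: (chain_map_inj (@sing_map_inj R X U n.-1)).
have -> : chain_map (sing_map (vietoris_id U)) 0 = 0 :> sing_chain R G n.-1 M.
  exact: raddf0.
rewrite -w0 wE sing_bdD sing_bd_bd add0r.
exact: (sing_bd_map _ k).
Qed.

(** Evaluate [p] on the homotopy identity. The boundary term vanishes since [p] is a cocycle; the
    other two exhibit [p] as the coboundary of [p] composed with the homotopy plus [q] composed with
    the retraction. *)
Lemma cochain_injectivity n (p : sing_cochain R G n M) (q : sing_cochain R G n.-1 K) :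
  sing_cobd p = 0 -> sing_cobd_in q = p \o iota ->
  exists a : sing_cochain R G n.-1 M, sing_cobd_in a = p.
Proof.
move=> p0 qp; have pE s : p s =
    lin p (correction s) + lin (p \o iota) ((retraction n).1 s).
  rewrite -[LHS]mulr1z -linU (retraction_homotopy s) !raddfD /=.
  rewrite -lin_cobd p0 lin_chain_map (_ : lin 0 _ = 0) ?addr0//.
  exact: lin0.
case: n => [|n] in p q p0 qp pE *.
  (* In degree 0 the incoming coboundary is zero, so [p] vanishes on the complex and, by [pE],
     everywhere. *)
  exists 0; apply/funext => s; rewrite pE -qp (_ : correction s = 0)//.
  by rewrite (raddf0 (lin p)) add0r; apply: esym; exact: lin0.
exists (fun s => lin p ((retraction n).2 s) + lin q ((retraction n).1 s)).
apply/funext => s; rewrite /sing_cobd_in sing_cobdE linD pE -qp; congr (_ + _).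
  by rewrite /correction raddf_lin.
by rewrite lin_cobd retraction_bd raddf_lin.
Qed.

(** Composition with the retraction preserves cocycles, as it is a chain map, and extends [p], as it
    is the identity on the complex. *)
Lemma cochain_surjectivity n (p : sing_cochain R G n K) : sing_cobd p = 0 ->
  exists z : sing_cochain R G n M, sing_cobd z = 0 /\ z \o iota = p.
Proof.
move=> p0; exists (fun s => lin p ((retraction n).1 s)); split; apply/funext => s /=.
  transitivity (lin (sing_cobd p) ((retraction n.+1).1 s)).
    by rewrite lin_cobd retraction_bd raddf_lin -sing_cobdE.
  by rewrite p0; exact: lin0.
by rewrite retraction_iota linU mulr1z.
Qed.

End Retraction.

Theorem corollary2 (R : realType) (X : metricType R) (U : set (set X))
  (Uopen : open_cover U) (Ubounded : uniformly_bounded U)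
  (G : zmodType) (n : nat) :
  is_group_isomorphism (sing_homology_map R G n (vietoris_id U)) /\
  is_group_isomorphism (sing_cohomology_map R G n (vietoris_id U)).
Proof.
split; apply: homology_map_isomorphism.
- by move=> z _ [w]; exact: chain_injectivity.
- by move=> w; exact: chain_surjectivity.
- by move=> p p0 [q]; exact: cochain_injectivity.
move=> p /(cochain_surjectivity Uopen)[z [z0 zp]].
(* The cocycle [z] restricts to [p] exactly, so the coboundary term can be 0. *)
by exists 0, z; split=> //; rewrite raddf0 add0r.
Qed.
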